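(* Let $\rho_1,\sigma_1$ be density operators on a finite-dimensional Hilbert space and $\rho_2,\sigma_2$ density operators on another finite-dimensional Hilbert space. Fix a constant $\epsilon\in(0,1)$. If $[\rho_2,\sigma_2]=0$, then $$R_n^*(\epsilon)=\frac{D(\rho_1\|\sigma_1)+\sqrt{V(\rho_1\|\sigma_1)/n}\;S_{1/\xi}^{-1}(\epsilon)}{D(\rho_2\|\sigma_2)}+o(1/\sqrt n).$$ For general $\rho_2,\sigma_2$ (not necessarily commuting) the upper bound $$R_n^*(\epsilon)\leq\frac{D(\rho_1\|\sigma_1)+\sqrt{V(\rho_1\|\sigma_1)/n}\;S_{1/\xi}^{-1}(\epsilon)}{D(\rho_2\|\sigma_2)}+o(1/\sqrt n)$$ holds.
   Context: Trace distance $T(\rho,\sigma)=\frac12\|\rho-\sigma\|_1$. For density operators, write $(\rho,\sigma)\succeq_{(\epsilon_\rho,\epsilon_\sigma)}(\rho',\sigma')$ if there is a quantum channel (CPTP map) $\mathcal E$ with $T(\mathcal E(\rho),\rho')\le\epsilon_\rho$ and $T(\mathcal E(\sigma),\sigma')\le\epsilon_\sigma$. For a sequence of errors $\epsilon_n$, $R_n^*(\epsilon_n)$ denotes the largest rate $R_n$ such that $(\rho_1^{\otimes n},\sigma_1^{\otimes n})\succeq_{(\epsilon_n,0)}(\rho_2^{\otimes R_nn},\sigma_2^{\otimes R_nn})$ (with $R_nn$ the number of output copies). Relative entropy $D(\rho\|\sigma)=\mathrm{Tr}\,\rho(\log\rho-\log\sigma)$ and relative entropy variance $V(\rho\|\sigma)=\mathrm{Tr}\,\rho(\log\rho-\log\sigma)^2-D(\rho\|\sigma)^2$.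 The reversibility parameter is $\xi=\frac{V(\rho_1\|\sigma_1)}{D(\rho_1\|\sigma_1)}\Big/\frac{V(\rho_2\|\sigma_2)}{D(\rho_2\|\sigma_2)}$. The sesquinormal cdf is $S_\nu(\mu)=\frac12\inf_{A\geq\Phi}\int_{\mathbb R}|A'(x)-\phi_{\mu,\nu}(x)|\,dx$, infimum over cdfs $A$ pointwise at least the standard normal cdf $\Phi$, with $\phi_{\mu,\nu}$ the normal density of mean $\mu$ and variance $\nu$; $S_\nu^{-1}$ is its inverse cdf. *)

(* Defs.v *)
From HB Require Import structures.
From mathcomp Require Import all_boot all_order all_algebra.
From mathcomp Require Import complex.
From mathcomp Require Import all_classical all_reals all_analysis.
From mathcomp Require mxtens.

Set Implicit Arguments.
Unset Strict Implicit.
Unset Printing Implicit Defensive.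

Import Order.TTheory GRing.Theory Num.Theory.
Import numFieldNormedType.Exports.
Local Open Scope classical_set_scope.
Local Open Scope ring_scope.

Section Quantum.
Variable R : realType.
Local Notation C := (R[i]).

Definition adjmx m n (A : 'M[C]_(m, n)) : 'M[C]_(n, m) := map_mx Num.conj (A^T).

Definition hermitian n (A : 'M[C]_n) : Prop := adjmx A = A.

Definition psd n (A : 'M[C]_n) : Prop :=
  hermitian A /\ forall v : 'rV[C]_n, 0 <= (v *m A *m adjmx v) ord0 ord0.

Definition density n (A : 'M[C]_n) : Prop := psd A /\ \tr A = 1.

Definition supp_le n (rho sigma : 'M[C]_n) : Prop :=
  forall v : 'rV[C]_n, v *m sigma = 0 -> v *m rho = 0.

(* functional calculus for Hermitian matrices via the spectral decomposition
   A = P^-1 diag(lambda) P (P unitary) of mathcomp's spectral.v: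
   f(A) := P^-1 diag(f(lambda)) P *)
Definition mxfun (f : R -> R) n (A : 'M[C]_n) : 'M[C]_n :=
  invmx (spectralmx A) *m
  diag_mx (\row_i (real_complex R (f (complex.Re (spectral_diag A ord0 i))))) *m
  spectralmx A.

(* natural logarithm (convention ln 0 = 0, i.e. log on the support) *)
Definition logmx n (A : 'M[C]_n) : 'M[C]_n := mxfun (@ln R) A.

Definition relent n (rho sigma : 'M[C]_n) : R :=
  complex.Re (\tr (rho *m (logmx rho - logmx sigma))).

Definition relvar n (rho sigma : 'M[C]_n) : R :=
  complex.Re (\tr (rho *m ((logmx rho - logmx sigma) *m (logmx rho - logmx sigma))))
  - relent rho sigma ^+ 2.

Definition trnorm m n (A : 'M[C]_(m, n)) : R :=
  complex.Re (\tr (mxfun Num.sqrt (adjmx A *m A))).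

Definition trdist n (rho sigma : 'M[C]_n) : R := trnorm (rho - sigma) / 2.

Definition blockmx k d (X : 'M[C]_(k * d)) (a b : 'I_k) : 'M[C]_d :=
  \matrix_(x, y) X (mxtens.mxtens_index (a, x)) (mxtens.mxtens_index (b, y)).

(* (id_k (x) E)(X) *)
Definition ampl d1 d2 (E : 'M[C]_d1 -> 'M[C]_d2) k (X : 'M[C]_(k * d1))
  : 'M[C]_(k * d2) :=
  \matrix_(i, j) E (blockmx X (mxtens.mxtens_unindex i).1
                              (mxtens.mxtens_unindex j).1)
                   (mxtens.mxtens_unindex i).2 (mxtens.mxtens_unindex j).2.

Definition is_channel d1 d2 (E : 'M[C]_d1 -> 'M[C]_d2) : Prop :=
  [/\ (forall (c : C) (X Y : 'M[C]_d1), E (c *: X + Y) = c *: E X + E Y),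
      (forall X : 'M[C]_d1, \tr (E X) = \tr X) &
      (forall (k : nat) (X : 'M[C]_(k * d1)), psd X -> psd (ampl E X))].

Definition dominates d1 d2 (rho sigma : 'M[C]_d1) (rho' sigma' : 'M[C]_d2)
  (erho esigma : R) : Prop :=
  exists E : 'M[C]_d1 -> 'M[C]_d2,
    [/\ is_channel E, trdist (E rho) rho' <= erho & trdist (E sigma) sigma' <= esigma].

Definition tpow d (A : 'M[C]_d) (n : nat) : 'M[C]_(d ^ n) := mxtens.ntensmx A n.

Definition Rstar d1 d2 (rho1 sigma1 : 'M[C]_d1) (rho2 sigma2 : 'M[C]_d2)
  (n : nat) (eps : R) : R :=
  sup [set (m%:R / n%:R : R) | m in
        [set m : nat | dominates (tpow rho1 n) (tpow sigma1 n)
                                 (tpow rho2 m) (tpow sigma2 m) eps 0]].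

End Quantum.

Section Sesquinormal.
Variable R : realType.
Local Open Scope ereal_scope.

(* density of N(mu, nu) (nu = variance) *)
Definition phi (mu nu : R) (x : R) : R := normal_pdf mu (Num.sqrt nu) x.

Definition Phi (x : R) : R :=
  fine (\int[@lebesgue_measure R]_(y in `]-oo, x]) (phi 0 1 y)%:E).

(* cdfs A >= Phi, given by their derivative (density) a *)
Definition dominating_density (a : R -> R) : Prop :=
  [/\ measurable_fun setT a, (forall x, (0 <= a x)%R),
      \int[@lebesgue_measure R]_y (a y)%:E = 1 &
      forall x, (Phi x)%:E <= \int[@lebesgue_measure R]_(y in `]-oo, x]) (a y)%:E].

Definition Sesq (nu mu : R) : R :=
  fine (ereal_inf [set (2^-1)%:E * \int[@lebesgue_measure R]_y (`|a y - phi mu nu y|)%:E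
                  | a in dominating_density]).

Definition Sesq_inv (nu eps : R) : R := inf [set mu : R | (eps <= Sesq nu mu)%R].

End Sesquinormal.

(* Main.v *)
(* Everything is reduced to the log-likelihood ratio of a pair of commuting states.  The
   Nussbaum-Szkola distributions have the relative entropy and variance of (rho, sigma) and
   are multiplicative, so their log-likelihood ratio obeys a central limit theorem (proved by
   Stein's method).  Pinching rho^n in the eigenbasis of sigma^n costs only a polynomial
   factor, because sigma^n has polynomially many eigenvalues; hence the measured
   log-likelihood ratio obeys the same limit law, and no quantum test does better.

   Moving the top mass s of a cdf A >= Phi to the far left shows that S_nu(mu) is the
   supremum over t of Phi(t) - Phi((t - mu) / sqrt nu), i.e. the worst violation of the
   threshold tests.

   Converse: pull a threshold test on the output back through the channel and compare it with
   the optimal test on the input.  Achievability: measure the input in the pinching basis,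
   send each quantile bin of the likelihood ratio to a lower quantile bin of the output,
   rescaled to the output distribution, and use the unmatched input mass to make the image of
   sigma exact. *)

Require Import Defs.
From HB Require Import structures.
From mathcomp Require Import all_boot all_order all_algebra.
From mathcomp Require Import complex.
From mathcomp Require Import all_classical all_reals all_analysis.
From mathcomp Require Import measurable_realfun ring lra.
Import Order.TTheory GRing.Theory Num.Theory.
Import numFieldNormedType.Exports.
Local Open Scope classical_set_scope.
Local Open Scope ring_scope.

Set Implicit Arguments.
Unset Strict Implicit.
Unset Printing Implicit Defensive.

(** * Normal and sesquinormal distribution functions *)

(** Origin of the parameter $1/\xi$: if $kD_2 = nD_1+\mu\sqrt{nV_1}$, then $\sqrt{kV_2}$ equals
    $\sqrt\nu\,\sqrt{nV_1}$ up to a bounded error, with $\nu = V_2D_1/(V_1D_2) = 1/\xi$. The output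
    log-likelihood ratio at normal quantile $z$ therefore sits at input quantile $t = \mu+\sqrt\nu
    z$, and comparing the two laws means comparing $\Phi(t)$ with $\Phi((t-\mu)/\sqrt\nu)$.
    Log-likelihoods matter only on the scale $\sqrt n$: polynomial factors, constants and the
    rounding of $k$ shift them by $o(\sqrt n)$ and disappear. Constants multiplying probabilities do
    not disappear, so the quantum test bound is needed with a factor arbitrarily close to 1, which a
    weighted inequality provides at the price of a constant in the threshold. A value $\mu$ strictly
    on one side of $S_\nu^{-1}(\epsilon)$ leaves a fixed slack in probability; it absorbs the errors
    of the limit theorems and lets a fixed finite number of bins suffice. Commutation of the output
    pair enters in the achievability, where the channel prepares mixtures of one fixed
    eigenbasis. *)

HB.lock Definition ncdf {R : realType} (m v x : R) : R :=
  \int[@lebesgue_measure R]_(y in `]-oo, x]) phi m v y.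

Section Gaussian.
Variable R : realType.
Implicit Types m v x t : R.
Local Notation leb := (@lebesgue_measure R).

Local Notation Phi := (@ncdf R 0 1).

Lemma sqrt_neq0 v : 0 < v -> Num.sqrt v != 0.
Proof. by move=> v0; rewrite gt_eqF// sqrtr_gt0. Qed.

Lemma phi_ge0 m v x : 0 <= phi m v x.
Proof. exact: normal_pdf_ge0. Qed.

Lemma phiE m v x : 0 < v ->
  phi m v x = normal_peak (Num.sqrt v) * expR (- (x - m) ^+ 2 / (v *+ 2)).
Proof.
move=> v0; rewrite /phi normal_pdfE ?sqrt_neq0//.
by rewrite /normal_fun sqr_sqrtr// ltW.
Qed.

Lemma phi_gt0 m v x : 0 < v -> 0 < phi m v x.
Proof.
by move=> v0; rewrite phiE// mulr_gt0 ?expR_gt0 ?normal_peak_gt0 ?sqrt_neq0.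
Qed.

Lemma phi_std m v x : 0 < v ->
  phi m v x = phi 0 1 ((x - m) / Num.sqrt v) / Num.sqrt v.
Proof.
move=> v0; rewrite !phiE// mulrAC; congr (_ * expR _).
  rewrite /normal_peak sqrtr1 expr1n mul1r sqr_sqrtr ?ltW//.
  by rewrite -mulrnAr sqrtrM ?ltW// invfM mulrC.
rewrite subr0 expr_div_n sqr_sqrtr ?ltW// -mulr_natr -(mulr_natr 1).
by field; rewrite gt_eqF.
Qed.

Lemma phi01_le1 x : phi 0 1 x <= 1.
Proof.
have s1 : Num.sqrt (1 : R) != 0 by rewrite sqrt_neq0.
apply: (le_trans (normal_pdf_ub 0 x s1)); rewrite /normal_peak sqrtr1 expr1n mul1r.
have p2 := @pi_ge2 R.
have h : (1 : R) <= Num.sqrt (pi *+ 2).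
  by rewrite -{1}(sqrtr1 R) ler_sqrt// -mulr_natr; lra.
by rewrite invf_le1// (lt_le_trans _ h).
Qed.

Lemma measurable_phi m v : measurable_fun setT (phi m v).
Proof. exact: measurable_normal_pdf. Qed.

Lemma integrable_phi m v : leb.-integrable setT (EFin \o phi m v).
Proof. exact: integrable_normal_pdf. Qed.

Lemma continuous_phi m v : 0 < v -> continuous (phi m v).
Proof. by move=> v0; apply: continuous_normal_pdf; rewrite sqrt_neq0. Qed.

Lemma is_derive_phi01 x : is_derive x 1 (phi 0 1) (- x * phi 0 1 x).
Proof.
have -> : phi 0 1 = (fun x : R => normal_peak 1 * expR (- x ^+ 2 / 2)).
  by apply/funext => y; rewrite phiE// sqrtr1 subr0.
apply: is_derive_eq.
by rewrite /GRing.scale/= !mulr1 !mulr0 add0r; field.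
Qed.

Lemma is_derive_ncdf m v x : 0 < v -> is_derive x 1 (ncdf m v) (phi m v x).
Proof.
move=> v0.
have ii : leb.-integrable [set` Interval -oo%O (BRight (x + 1))] (EFin \o phi m v).
  exact: integrableS (integrable_phi m v).
have xx : x < x + 1 by rewrite ltrDl.
rewrite unlock; have [d e] := continuous_FTC1 xx ii (ltNyr x) (@continuous_phi _ _ v0 x).
apply: DeriveDef; first exact: d.
by rewrite -derive1E; exact: e.
Qed.

Lemma EFin_ncdf m v x : (ncdf m v x)%:E = (\int[leb]_(y in `]-oo, x]) (phi m v y)%:E)%E.
Proof.
rewrite unlock /Rintegral fineK//; apply: integrable_fin_num => //.
exact: integrableS (integrable_phi m v).
Qed.

Lemma PhiE : @Defs.Phi R = Phi.
Proof. by rewrite unlock. Qed.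

(** Under the normal law the identity is a random variable with distribution function [ncdf];
    monotonicity and the limits at both infinities then come from the general theory of [cdf]. *)
Let idTR : measurableTypeR R -> R := idfun.

#[local] HB.instance Definition _ :=
  @isMeasurableFun.Build _ _ _ _ idTR (@measurable_id _ _ setT).

Lemma ncdf_cdf m v x :
  (ncdf m v x)%:E = cdf (idTR : {RV (normal_prob m (Num.sqrt v)) >-> R}) x.
Proof. by rewrite EFin_ncdf. Qed.

Lemma ncdf_ge0 m v x : 0 <= ncdf m v x.
Proof. by rewrite -lee_fin ncdf_cdf cdf_ge0. Qed.

Lemma ncdf_le1 m v x : ncdf m v x <= 1.
Proof. by rewrite -lee_fin ncdf_cdf cdf_le1. Qed.

Lemma ncdf_le m v x y : x <= y -> ncdf m v x <= ncdf m v y.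
Proof. by move=> xy; rewrite -lee_fin !ncdf_cdf cdf_nondecreasing. Qed.

Lemma ncdf_cvgy m v : ncdf m v x @[x --> +oo] --> (1 : R).
Proof.
have := cvg_cdfy1 (idTR : {RV (normal_prob m (Num.sqrt v)) >-> R}).
rewrite (_ : cdf _ = EFin \o ncdf m v); last by apply/funext => x; rewrite /= ncdf_cdf.
by move=> /fine_cvgP[].
Qed.

Lemma ncdf_cvgNy m v : ncdf m v x @[x --> -oo] --> (0 : R).
Proof.
have := cvg_cdfNy0 (idTR : {RV (normal_prob m (Num.sqrt v)) >-> R}).
rewrite (_ : cdf _ = EFin \o ncdf m v); last by apply/funext => x; rewrite /= ncdf_cdf.
by move=> /fine_cvgP[].
Qed.

Lemma ncdf_small m v e : 0 < e -> exists M, forall x, x <= M -> ncdf m v x < e.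
Proof.
move=> e0; have /cvgrPdist_lt/(_ _ e0) [M [_ h]] := ncdf_cvgNy m v.
exists (M - 1) => x xM; have xM' : x < M by lra.
by have := h x xM'; rewrite sub0r normrN ger0_norm ?ncdf_ge0.
Qed.

Lemma ncdf_large m v e : 0 < e -> exists M, forall x, M <= x -> 1 - e < ncdf m v x.
Proof.
move=> e0; have /cvgrPdist_lt/(_ _ e0) [M [_ h]] := ncdf_cvgy m v.
exists (M + 1) => x xM; have xM' : M < x by lra.
by have := h x xM'; rewrite ger0_norm ?subr_ge0 ?ncdf_le1//; lra.
Qed.

Lemma continuous_ncdf m v : 0 < v -> continuous (ncdf m v).
Proof.
move=> v0 x; apply: differentiable_continuous; apply/derivable1_diffP.
by have [] := is_derive_ncdf m x v0.
Qed.

Lemma ncdf_lt m v x y : 0 < v -> x < y -> ncdf m v x < ncdf m v y.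
Proof.
move=> v0 xy; rewrite -subr_gt0.
have [|c _ ->] := MVT xy (fun z _ => is_derive_ncdf m z v0).
  by apply: continuous_subspaceT; exact: continuous_ncdf.
by rewrite mulr_gt0 ?phi_gt0// subr_gt0.
Qed.

Lemma ncdf_gt0 m v x : 0 < v -> 0 < ncdf m v x.
Proof.
move=> v0; apply: (le_lt_trans (ncdf_ge0 m v (x - 1))).
by rewrite ncdf_lt// ltrBlDr ltrDl.
Qed.

Lemma ncdf_lt1 m v x : 0 < v -> ncdf m v x < 1.
Proof.
move=> v0; apply: (lt_le_trans _ (ncdf_le1 m v (x + 1))).
by rewrite ncdf_lt// ltrDl.
Qed.

Lemma ncdf_quantile m v p : 0 < v -> 0 < p < 1 -> exists x, ncdf m v x = p.
Proof.
move=> v0 /andP[p0 p1].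
have [a ha] := ncdf_small m v p0.
have q0 : 0 < 1 - p by rewrite subr_gt0.
have [b hb] := ncdf_large m v q0.
have hA := ha _ (lexx a); have hB := hb _ (lexx b).
have ab : a <= b.
  by rewrite leNgt; apply/negP => /ltW/(ncdf_le m v); lra.
have [||x _ <-] := @IVT _ (ncdf m v) a b p ab; last by exists x.
  by apply: continuous_subspaceT; exact: continuous_ncdf.
by rewrite ge_min le_max (ltW hA) /=; apply/orP; right; lra.
Qed.

(** Both sides have the same derivative and tend to 0 at minus infinity, so their difference is a
    vanishing constant; this replaces a change of variables in the integral. [Phi_sym] uses the same
    device. *)
Lemma ncdf_std m v x : 0 < v -> ncdf m v x = Phi ((x - m) / Num.sqrt v).
Proof.
move=> v0; set s := Num.sqrt v.
have s0 : 0 < s by rewrite sqrtr_gt0.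
pose g (x : R) := ncdf m v x - ncdf 0 1 ((x - m) / s).
have dg (y : R) : is_derive y 1 g 0.
  have d1 := is_derive_ncdf m y v0.
  have d2 := is_derive_ncdf 0 ((y - m) / s) (@ltr01 R).
  have d3 : is_derive y 1 (fun x : R => (x - m) / s) s^-1.
    by apply: is_derive_eq; rewrite /GRing.scale/= subr0 mulr0 add0r mulr1.
  have d4 := @is_derive1_comp R (ncdf 0 1) (fun x : R => (x - m) / s) y _ _ d2 d3.
  rewrite /g; apply: (is_derive_eq (is_deriveB d1 d4)).
  by rewrite phi_std// -/s mulrC subrr.
suff g0 : g x = 0 by apply/eqP; rewrite -subr_eq0; apply/eqP.
apply/eqP; rewrite -normr_le0 leNgt; apply/negP => gx0.
have gx2 : 0 < `|g x| / 2 by rewrite divr_gt0.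
have [M1 h1] := ncdf_small m v gx2.
have [M2 h2] := ncdf_small 0 1 gx2.
have [y y1 y2] : exists2 y : R, y <= M1 & (y - m) / s <= M2.
  exists (Num.min M1 (s * M2 + m)); first by rewrite ge_min lexx.
  by rewrite ler_pdivrMr// lerBlDr mulrC ge_min lexx orbT.
have gy : `|g y| < `|g x|.
  apply: (le_lt_trans (ler_normB _ _)).
  have := h1 _ y1; have := h2 _ y2; have := ncdf_ge0 m v y.
  have := ncdf_ge0 0 1 ((y - m) / s); move: (ncdf m v y) (ncdf 0 1 _) `|g x| => a b c.
  by move=> a0 b0; rewrite !ger0_norm//; lra.
by move: gy; rewrite (is_derive_0_is_cst y x dg) ltxx.
Qed.

(** Mills' ratio bound. On the negative half-line $\phi(y)/(-y)-\Phi(y)$ has derivative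
    $\phi(y)/y^2\ge 0$. A negative value at [x] would bound it away from 0 on the whole left tail,
    where $\Phi$ vanishes and the other term is nonnegative. *)
Lemma mills_left x : x < 0 -> - x * Phi x <= phi 0 1 x.
Proof.
move=> x0; rewrite -ler_pdivlMl ?oppr_gt0// leNgt; apply/negP => H.
pose g (y : R) := phi 0 1 y * (- y)^-1 - ncdf 0 1 y.
have dg (y : R) : y < 0 -> is_derive y 1 g (phi 0 1 y * (y ^- 2)).
  move=> y0; have d1 := is_derive_ncdf 0 y (@ltr01 R).
  have d2 := is_derive_phi01 y.
  have ny0 : - y != 0 by rewrite oppr_eq0 lt_eqF.
  have d3 : is_derive y 1 (fun z : R => (- z)^-1) (y ^- 2).
    have := is_deriveV ny0 (is_deriveN (is_derive_id y 1)).
    by move=> h; apply: is_derive_eq; rewrite /GRing.scale/= sqrrN mulrN1 opprK.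
  rewrite /g; apply: (is_derive_eq (is_deriveB (is_deriveM d2 d3) d1)).
  by rewrite /GRing.scale/=; field; rewrite lt_eqF.
have gle y z : y < z -> z < 0 -> g y <= g z.
  move=> yz z0; rewrite -subr_ge0.
  have sub u : u \in `[y, z] -> u < 0.
    by rewrite in_itv/= => /andP[_ uz]; exact: le_lt_trans z0.
  have [||c _ ->] := @MVT R g (fun u => phi 0 1 u * (u ^- 2)) y z yz.
  - by move=> u uyz; apply: dg; apply: sub; exact: subset_itv_oo_cc.
  - apply: derivable_within_continuous => u /sub u0.
    by have [] := dg _ u0.
  by rewrite !mulr_ge0 ?phi_ge0 ?invr_ge0 ?sqr_ge0// subr_ge0 ltW.
have gx : g x < 0 by rewrite /g subr_lt0 mulrC.
have ngx : 0 < - g x by rewrite oppr_gt0.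
have [M hM] := ncdf_small 0 1 ngx.
pose y := Num.min M (x - 1).
have yx : y < x by rewrite gt_min; apply/orP; right; rewrite ltrBlDr ltrDl.
have := hM y; rewrite ge_min lexx => /(_ isT).
have := gle _ _ yx x0.
have : 0 <= phi 0 1 y * (- y)^-1.
  by rewrite mulr_ge0 ?phi_ge0// invr_ge0 oppr_ge0 (ltW (lt_trans yx _)).
rewrite /g; lra.
Qed.

Lemma phi01_sym x : phi 0 1 (- x) = phi 0 1 x :> R.
Proof. by rewrite !phiE// !subr0 sqrrN. Qed.

Lemma Phi_sym x : Phi (- x) = 1 - Phi x :> R.
Proof.
pose g (x : R) := ncdf 0 1 x + ncdf 0 1 (- x).
have dg (y : R) : is_derive y 1 g 0.
  have d1 := is_derive_ncdf 0 y (@ltr01 R).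
  have d2 := is_derive_ncdf 0 (- y) (@ltr01 R).
  have d3 : is_derive y 1 (fun x : R => - x) (- 1) by apply: is_derive_eq.
  have d4 := @is_derive1_comp R (ncdf 0 1) (fun x : R => - x) y _ _ d2 d3.
  rewrite /g; apply: (is_derive_eq (is_deriveD d1 d4)).
  by rewrite phi01_sym mulrN1 subrr.
suff g1 : g x = 1 by move: g1; rewrite /g; lra.
apply/eqP; rewrite -subr_eq0 -normr_le0 leNgt; apply/negP => gx0.
have gx2 : 0 < `|g x - 1| / 2 by rewrite divr_gt0.
have [M1 h1] := ncdf_small 0 1 gx2.
have [M2 h2] := ncdf_large 0 1 gx2.
have [y h3 h4] : exists2 y, M2 <= y & - y <= M1.
  exists (Num.max M2 (- M1)); first by rewrite le_max lexx.
  by rewrite lerNl le_max lexx orbT.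
have gyx : g y = g x by exact: is_derive_0_is_cst.
have := h2 _ h3; have := h1 _ h4; have := ncdf_ge0 0 1 (- y); have := ncdf_le1 0 1 y.
move: gx0; rewrite -gyx /g => {h1 h2 gx2 gyx dg g}.
move: (ncdf 0 1 y) (ncdf 0 1 (- y)) => a b.
by case: (ltrP (a + b - 1) 0) => ab; [rewrite (ltr0_norm ab)|rewrite (ger0_norm ab)]; lra.
Qed.

Lemma mills_right x : 0 < x -> x * (1 - Phi x) <= phi 0 1 x.
Proof.
move=> x0; have := @mills_left (- x); rewrite oppr_lt0 opprK Phi_sym phi01_sym.
exact.
Qed.

Lemma Phi_lip x y : `|Phi x - Phi y| <= `|x - y| :> R.
Proof.
wlog yx : x y / y < x => [h|].
  have [xy|yx|->] := ltgtP x y; first by rewrite distrC (distrC x); exact: h.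
    exact: h.
  by rewrite !subrr normr0.
have [|c _ ->] := MVT yx (fun z _ => is_derive_ncdf 0 z (@ltr01 R)).
  by apply: continuous_subspaceT; exact: continuous_ncdf.
rewrite normrM ler_piMl// ger0_norm ?phi_ge0//; exact: phi01_le1.
Qed.

(** * Stein's equation for a smoothed half-line indicator *)

Definition pos (u : R) : R := Num.max 0 u.

Lemma posP (u : R) : (u <= 0 /\ pos u = 0) \/ (0 <= u /\ pos u = u).
Proof. by rewrite /pos; case: (leP 0 u) => h; [right|left; split => //; exact: ltW]. Qed.

(** The square of a positive part has a kink in its derivative; a quadratic remainder bound turns
    its differentiability into an inequality that is checked sign by sign. *)
Lemma is_derive_quad (f : R -> R) (x l K : R) :
  (forall h, `|f (x + h) - f x - h * l| <= K * h ^+ 2) -> is_derive x 1 f l.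
Proof.
move=> H; have K0 : 0 <= K.
  by have := H 1; rewrite expr1n mulr1; apply: le_trans.
have c : h^-1 *: (f (h *: (1 : R^o) + x) - f x) @[h --> 0^'] --> l.
  apply/cvgrPdist_le => e e0; near=> h.
  have h0 : h != 0 by near: h; exact: nbhs_dnbhs_neq.
  have hK : `|h| * (K + 1) <= e.
    rewrite -ler_pdivlMr ?ltr_wpDl//; near: h; apply: dnbhs0_le.
    by rewrite divr_gt0// ltr_wpDl.
  rewrite /GRing.scale/= mulr1 [h + x]addrC distrC.
  have -> : h^-1 * (f (x + h) - f x) - l = h^-1 * (f (x + h) - f x - h * l).
    by field.
  rewrite normrM normfV ler_pdivrMl ?normr_gt0//.
  apply: (le_trans (H h)); rewrite -real_normK ?num_real// expr2 mulrCA.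
  rewrite ler_wpM2l// (le_trans _ hK)// mulrC ler_wpM2l//; lra.
apply: DeriveDef; first by apply/cvg_ex; exists l; exact: c.
by apply/cvg_lim => //; exact: c.
Unshelve. all: by end_near. Qed.

Lemma is_derive_sqpos x : is_derive x 1 (fun u => pos u ^+ 2) (2 * pos x).
Proof.
apply: (@is_derive_quad _ _ _ 1) => h; rewrite mul1r ler_norml.
by case: (posP (x + h)) => -[? ->]; case: (posP x) => -[? ->]; apply/andP; split; nra.
Qed.

(** For [0 <= p], the primitive vanishing at 0 of the cutoff [soft_step p d], which is 1 up to [p],
    0 from [p + d] on and linear between. The variable is the quantile [u = Phi x], in which the
    normal law is uniform on $[0,1]$, so the cutoff has mean [p + d / 2] when its window lies in
    $[0,1]$. *)
Definition soft_min (p d u : R) : R := u - (pos (u - p) ^+ 2 - pos (u - p - d) ^+ 2) / (2 * d).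
Definition soft_step (p d u : R) : R := 1 - (pos (u - p) - pos (u - p - d)) / d.
Lemma is_derive_soft_min (p d u : R) : 0 < d -> is_derive u 1 (soft_min p d) (soft_step p d u).
Proof.
move=> d0.
have d1 : is_derive u 1 (fun v => pos (v - p) ^+ 2) (2 * pos (u - p)).
  have e : is_derive u 1 (fun v : R => v - p) 1.
    by apply: is_derive_eq; rewrite subr0.
  have := @is_derive1_comp R (fun w => pos w ^+ 2) (fun v => v - p) u _ _ (is_derive_sqpos (u - p)) e.
  by rewrite mulr1.
have d2 : is_derive u 1 (fun v => pos (v - p - d) ^+ 2) (2 * pos (u - p - d)).
  have e : is_derive u 1 (fun v : R => v - p - d) 1.
    by apply: is_derive_eq; rewrite !subr0.
  have := @is_derive1_comp R (fun w => pos w ^+ 2) (fun v => v - p - d) u _ _ (is_derive_sqpos (u - p - d)) e.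
  by rewrite mulr1.
apply: is_derive_eq; rewrite /soft_step /GRing.scale/= !mulr0 add0r.
by field; rewrite gt_eqF.
Qed.

Lemma soft_stepP (p d u : R) : 0 < d -> [/\ 0 <= soft_step p d u <= 1, u <= p -> soft_step p d u = 1 & p + d <= u -> soft_step p d u = 0].
Proof.
move=> d0.
have e : soft_step p d u * d = d - (pos (u - p) - pos (u - p - d)).
  by rewrite /soft_step; field; rewrite gt_eqF.
have [H1 H2 H3] : [/\ 0 <= soft_step p d u * d <= d, u <= p -> soft_step p d u * d = d & p + d <= u -> soft_step p d u * d = 0].
  rewrite e; case: (posP (u - p)) => -[? ->]; case: (posP (u - p - d)) => -[? ->];
    (split; [apply/andP; split|move=> ?|move=> ?]); lra.
split.
- move: H1; rewrite pmulr_lge0// => /andP[-> H]; rewrite -(ler_pM2r d0) mul1r; exact: H.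
- by move=> /H2 h; apply: (mulIf (lt0r_neq0 d0)); rewrite mul1r.
- by move=> /H3 h; apply: (mulIf (lt0r_neq0 d0)); rewrite mul0r.
Qed.

Lemma soft_step_lip (p d u v : R) : 0 < d -> `|soft_step p d u - soft_step p d v| <= `|u - v| / d.
Proof.
move=> d0.
rewrite ler_pdivlMr// -[X in _ * X <= _](gtr0_norm d0) -normrM.
have -> : (soft_step p d u - soft_step p d v) * d = pos (v - p) - pos (v - p - d) - (pos (u - p) - pos (u - p - d)).
  by rewrite /soft_step; field; rewrite gt_eqF.
wlog uv : u v / u <= v => [h|].
  by case/orP: (le_total u v) => /h//; rewrite distrC (distrC v).
rewrite (distrC u) (ger0_norm (_ : 0 <= v - u)) ?subr_ge0// ler_norml.
case: (posP (u - p)) => -[? ->]; case: (posP (u - p - d)) => -[? ->];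
case: (posP (v - p)) => -[? ->]; case: (posP (v - p - d)) => -[? ->];
  (apply/andP; split); lra.
Qed.

(** The difference vanishes at [u = 0] and at [u = 1], and its slope lies in $[-1,1]$. The first
    bound serves the left tail in Stein's equation, the second the right tail. *)
Lemma soft_min_bound (p d u : R) (c := p + d / 2) : 0 <= p -> 0 < d -> p + d <= 1 -> 0 <= u <= 1 -> `|soft_min p d u - c * u| <= u /\ `|soft_min p d u - c * u| <= 1 - u.
Proof.
move=> p0 d0 pd1 /andP[u0 u1].
have [Q e [Q0 Q1 Q2 Q3]] : exists2 Q, soft_min p d u = u - Q / (2 * d) &
    [/\ 0 <= Q, Q <= u * (2 * d), (u - c) * (2 * d) <= Q & Q <= (1 - c) * (2 * d)].
  exists (pos (u - p) ^+ 2 - pos (u - p - d) ^+ 2) => //; rewrite /c.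
  have dd := mulr_ge0 (ltW d0) (ltW d0); have d1 : 0 <= d * (1 - p - d) by rewrite mulr_ge0; lra.
  have du : 0 <= d * (1 - u) by rewrite mulr_ge0; lra.
  have dp : 0 <= d * p by rewrite mulr_ge0; lra.
  have uu : 0 <= d * u by rewrite mulr_ge0; lra.
  case: (posP (u - p)) => -[? ->]; case: (posP (u - p - d)) => -[? ->].
  - have dpu : 0 <= d * (p - u) by rewrite mulr_ge0; lra.
    split; lra.
  - lra.
  - have w1 : 0 <= (u - p) * (d - (u - p)) by rewrite mulr_ge0; lra.
    have w2 : 0 <= d * (d - (u - p)) by rewrite mulr_ge0; lra.
    have w3 := sqr_ge0 (u - p - d); have w4 := sqr_ge0 (u - p).
    split; lra.
  - have w3 : 0 <= d * (u - p - d) by rewrite mulr_ge0; lra.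
    split; lra.
have dd : 0 < 2 * d by rewrite mulr_gt0.
have [c0 c1] : 0 <= c /\ c <= 1 by rewrite /c; split; lra.
have H0 : 0 <= Q / (2 * d) by rewrite divr_ge0 ?(ltW dd).
rewrite -ler_pdivrMr// in Q1; rewrite -ler_pdivlMr// in Q2; rewrite -ler_pdivrMr// in Q3.
rewrite e; move: Q1 Q2 Q3; move: (Q / (2 * d)) H0 => {e} q q0 q1 q2 q3.
have cu : 0 <= c * u by rewrite mulr_ge0.
have cu1 : 0 <= (1 - c) * u by rewrite mulr_ge0//; lra.
have cu2 : 0 <= (1 - c) * (1 - u) by rewrite mulr_ge0//; lra.
have cu3 : 0 <= c * (1 - u) by rewrite mulr_ge0//; lra.
by split; rewrite ler_norml; apply/andP; (split; lra).
Qed.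

(** With $c$ the normal mean of the smoothed indicator $h$, the function
    $f(x)=\phi(x)^{-1}\int_{-\infty}^x (h-c)\phi$ solves $f'-xf=h-c$, and the integral is explicit
    in the quantile variable. Here [g] is $f'$, tied to [f] by a mean value property. A Lipschitz
    constant on bounded sets is enough, since the second moment controls the tails. *)
Lemma stein_solution (p d : R) (c := p + d / 2) : 0 <= p -> 0 < d -> p + d <= 1 -> exists f g h : R -> R,
  [/\ forall x, g x = x * f x + h x - c,
      forall x, `|g x| <= 2,
      forall M : R, exists2 K : R, 0 <= K & forall x y : R, `|x| <= M -> `|y| <= M ->
        `|g x - g y| <= K * `|x - y|,
      forall x y : R, exists2 z : R, `|z - x| <= `|y - x| & f y - f x = g z * (y - x) &
      [/\ forall x, 0 <= h x <= 1, forall x, Phi x <= p -> h x = 1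
        & forall x, p + d <= Phi x -> h x = 0]].
Proof.
move=> p0 d0 pd1.
pose f x := (soft_min p d (Phi x) - c * Phi x) / phi 0 1 x.
pose h x := soft_step p d (Phi x).
pose g x := x * f x + h x - c.
have f0 : forall x : R, phi 0 1 x != 0 by move=> x; rewrite gt_eqF// phi_gt0.
have u01 x : 0 <= (Phi x : R) <= 1 by rewrite ncdf_ge0 ncdf_le1.
have df (x : R) : is_derive x 1 f (g x).
  have d1 : is_derive x 1 Phi (phi 0 1 x) by exact: is_derive_ncdf.
  have d2 := is_derive1_comp (is_derive_soft_min p (Phi x) d0) d1.
  have d3 := is_deriveV (f0 x) (is_derive_phi01 x).
  have d4 := is_deriveM (is_deriveB d2 (is_deriveM (is_derive_cst c x 1) d1)) d3.
  apply: (is_derive_eq d4); rewrite /g /f /h /GRing.scale/= mulr0 addr0.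
  rewrite -[(_ - _) x]/(soft_min p d (Phi x) - c * Phi x).
  by field; exact: f0.
(* Mills' inequality on the side of [x] cancels the division by the density. *)
have xf x : `|x * f x| <= 1.
  have [B1 B2] := soft_min_bound p0 d0 pd1 (u01 x).
  rewrite /f mulrA normrM normfV (gtr0_norm (phi_gt0 0 x (@ltr01 R))).
  rewrite ler_pdivrMr ?phi_gt0// mul1r normrM.
  have [x0|x0|->] := ltgtP x 0.
  - apply: (le_trans _ (mills_left x0)); rewrite ltr0_norm// ler_wpM2l//.
    by rewrite oppr_ge0 ltW.
  - apply: (le_trans _ (mills_right x0)); rewrite gtr0_norm// ler_wpM2l//.
    exact: ltW.
  - by rewrite normr0 mul0r phi_ge0.
have c1 : 0 <= c <= 1 by rewrite /c; apply/andP; split; lra.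
have g2 x : `|g x| <= 2.
  rewrite /g -addrA; apply: (le_trans (ler_normD _ _)).
  have -> : (2 : R) = 1 + 1 by [].
  apply: lerD => //.
  by have [/andP[? ?] _ _] := soft_stepP p (Phi x) d0; rewrite /h ler_norml; apply/andP; split; lra.
have mvt x y : exists2 z, `|z - x| <= `|y - x| & f y - f x = g z * (y - x).
  have cf a b : {within `[a, b], continuous f}.
    by apply: derivable_within_continuous => u _; have [] := df u.
  have [xy|yx|->] := ltgtP x y.
  - have [z zxy e] := MVT xy (fun z _ => df z) (cf _ _).
    exists z => //; move: zxy; rewrite in_itv/= => /andP[? ?].
    by rewrite !ger0_norm; lra.
  - have [z zxy e] := MVT yx (fun z _ => df z) (cf _ _).
    exists z; last by rewrite -opprB e -mulrN opprB.
    move: zxy; rewrite in_itv/= => /andP[? ?].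
    by rewrite !ler0_norm; lra.
  - by exists y => //; rewrite !subrr mulr0.
have flip x y : `|f x - f y| <= 2 * `|x - y|.
  by have [z _ ->] := mvt y x; rewrite normrM ler_wpM2r.
exists f, g, h; split => //.
- move=> M; exists (`|f 0| + 4 * `|M| + d^-1).
    by rewrite !addr_ge0// ?mulr_ge0// invr_ge0 ltW.
  move=> x y xM yM.
  have -> : g x - g y = (x * (f x - f y) + (x - y) * f y) + (h x - h y).
    by rewrite /g; ring.
  rewrite [leRHS]mulrDl; apply: (le_trans (ler_normD _ _)); apply: lerD; last first.
    rewrite mulrC /h; apply: (le_trans (soft_step_lip _ _ _ d0)).
    by rewrite ler_wpM2r ?invr_ge0 ?(ltW d0)// Phi_lip.
  have M0 : 0 <= M by apply: le_trans xM.
  apply: (le_trans (ler_normD _ _)); rewrite (normrM x) (normrM (x - y)) (ger0_norm M0).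
  have H1 : `|x| * `|f x - f y| <= M * (2 * `|x - y|) by rewrite ler_pM.
  have H2 : `|f y| <= `|f 0| + 2 * M.
    have := ler_normD (f y - f 0) (f 0); rewrite subrK => H; apply: (le_trans H).
    rewrite addrC lerD2l (le_trans (flip _ _))// subr0 ler_wpM2l//.
  have H3 : `|x - y| * `|f y| <= `|x - y| * (`|f 0| + 2 * M) by rewrite ler_wpM2l.
  by lra.
- split => x.
  + by have [] := soft_stepP p (Phi x) d0.
  + by have [_ + _] := soft_stepP p (Phi x) d0; apply.
  + by have [_ _ +] := soft_stepP p (Phi x) d0; apply.
Qed.

(** The masses are equal, so the excess of [a] over [b] on [D] reappears as a deficit on the
    complement and is counted twice in the L1 distance. *)
Lemma half_L1_ge_diff (a b : R -> R) (D : set R) : measurable D ->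
  measurable_fun setT a -> (forall x, 0 <= a x) -> (\int[leb]_y (a y)%:E = 1)%E ->
  measurable_fun setT b -> (forall x, 0 <= b x) -> (\int[leb]_y (b y)%:E = 1)%E ->
  (\int[leb]_(y in D) (a y)%:E - \int[leb]_(y in D) (b y)%:E
    <= (2^-1)%:E * \int[leb]_y (`|a y - b y|)%:E)%E.
Proof.
move=> mD ma a0 ia mb b0 ib; pose e (y : R) : R := `|a y - b y|.
have me : measurable_fun setT e by apply: measurableT_comp => //; exact: measurable_funB.
have split_int (f : R -> R) : measurable_fun setT f -> (forall x, 0 <= f x) ->
    (\int[leb]_y (f y)%:E = \int[leb]_(y in D) (f y)%:E + \int[leb]_(y in ~` D) (f y)%:E)%E.
  move=> mf f0; rewrite -(setUv D) ge0_integral_setU//.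
  - exact: measurableC.
  - by apply: measurable_funTS; apply/measurable_EFinP.
  - by move=> x _; rewrite lee_fin.
  - by apply/disj_setPS; rewrite setICr.
have int_ge0 (f : R -> R) (E : set R) : (forall x, 0 <= f x) -> (0 <= \int[leb]_(y in E) (f y)%:E)%E.
  by move=> f0; apply: integral_ge0 => x _; rewrite lee_fin.
have tri (f g : R -> R) (E : set R) : measurable E -> measurable_fun setT f -> measurable_fun setT g ->
    (forall x, 0 <= f x) -> (forall x, 0 <= g x) -> (forall x, f x <= g x + e x) ->
    (\int[leb]_(y in E) (f y)%:E <= \int[leb]_(y in E) (g y)%:E + \int[leb]_(y in E) (e y)%:E)%E.
  move=> mE mf mg f0 g0 fg; rewrite -ge0_integralD//.
  - apply: ge0_le_integral => //.
    + by move=> x _; rewrite lee_fin.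
    + by apply: measurable_funTS; apply/measurable_EFinP.
    + by apply: measurable_funTS; apply/measurable_EFinP; exact: measurable_funD.
    + by move=> x _; rewrite -EFinD lee_fin.
  - by move=> x _; rewrite lee_fin.
  - by apply: measurable_funTS; apply/measurable_EFinP.
  - by move=> x _; rewrite lee_fin normr_ge0.
  - by apply: measurable_funTS; apply/measurable_EFinP.
have T1 := tri a b D mD ma mb a0 b0 (fun x => _).
have T2 := tri b a (~` D) (measurableC mD) mb ma b0 a0 (fun x => _).
have {T1}T1 : (\int[leb]_(y in D) (a y)%:E <= \int[leb]_(y in D) (b y)%:E + \int[leb]_(y in D) (e y)%:E)%E.
  by apply: T1 => x; rewrite /e; have := ler_norm (a x - b x); lra.
have {T2}T2 : (\int[leb]_(y in ~` D) (b y)%:E <= \int[leb]_(y in ~` D) (a y)%:E + \int[leb]_(y in ~` D) (e y)%:E)%E.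
  by apply: T2 => x; rewrite /e distrC; have := ler_norm (b x - a x); lra.
move: T1 T2 ia ib; rewrite (split_int a)// (split_int b)// (split_int e)//; last by move=> x; exact: normr_ge0.
have e0 x : 0 <= e x by exact: normr_ge0.
move: (int_ge0 a D a0) (int_ge0 a (~` D) a0) (int_ge0 b D b0) (int_ge0 b (~` D) b0) (int_ge0 e D e0) (int_ge0 e (~` D) e0).
move: (\int[leb]_(y in D) (a y)%:E)%E (\int[leb]_(y in ~` D) (a y)%:E)%E
  (\int[leb]_(y in D) (b y)%:E)%E (\int[leb]_(y in ~` D) (b y)%:E)%E
  (\int[leb]_(y in D) (e y)%:E)%E (\int[leb]_(y in ~` D) (e y)%:E)%E.
have half_infty : ((2^-1 : R)%:E * +oo = +oo)%E by rewrite gt0_muley// lte_fin invr_gt0.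
move=> [A1| |] [A2| |] [B1| |] [B2| |] //; move=> [E1| |] [E2| |] //;
  rewrite ?(addey, addye)// ?half_infty ?leey// -?EFinD -?EFinM -?EFinB ?lee_fin.
by move=> ? ? ? ? ? ? ? ? [?] [?]; lra.
Qed.

Lemma int_phi01 m v : (\int[leb]_y (phi m v y)%:E = 1)%E.
Proof. exact: integral_normal_pdf. Qed.

Definition Sesq_obj nu mu (a : R -> R) : \bar R :=
  ((2^-1)%:E * \int[leb]_y (`|a y - phi mu nu y|)%:E)%E.

Lemma Sesq_obj_ge0 nu mu a : (0 <= Sesq_obj nu mu a)%E.
Proof.
rewrite /Sesq_obj mule_ge0// ?lee_fin ?invr_ge0//.
by apply: integral_ge0 => x _; rewrite lee_fin.
Qed.

Lemma Sesq_le_obj nu mu a r : dominating_density a ->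
  (Sesq_obj nu mu a <= r%:E)%E -> Sesq nu mu <= r.
Proof.
move=> da ar; rewrite /Sesq; set S := ereal_inf _.
have S0 : (0 <= S)%E by apply: le_ereal_inf_tmp => _ [b _ <-]; exact: Sesq_obj_ge0.
have Sr : (S <= r%:E)%E.
  apply: le_trans ar; apply: ge_ereal_inf; exists (Sesq_obj nu mu a) => //.
  by exists a.
have fS : S \is a fin_num by rewrite ge0_fin_numE// (le_lt_trans Sr) ?ltry.
by rewrite -lee_fin fineK.
Qed.
End Gaussian.

(** * The sesquinormal distribution in terms of threshold tests *)

Section SesquinormalTheory.
Variable R : realType.
Implicit Types nu mu s t eps : R.
Local Notation leb := (@lebesgue_measure R).
Local Notation Phi := (@ncdf R 0 1).

(** A cdf above [Phi] is at least [Phi t] at [t], and the half-line up to [t] then bounds its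
    distance to the normal law from below. *)
Lemma ncdf_le_Sesq nu mu t : 0 < nu -> Phi t - ncdf mu nu t <= Sesq nu mu.
Proof.
move=> nu0; rewrite /Sesq; set S := ereal_inf _.
have dphi : dominating_density (@phi R 0 1).
  split; [exact: measurable_phi|by move=> x; exact: phi_ge0|exact: int_phi01|].
  by move=> x; rewrite PhiE EFin_ncdf.
have lS : ((Phi t - ncdf mu nu t)%:E <= S)%E.
  apply: le_ereal_inf_tmp => _ [a [ma a0 ia aPhi] <-].
  have := @half_L1_ge_diff R a (phi mu nu) _ (measurable_itv `]-oo, t]) ma a0 ia
    (measurable_phi mu nu) (fun x => phi_ge0 mu nu x) (int_phi01 mu nu).
  apply: le_trans; rewrite EFinB -[X in (_ <= _ - X)%E]EFin_ncdf.
  by rewrite leeD2r// -PhiE.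
have S0 : (0 <= S)%E by apply: le_ereal_inf_tmp => _ [b _ <-]; exact: Sesq_obj_ge0.
(* [fine] sends an infinite value to 0, so the infimum has to be shown finite; the standard normal
   density is itself admissible. *)
rewrite -lee_fin fineK// ge0_fin_numE//.
apply: (@le_lt_trans _ _ (Sesq_obj nu mu (phi 0 1))).
  by apply: ge_ereal_inf; exists (Sesq_obj nu mu (phi 0 1)) => //; exists (phi 0 1).
apply: (@le_lt_trans _ _ ((2^-1)%:E * (\int[leb]_y ((phi 0 1 y)%:E + (phi mu nu y)%:E)))%E).
  rewrite lee_wpmul2l ?lee_fin ?invr_ge0//; apply: ge0_le_integral => //.
  - apply/measurable_EFinP; apply: measurableT_comp => //.
    by apply: measurable_funB; exact: measurable_phi.
  - by apply/measurable_EFinP; apply: measurable_funD; exact: measurable_phi.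
  - move=> x _; rewrite -EFinD lee_fin (le_trans (ler_normB _ _))//.
    by rewrite !ger0_norm ?phi_ge0.
rewrite ge0_integralD//.
- by rewrite !int_phi01 -EFinD -EFinM ltry.
- by move=> x _; rewrite lee_fin phi_ge0.
- by apply/measurable_EFinP; exact: measurable_phi.
- by move=> x _; rewrite lee_fin phi_ge0.
- by apply/measurable_EFinP; exact: measurable_phi.
Qed.

(* The density cuts the top mass [s] off N(mu, nu) and replaces it by the lowest
   mass [s] of the standard normal. *)
Lemma Sesq_le nu mu s : 0 < nu -> 0 < s < 1 ->
  (forall t, Phi t - ncdf mu nu t <= s) -> Sesq nu mu <= s.
Proof.
move=> nu0 s01 H.
have s01' : 0 < 1 - s < 1 by lra.
have [c hc] := ncdf_quantile mu nu0 s01'.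
have [y hy] := ncdf_quantile 0 (@ltr01 R) s01.
pose b1 := phi mu nu \_ `]-oo, c]; pose b2 := phi 0 1 \_ `]-oo, y].
pose a x := b1 x + b2 x.
have b10 x : 0 <= b1 x by rewrite /b1 patchE; case: ifP => // _; exact: phi_ge0.
have b20 x : 0 <= b2 x by rewrite /b2 patchE; case: ifP => // _; exact: phi_ge0.
have mb1 : measurable_fun setT b1.
  apply/(measurable_restrict _ (measurable_itv _) measurableT).
  by apply: measurable_funTS; exact: measurable_phi.
have mb2 : measurable_fun setT b2.
  apply/(measurable_restrict _ (measurable_itv _) measurableT).
  by apply: measurable_funTS; exact: measurable_phi.
have intb m v z (D : set R) : (\int[leb]_(x in D) ((phi m v \_ `]-oo, z]) x)%:E =
    \int[leb]_(x in D `&` `]-oo, z]) (phi m v x)%:E)%E.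
  rewrite integral_mkcondr; apply: eq_integral => x _.
  by rewrite !patchE; case: ifP.
have inta (D : set R) : measurable D -> (\int[leb]_(x in D) (a x)%:E =
    \int[leb]_(x in D `&` `]-oo, c]) (phi mu nu x)%:E +
    \int[leb]_(x in D `&` `]-oo, y]) (phi 0 1 x)%:E)%E.
  move=> mD; rewrite -!intb -ge0_integralD//.
  - by move=> x _; rewrite lee_fin.
  - by apply: measurable_funTS; apply/measurable_EFinP.
  - by move=> x _; rewrite lee_fin.
  - by apply: measurable_funTS; apply/measurable_EFinP.
have itvI t z : `]-oo, t]%classic `&` `]-oo, z]%classic = `]-oo, Num.min t z]%classic :> set R.
  apply/seteqP; split => x /=; rewrite !in_itv/= le_min.
    by move=> [-> ->].
  by move=> /andP.
have da : dominating_density a.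
  split.
  - exact: measurable_funD.
  - by move=> x; rewrite addr_ge0.
  - by rewrite inta// !setTI -!EFin_ncdf hc hy -EFinD subrK.
  - move=> x; rewrite PhiE inta//.
    rewrite !itvI -!EFin_ncdf -EFinD lee_fin.
    have Hx := H x.
    (* The new cdf is the cdf of N(mu, nu) capped at [1 - s] plus [Phi] capped at [s]. It dominates
       [Phi] trivially except at points left of [c] and right of [y], where [H] is used. *)
    have [xc|cx] := leP x c; have [xy|yx] := leP x y; rewrite ?hc ?hy.
    + by rewrite lerDr ncdf_ge0.
    + by move: Hx; lra.
    + by rewrite lerDr subr_ge0 ltW//; case/andP: s01.
    + by rewrite subrK ncdf_le1.
apply: (Sesq_le_obj da); rewrite /Sesq_obj.
(* The densities differ by at most the removed tail plus the added tail, each of mass [s]. *)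
have -> : s%:E = ((2^-1)%:E * (s%:E + s%:E))%E.
  by rewrite -EFinD -EFinM; congr (_%:E); lra.
rewrite lee_wpmul2l ?lee_fin ?invr_ge0//.
have tail : (\int[leb]_(x in ~` `]-oo, c]) (phi mu nu x)%:E = s%:E)%E.
  have : (\int[leb]_x (phi mu nu x)%:E = (1 - s)%:E +
          \int[leb]_(x in ~` `]-oo, c]) (phi mu nu x)%:E)%E.
    rewrite -(setUv `]-oo, c]) ge0_integral_setU//.
    - by rewrite -EFin_ncdf hc.
    - by apply: measurableC; exact: measurable_itv.
    - by apply: measurable_funTS; apply/measurable_EFinP; exact: measurable_phi.
    - by move=> x _; rewrite lee_fin phi_ge0.
    - by apply/disj_setPS; rewrite setICr.
  rewrite int_phi01.
  case: (\int[leb]_(x in ~` _) _)%E => [r| |]//.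
  by rewrite -EFinD => -[h]; congr (_%:E); lra.
rewrite -[X in (_ <= X + _)%E]tail -[X in (_ <= _ + X)%E](_ : (\int[leb]_x (b2 x)%:E = _)%E); last first.
  by rewrite intb setTI -EFin_ncdf hy.
rewrite [X in (_ <= X + _)%E]integral_mkcond -ge0_integralD//.
- apply: ge0_le_integral => //.
  + apply/measurable_EFinP; apply: measurableT_comp => //.
    by apply: measurable_funB; [exact: measurable_funD|exact: measurable_phi].
  + apply: emeasurable_funD; last by apply/measurable_EFinP.
    apply/(measurable_restrict _ (measurableC (measurable_itv _)) measurableT).
    by apply: measurable_funTS; apply/measurable_EFinP; exact: measurable_phi.
  + move=> x _; have := b20 x; rewrite /a /b1 !patchE in_setC.
    case: ifP => _ b2x /=.
      by rewrite add0e lee_fin addrAC subrr add0r ger0_norm.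
    rewrite -EFinD lee_fin add0r (le_trans (ler_normB _ _))//.
    by rewrite !ger0_norm ?phi_ge0// addrC.
- by move=> x _; rewrite patchE; case: ifP => // _; rewrite lee_fin phi_ge0.
- apply/(measurable_restrict _ (measurableC (measurable_itv _)) measurableT).
  by apply: measurable_funTS; apply/measurable_EFinP; exact: measurable_phi.
- by move=> x _; rewrite lee_fin.
- by apply/measurable_EFinP.
Qed.

(** Needed because [inf] has a default value on other sets. For large [mu] some threshold has [Phi]
    near 1 and the shifted law near 0. For very negative [mu] every threshold gains at most
    [eps / 2]: left of [t] the first cdf is small, right of it the second is near 1. *)
Lemma Sesq_inv_has_inf nu eps : 0 < nu -> 0 < eps < 1 ->
  has_inf [set mu : R | eps <= Sesq nu mu].
Proof.
move=> nu0 /andP[e0 e1]; have s0 : 0 < Num.sqrt nu by rewrite sqrtr_gt0.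
split.
  have ep : 0 < (1 - eps) / 2 by lra.
  have [t ht] := ncdf_large 0 1 ep; have [y hy] := ncdf_small 0 1 ep.
  exists (t - y * Num.sqrt nu) => /=; apply: (le_trans _ (@ncdf_le_Sesq nu _ t nu0)).
  rewrite (ncdf_std _ _ nu0) (_ : _ / _ = y).
    by have := ht _ (lexx t); have := hy _ (lexx y); lra.
  by field; rewrite gt_eqF.
have ep : 0 < eps / 2 by lra.
have [t ht] := ncdf_small 0 1 ep; have [y hy] := ncdf_large 0 1 ep.
exists (t - y * Num.sqrt nu) => mu /= emu; rewrite leNgt; apply/negP => muy.
suff : Sesq nu mu <= eps / 2 by lra.
apply: Sesq_le => // [|z]; first by lra.
have := ncdf_ge0 mu nu z; have := ncdf_le1 0 1 z.
have [zt|tz] := leP z t; first by have := ht _ zt; lra.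
have : y <= (z - mu) / Num.sqrt nu by rewrite ler_pdivlMr//; lra.
by move=> /hy; rewrite (ncdf_std _ _ nu0); lra.
Qed.

(** The strict gap between [s] and [eps] pays for the discretization into bins; the maximum with
    [eps / 2] in the witness keeps [s] positive. *)
Lemma Sesq_inv_lt nu eps mu : 0 < nu -> 0 < eps < 1 -> mu < Sesq_inv nu eps ->
  exists2 s, 0 < s < eps & forall t, Phi t - Phi ((t - mu) / Num.sqrt nu) <= s.
Proof.
move=> nu0 e01 mulow; have [ne lb] := Sesq_inv_has_inf nu0 e01.
have lt_e : Sesq nu mu < eps.
  rewrite ltNge; apply/negP => h; move: mulow; rewrite ltNge => /negP; apply.
  exact: ge_inf.
exists (Num.max (Sesq nu mu) (eps / 2)).
  rewrite lt_max gt_max lt_e/=; apply/andP; split; last by lra.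
  by apply/orP; right; lra.
by move=> t; rewrite le_max -ncdf_std// ncdf_le_Sesq.
Qed.

(** Otherwise all violations at [mu] are at most [eps]. Lowering the mean to some [mu1 < mu] with
    [eps <= Sesq nu mu1] raises the normal cdf strictly, by at least some [g > 0] on a compact
    interval, while outside it the violations are at most [eps / 2]. Then [Sesq nu mu1 < eps], a
    contradiction. *)
Lemma Sesq_inv_gt nu eps mu : 0 < nu -> 0 < eps < 1 -> Sesq_inv nu eps < mu ->
  exists t, eps < Phi t - Phi ((t - mu) / Num.sqrt nu).
Proof.
move=> nu0 e01 muhi; have hi := Sesq_inv_has_inf nu0 e01.
have d0 : 0 < mu - Sesq_inv nu eps by rewrite subr_gt0.
have [mu1 /= emu1 mu1mu] := inf_adherent d0 hi.
have {}mu1mu : mu1 < mu by move: mu1mu; rewrite /Sesq_inv; lra.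
apply: contrapT => /forallNP N.
have {}N t : Phi t - ncdf mu nu t <= eps.
  by rewrite (ncdf_std _ _ nu0) leNgt; apply/negP; exact: N.
move/andP: e01 => [e0 e1]; have e2 : 0 < eps / 2 by lra.
have s0 : 0 < Num.sqrt nu by rewrite sqrtr_gt0.
have [t1 ht1] := ncdf_small 0 1 e2; have [t2 ht2] := ncdf_large mu1 nu e2.
pose gap (t : R) := ncdf mu1 nu t - ncdf mu nu t.
have gap0 t : 0 < gap t.
  by rewrite subr_gt0 !(ncdf_std _ _ nu0) ncdf_lt// ltr_pM2r ?invr_gt0//; lra.
have [g g0 hg] : exists2 g, 0 < g & forall t, t1 <= t <= t2 -> g <= gap t.
  have [t12|t21] := leP t1 t2; last by exists 1 => // t; lra.
  have [|z _ hz] := @EVT_min R gap t1 t2 t12.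
    apply: continuous_subspaceT => x; apply: cvgB; exact: continuous_ncdf.
  by exists (gap z) => // t tt; apply: hz; rewrite in_itv/=.
suff : Sesq nu mu1 <= Num.max (eps / 2) (eps - g).
  by rewrite le_max => /orP[]; lra.
apply: Sesq_le => // [|z].
  by rewrite lt_max gt_max e2/=; apply/andP; split; lra.
have := ncdf_ge0 mu1 nu z; have := ncdf_le1 0 1 z; have := N z.
have := @hg z; have := @ht1 z; have := @ht2 z; rewrite /gap.
rewrite le_max; move: (ncdf 0 1 z) (ncdf mu1 nu z) (ncdf mu nu z) => A B C.
have [z1|z1] := leP z t1.
  by move=> _ /(_ isT) h1 _ _ ? ?; apply/orP; left; lra.
have [z2|z2] := leP t2 z.
  by move=> /(_ isT) h1 _ _ _ ? ?; apply/orP; left; lra.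
move=> _ _; rewrite (ltW z1) (ltW z2) => /(_ isT) h1 ? ? ?; apply/orP; right; lra.
Qed.

End SesquinormalTheory.

(** * Central limit theorem *)

Section IidSum.
Variables (R : realType) (A : finType) (p : A -> R).
Implicit Types (L : A -> R) (h k f : R -> R).
Local Notation Phi := (@ncdf R 0 1).

(** Expectation of [h] at a sum of [n] independent copies of [L], taken one letter at a time so that
    no product space appears. *)
Fixpoint iid_expect L n h : R :=
  if n is n'.+1 then \sum_a p a * iid_expect L n' (fun x => h (x + L a)) else h 0.

Lemma eq_iid_expect L n h k : h =1 k -> iid_expect L n h = iid_expect L n k.
Proof.
elim: n h k => [|n IH] h k hk /=; first exact: hk.
by apply: eq_bigr => a _; congr (_ * _); apply: IH => x; exact: hk.
Qed.

Lemma iid_expectD L n h k :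
  iid_expect L n (fun x => h x + k x) = iid_expect L n h + iid_expect L n k.
Proof.
elim: n h k => [|n IH] h k //=.
by rewrite -big_split/=; apply: eq_bigr => a _; rewrite IH mulrDr.
Qed.

Lemma iid_expectZ L n c h : iid_expect L n (fun x => c * h x) = c * iid_expect L n h.
Proof.
elim: n h => [|n IH] h //=.
by rewrite mulr_sumr; apply: eq_bigr => a _; rewrite IH mulrCA.
Qed.

Lemma iid_expectB L n h k :
  iid_expect L n (fun x => h x - k x) = iid_expect L n h - iid_expect L n k.
Proof.
rewrite -mulN1r -iid_expectZ -iid_expectD.
by apply: eq_iid_expect => x; rewrite mulN1r.
Qed.

Lemma iid_expect_shift L D n h :
  iid_expect L n h = iid_expect (fun a => L a - D) n (fun x => h (x + n%:R * D)).
Proof.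
elim: n h => [|n IH] h /=; first by rewrite mul0r addr0.
apply: eq_bigr => a _; congr (_ * _); rewrite IH; apply: eq_iid_expect => x.
by congr h; rewrite -natr1; ring.
Qed.

(** By exchangeability each of the [n.+1] summands contributes equally to $E[Sf(S)]$; isolating one
    leaves the sum of the others independent of it. *)
Lemma iid_expect_stein L n f :
  iid_expect L n.+1 (fun x => x * f x) =
  n.+1%:R * \sum_a p a * L a * iid_expect L n (fun x => f (x + L a)).
Proof.
elim: n f => [|n IH] f.
  by rewrite mul1r; apply: eq_bigr => a _ /=; rewrite add0r mulrA.
rewrite [LHS]/=.
under eq_bigr => a _.
  rewrite -[X in _ * X]/(iid_expect L n.+1 (fun x => (x + L a) * f (x + L a))).
  under eq_iid_expect => x do rewrite mulrDl.
  rewrite iid_expectD iid_expectZ (IH (fun x => f (x + L a))) mulrDr.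
  over.
rewrite big_split/= -(natr1 n.+1) mulrDl mul1r; congr (_ + _); last first.
  by apply: eq_bigr => a _; rewrite mulrA.
under eq_bigr do rewrite mulrCA mulr_sumr.
rewrite -mulr_sumr; congr (_ * _); rewrite exchange_big/=; apply: eq_bigr => b _.
rewrite mulr_sumr; apply: eq_bigr => a _; rewrite mulrCA; congr (_ * (_ * _)).
by apply: eq_iid_expect => x; rewrite addrAC.
Qed.

Section Distribution.
Hypotheses (p0 : forall a, 0 <= p a) (p1 : \sum_a p a = 1).

Lemma ler_iid_expect L n h k : (forall x, h x <= k x) ->
  iid_expect L n h <= iid_expect L n k.
Proof.
elim: n h k => [|n IH] h k hk /=; first exact: hk.
by apply: ler_sum => a _; rewrite ler_wpM2l// IH.
Qed.

Lemma iid_expect_cst L n c : iid_expect L n (fun=> c) = c.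
Proof.
elim: n => //= n IH; under eq_bigr do rewrite IH.
by rewrite -mulr_suml p1 mul1r.
Qed.

Lemma ler_norm_iid_expect L n h k : (forall x, `|h x| <= k x) ->
  `|iid_expect L n h| <= iid_expect L n k.
Proof.
move=> hk; rewrite ler_norml; apply/andP; split; last first.
  by apply: ler_iid_expect => x; exact: le_trans (ler_norm _) (hk x).
rewrite -mulN1r -iid_expectZ; apply: ler_iid_expect => x.
by rewrite mulN1r lerNl (le_trans _ (hk x))// -normrN ler_norm.
Qed.

Section Centered.
Variable (L : A -> R) (V : R).
Hypotheses (V0 : 0 < V) (L0 : \sum_a p a * L a = 0) (L2 : \sum_a p a * L a ^+ 2 = V).

Lemma iid_expect_sqr n : iid_expect L n (fun x => x ^+ 2) = n%:R * V.
Proof.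
case: n => [|n]; first by rewrite /= mul0r expr0n.
under eq_iid_expect do rewrite expr2.
rewrite iid_expect_stein -L2; congr (_ * _).
under eq_bigr do rewrite iid_expectD iid_expect_cst mulrDr.
by rewrite big_split/= -mulr_suml L0 mul0r add0r; apply: eq_bigr => a _; rewrite -mulrA expr2.
Qed.

(** Stein's equation rewrites the error as $E\,g(S/s)-E[(S/s)f(S/s)]$. Isolating one summand turns
    both terms into averages of [g] at points within [B / s] of the normalized sum of the others:
    the first with weights [p a], the second with weights [p a * L a ^+ 2 / V], again a probability
    vector. Local Lipschitz continuity makes them close. *)
Lemma clt_smooth f g h c :
  (forall x, g x = x * f x + h x - c) -> (forall x, `|g x| <= 2) ->
  (forall M : R, exists2 K : R, 0 <= K & forall x y : R, `|x| <= M -> `|y| <= M ->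
     `|g x - g y| <= K * `|x - y|) ->
  (forall x y : R, exists2 z : R, `|z - x| <= `|y - x| & f y - f x = g z * (y - x)) ->
  forall e : R, 0 < e -> exists N, forall n, (N <= n)%N ->
    `|iid_expect L n (fun x => h (x / Num.sqrt (n%:R * V))) - c| <= e.
Proof.
move=> gE g2 glip fmvt e e0.
pose B : R := \sum_a `|L a|.
have LB a : `|L a| <= B by rewrite /B (bigD1 a)//= lerDl sumr_ge0.
have B0 : 0 <= B by rewrite sumr_ge0.
(* Makes the tail contribution [4 / (M - 1) ^ 2] in [err] at most [e / 4]. *)
pose M : R := 16 / e + 2.
have e16 : 0 < 16 / e by rewrite divr_gt0.
have M1 : 0 < M - 1 by rewrite /M; lra.
have [K K0 gK] := glip (M + 1).
pose T : R := (B + 4 * K * B / e) ^+ 2 / V.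
exists (Num.truncn T).+2 => n Nn.
case: n Nn => // n Nn.
set s := Num.sqrt (n.+1%:R * V).
have nV0 : 0 < n.+1%:R * V by rewrite mulr_gt0.
have s0 : 0 < s by rewrite sqrtr_gt0.
have ss : s ^+ 2 = n.+1%:R * V by rewrite sqr_sqrtr// ltW.
have sB : B + 4 * K * B / e <= s.
  have b0 : 0 <= B + 4 * K * B / e by rewrite addr_ge0// divr_ge0 ?(ltW e0)// !mulr_ge0.
  rewrite -(ler_pXn2r (_ : 0 < 2)%N) ?nnegrE ?(ltW s0)// ss -ler_pdivrMr//.
  rewrite -/T; apply: ltW; apply: (lt_trans (truncnS_gt T)).
  by rewrite ltr_nat.
have KB0 : 0 <= 4 * K * B / e by rewrite divr_ge0 ?(ltW e0)// !mulr_ge0.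
have Bs : B / s <= 1 by rewrite ler_pdivrMr// mul1r; lra.
have KBs : K * (B / s) <= e / 4.
  rewrite mulrA ler_pdivrMr//.
  have : 4 * K * B / e <= s by lra.
  by rewrite ler_pdivrMr//; lra.
have Bs0 : 0 <= B / s by rewrite divr_ge0// ltW.
(* The first term is the Lipschitz bound for [|x / s| <= M - 1]. Beyond, two values of [g] differ by
   at most 4, and the second term dominates 4 times the indicator, as in Chebyshev's inequality. *)
pose err (x : R) : R := e / 4 + 4 * ((M - 1) ^- 2 * (s ^- 2 * x ^+ 2)).
have gerr x y : `|y - x / s| <= B / s -> `|g y - g (x / s)| <= err x.
  move=> yx; rewrite /err.
  have [xM|Mx] := leP `|x / s| (M - 1).
    have yM : `|y| <= M + 1.
      have := ler_normD (y - x / s) (x / s); rewrite subrK; lra.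
    have xM' : `|x / s| <= M + 1 by lra.
    have G := gK _ _ yM xM'.
    have : 0 <= 4 * ((M - 1) ^- 2 * (s ^- 2 * x ^+ 2)).
      have i1 : 0 <= (M - 1) ^- 2 by rewrite invr_ge0 sqr_ge0.
      have i2 : 0 <= s ^- 2 by rewrite invr_ge0 sqr_ge0.
      by apply: mulr_ge0 => //; apply: mulr_ge0 => //; apply: mulr_ge0 => //; exact: sqr_ge0.
    have : K * `|y - x / s| <= K * (B / s) by rewrite ler_wpM2l.
    by lra.
  have h1 : 1 <= (M - 1) ^- 2 * (s ^- 2 * x ^+ 2).
    rewrite -ler_pdivrMl ?invr_gt0 ?exprn_gt0// invrK mulr1.
    rewrite mulrC -expr_div_n -(real_normK (num_real (x / s))).
    by rewrite ler_pXn2r ?nnegrE ?(ltW M1)// ltW.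
  have := ler_normB (g y) (g (x / s)); have := g2 y; have := g2 (x / s).
  by lra.
have errE : iid_expect L n err <= e / 2.
  rewrite /err iid_expectD iid_expect_cst !iid_expectZ iid_expect_sqr.
  have h1 : s ^- 2 * (n%:R * V) <= 1.
    rewrite ler_pdivrMl ?exprn_gt0// mulr1 ss ler_pM2r// ler_nat//.
  have h2 : (M - 1) ^- 2 * (s ^- 2 * (n%:R * V)) <= (M - 1) ^- 2.
    by rewrite ler_piMr// invr_ge0 sqr_ge0.
  suff : 4 * (M - 1) ^- 2 <= e / 4 by lra.
  have h3 : 16 / e <= (M - 1) ^+ 2 by rewrite /M; have := sqr_ge0 (16 / e : R); lra.
  rewrite ler_pdivrMr ?exprn_gt0//.
  by move: h3; rewrite ler_pdivrMr//; lra.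
have avg (w : A -> R) (k : A -> R -> R) : (forall a, 0 <= w a) -> \sum_a w a = 1 ->
    (forall a x, `|k a x - g (x / s)| <= err x) ->
    `|\sum_a w a * iid_expect L n (k a) - iid_expect L n (fun x => g (x / s))| <= e / 2.
  move=> w0 w1 H.
  have wsum (r : R) : r = \sum_a w a * r by rewrite -mulr_suml w1 mul1r.
  rewrite [X in _ - X]wsum -sumrB; apply: (le_trans (ler_norm_sum _ _ _)).
  rewrite [leRHS]wsum; apply: ler_sum => a _.
  rewrite -mulrBr normrM (ger0_norm (w0 a)) ler_wpM2l// -iid_expectB.
  by apply: (le_trans _ errE); exact: ler_norm_iid_expect.
have /choice [z hz] : forall xy : R * R, exists z, `|z - xy.1| <= `|xy.2 - xy.1| /\
    f xy.2 - f xy.1 = g z * (xy.2 - xy.1).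
  by move=> [x y]; have [z ? ?] := fmvt x y; exists z.
pose zz a (x : R) := z (x / s, (x + L a) / s).
have E1 : iid_expect L n.+1 (fun x => h (x / s)) - c =
    iid_expect L n.+1 (fun x => g (x / s)) - iid_expect L n.+1 (fun x => x * (s^-1 * f (x / s))).
  rewrite -[X in _ - X](iid_expect_cst L n.+1) -!iid_expectB.
  by apply: eq_iid_expect => x; rewrite gE; ring.
have E2 : iid_expect L n.+1 (fun x => x * (s^-1 * f (x / s))) =
    \sum_a (p a * L a ^+ 2 / V) * iid_expect L n (fun x => g (zz a x)).
  rewrite iid_expect_stein.
  (* The subtracted value does not involve the isolated letter and is cancelled by centering; the
     increment left is one to which the mean value property applies. *)
  have -> : \sum_a p a * L a * iid_expect L n (fun x => s^-1 * f ((x + L a) / s)) =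
     \sum_a p a * L a * iid_expect L n (fun x => s^-1 * (f ((x + L a) / s) - f (x / s))).
    apply/eqP; rewrite -subr_eq0 -sumrB; apply/eqP.
    transitivity (\sum_a p a * L a * iid_expect L n (fun x => s^-1 * f (x / s))).
      apply: eq_bigr => a _; rewrite -mulrBr -iid_expectB; congr (_ * _).
      by apply: eq_iid_expect => x; ring.
    by rewrite -mulr_suml L0 mul0r.
  rewrite mulr_sumr; apply: eq_bigr => a _.
  have -> : iid_expect L n (fun x => s^-1 * (f ((x + L a) / s) - f (x / s))) =
     iid_expect L n (fun x => (L a / s ^+ 2) * g (zz a x)).
    apply: eq_iid_expect => x; rewrite /zz; have [_ /= ->] := hz (x / s, (x + L a) / s).
    by field; rewrite gt_eqF.
  rewrite iid_expectZ ss; field.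
  by rewrite (gt_eqF V0) /= addrC natr1 pnatr_eq0.
have E3 : iid_expect L n.+1 (fun x => g (x / s)) =
    \sum_a p a * iid_expect L n (fun x => g ((x + L a) / s)) by [].
rewrite E1 E2 E3.
have A1 : `|\sum_a p a * iid_expect L n (fun x => g ((x + L a) / s)) -
    iid_expect L n (fun x => g (x / s))| <= e / 2.
  apply: (avg p (fun a x => g ((x + L a) / s))) => // a x; apply: gerr.
  rewrite -mulrBl addrAC subrr add0r normrM (gtr0_norm (_ : 0 < s^-1)) ?invr_gt0//.
  by rewrite ler_wpM2r// invr_ge0 ltW.
have A2 : `|\sum_a (p a * L a ^+ 2 / V) * iid_expect L n (fun x => g (zz a x)) -
    iid_expect L n (fun x => g (x / s))| <= e / 2.
  apply: (avg (fun a => p a * L a ^+ 2 / V) (fun a x => g (zz a x))).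
  - by move=> a; rewrite divr_ge0 ?(ltW V0)// mulr_ge0// sqr_ge0.
  - by rewrite -mulr_suml L2 divff// gt_eqF.
  move=> a x; apply: gerr; rewrite /zz; have [/= h1 _] := hz (x / s, (x + L a) / s).
  apply: (le_trans h1).
  rewrite -mulrBl addrAC subrr add0r normrM (gtr0_norm (_ : 0 < s^-1)) ?invr_gt0//.
  by rewrite ler_wpM2r// invr_ge0 ltW.
rewrite distrC in A2; have := ler_normD (\sum_a p a * iid_expect L n (fun x => g ((x + L a) / s)) -
    iid_expect L n (fun x => g (x / s))) (iid_expect L n (fun x => g (x / s)) - \sum_a (p a * L a ^+ 2 / V) * iid_expect L n (fun x => g (zz a x))).
rewrite addrA subrK => H; apply: (le_trans H).
by rewrite [leRHS]splitr lerD.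
Qed.

End Centered.
(** The indicator is squeezed between two smoothed ones whose windows in the quantile variable are
    [[Phi t - d, Phi t]] and [[Phi t, Phi t + d]]. Their normal means are [Phi t - d / 2] and
    [Phi t + d / 2]; [d] is small enough for both windows to fit in $[0,1]$. *)
Lemma clt L (D V : R) : 0 < V -> \sum_a p a * L a = D ->
    \sum_a p a * L a ^+ 2 - D ^+ 2 = V -> forall t e : R, 0 < e ->
  exists N, forall n, (N <= n)%N ->
   `|iid_expect L n (fun x => (x <= n%:R * D + t * Num.sqrt (n%:R * V))%R%:R) - Phi t| <= e.
Proof.
move=> V0 LD LV t e e0; pose L' a := L a - D.
have L'0 : \sum_a p a * L' a = 0.
  under eq_bigr do rewrite mulrBr.
  by rewrite sumrB -mulr_suml p1 mul1r LD subrr.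
have L'2 : \sum_a p a * L' a ^+ 2 = V.
  rewrite -LV; transitivity (\sum_a (p a * L a ^+ 2 - 2 * D * (p a * L a) + D ^+ 2 * p a)).
    by apply: eq_bigr => a _; rewrite /L'; ring.
  by rewrite big_split/= sumrB -!mulr_sumr LD p1; ring.
have u0 := @ncdf_gt0 R 0 1 t ltr01; have u1 := @ncdf_lt1 R 0 1 t ltr01.
have [d d0 [de du d1]] : exists2 d : R, 0 < d & [/\ d <= e, d <= Phi t & Phi t + d <= 1].
  exists (Num.min e (Num.min (Phi t) (1 - Phi t))).
    by rewrite !lt_min e0 u0 subr_gt0.
  split; rewrite ?ge_min ?lexx ?orbT//.
  by rewrite addrC -lerBrDr !ge_min lexx !orbT.
have [f1 [g1 [h1 [A1 B1 C1 D1 [E1 F1 G1]]]]] := stein_solution (ltW u0) d0 d1.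
have d0' : 0 <= Phi t - d by rewrite subr_ge0.
have d1' : Phi t - d + d <= 1 by rewrite subrK; exact: ltW.
have [f2 [g2 [h2 [A2 B2 C2 D2 [E2 F2 G2]]]]] := stein_solution d0' d0 d1'.
have d2 : 0 < d / 2 by rewrite divr_gt0.
have [N1 HN1] := clt_smooth V0 L'0 L'2 A1 B1 C1 D1 d2.
have [N2 HN2] := clt_smooth V0 L'0 L'2 A2 B2 C2 D2 d2.
exists (maxn 1 (maxn N1 N2)) => n; rewrite !geq_max => /and3P[n0 n1 n2].
rewrite (iid_expect_shift L D); rewrite -/L'.
set s := Num.sqrt _; have s0 : 0 < s by rewrite sqrtr_gt0 mulr_gt0// ltr0n.
under eq_iid_expect => x do rewrite addrC lerD2l -ler_pdivrMr//.
have {}HN1 := HN1 n n1; have {}HN2 := HN2 n n2.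
have H1 : iid_expect L' n (fun x => (x / s <= t)%R%:R) <= iid_expect L' n (fun x => h1 (x / s)).
  apply: ler_iid_expect => x; have /andP[? ?] := E1 (x / s).
  by case: (lerP (x / s) t) => // xt; rewrite F1// ncdf_le.
have H2 : iid_expect L' n (fun x => h2 (x / s)) <= iid_expect L' n (fun x => (x / s <= t)%R%:R).
  apply: ler_iid_expect => x; have /andP[? ?] := E2 (x / s).
  case: (lerP (x / s) t) => // xt; rewrite G2// subrK ncdf_le//; exact: ltW.
move: HN1 HN2 H1 H2; rewrite !ler_norml => /andP[? ?] /andP[? ?] ? ?.
by apply/andP; split; lra.
Qed.

End Distribution.
End IidSum.

(** * Unitary diagonalization and functional calculus *)

Section UnitaryDiagonalization.
Variable R : realType.
Local Notation C := (R[i]).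
Local Notation "x %:C" := (real_complex R x) : ring_scope.
Local Notation "A ^t*" := (adjmx A) (at level 30) : ring_scope.

Definition nsq (z : C) : R := complex.Re z ^+ 2 + complex.Im z ^+ 2.

Lemma nsqE (z : C) : (nsq z)%:C = z * Num.conj z.
Proof. by rewrite add_Re2_Im2 -normCK. Qed.

Lemma nsq_ge0 (z : C) : 0 <= nsq z.
Proof. by rewrite addr_ge0 ?sqr_ge0. Qed.

Lemma nsqM (z w : C) : nsq (z * w) = nsq z * nsq w.
Proof.
by apply: (@complexI R); rewrite rmorphM/= !nsqE rmorphM/= mulrACA.
Qed.

Lemma nsq_conj (z : C) : nsq (Num.conj z) = nsq z.
Proof. by apply: (@complexI R); rewrite !nsqE conjCK mulrC. Qed.

Lemma Re_real (x : R) : complex.Re x%:C = x. Proof. by []. Qed.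

Lemma conj_real (x : R) : Num.conj x%:C = x%:C.
Proof. by apply: CrealP; rewrite complex_real. Qed.

Lemma adjmxK m n (A : 'M[C]_(m, n)) : A^t*^t* = A.
Proof. exact: trmxCK. Qed.

Lemma adjmxM m n p (A : 'M[C]_(m, n)) (B : 'M[C]_(n, p)) : (A *m B)^t* = B^t* *m A^t*.
Proof. by rewrite /adjmx trmx_mul map_mxM. Qed.

Lemma adjmxD m n (A B : 'M[C]_(m, n)) : (A + B)^t* = A^t* + B^t*.
Proof. by rewrite /adjmx linearD/= map_mxD. Qed.

Lemma adjmxB m n (A B : 'M[C]_(m, n)) : (A - B)^t* = A^t* - B^t*.
Proof. by rewrite /adjmx linearB/= map_mxB. Qed.

Lemma adjmxZ m n c (A : 'M[C]_(m, n)) : (c *: A)^t* = Num.conj c *: A^t*.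
Proof. by apply/matrixP => i j; rewrite !mxE rmorphM. Qed.

Lemma adjmxE m n (A : 'M[C]_(m, n)) i j : A^t* i j = Num.conj (A j i).
Proof. by rewrite !mxE. Qed.

Definition unitary n (U : 'M[C]_n) := U *m U^t* = 1%:M.

Lemma unitary_mulV n (U : 'M[C]_n) : unitary U -> U^t* *m U = 1%:M.
Proof. exact: mulmx1C. Qed.

Lemma unitaryM n (U W : 'M[C]_n) : unitary U -> unitary W -> unitary (U *m W).
Proof.
by rewrite /unitary => u w; rewrite adjmxM mulmxA -(mulmxA U) w mulmx1.
Qed.

Lemma unitary_adj n (U : 'M[C]_n) : unitary U -> unitary (U^t*).
Proof. by move=> u; rewrite /unitary adjmxK unitary_mulV. Qed.

Definition diagc n (f : 'I_n -> R) : 'M[C]_n := diag_mx (\row_i (f i)%:C).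

(** The unitary is arbitrary rather than the one chosen by [spectralmx], so that tensor powers and
    pinchings can bring their own eigenbases. *)
Definition udiag n (U : 'M[C]_n) (f : 'I_n -> R) : 'M[C]_n := U^t* *m diagc f *m U.

Lemma diagcE n (f : 'I_n -> R) i j : diagc f i j = (f i)%:C *+ (i == j).
Proof. by rewrite !mxE. Qed.

Lemma eq_diagc n (f g : 'I_n -> R) : f =1 g -> diagc f = diagc g.
Proof. by move=> fg; apply/matrixP => i j; rewrite !diagcE fg. Qed.

Lemma eq_udiag n (U : 'M[C]_n) (f g : 'I_n -> R) : f =1 g -> udiag U f = udiag U g.
Proof. by move=> fg; rewrite /udiag (eq_diagc fg). Qed.

Lemma mul_diagc_mx n m (f : 'I_n -> R) (A : 'M[C]_(n, m)) i j :
  (diagc f *m A) i j = (f i)%:C * A i j.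
Proof. by rewrite mul_diag_mx !mxE. Qed.

Lemma mul_mx_diagc n m (f : 'I_n -> R) (A : 'M[C]_(m, n)) i j :
  (A *m diagc f) i j = A i j * (f j)%:C.
Proof. by rewrite mul_mx_diag !mxE. Qed.

Lemma diagcM n (f g : 'I_n -> R) : diagc f *m diagc g = diagc (fun i => f i * g i).
Proof.
by apply/matrixP => i j; rewrite mul_diagc_mx !diagcE rmorphM/= mulrnAr.
Qed.

Lemma diagcB n (f g : 'I_n -> R) : diagc f - diagc g = diagc (fun i => f i - g i).
Proof. by apply/matrixP => i j; rewrite !mxE rmorphB/= mulrnBl. Qed.

Lemma diagc1 n : diagc (fun _ : 'I_n => 1) = 1%:M.
Proof. by apply/matrixP => i j; rewrite diagcE rmorph1 mxE. Qed.

Lemma adj_diagc n (f : 'I_n -> R) : (diagc f)^t* = diagc f.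
Proof.
apply/matrixP => i j; rewrite adjmxE !diagcE rmorphMn/= conj_real eq_sym.
by case: eqP => // ->.
Qed.

Lemma adj_udiag n (U : 'M[C]_n) f : (udiag U f)^t* = udiag U f.
Proof. by rewrite /udiag !adjmxM adjmxK adj_diagc mulmxA. Qed.

Lemma udiagM n (U : 'M[C]_n) f g : unitary U ->
  udiag U f *m udiag U g = udiag U (fun i => f i * g i).
Proof.
move=> u; rewrite /udiag !mulmxA -[_ *m U *m _]mulmxA u mulmx1.
by rewrite -[_ *m diagc f *m _]mulmxA diagcM.
Qed.

Lemma udiagB n (U : 'M[C]_n) f g : udiag U f - udiag U g = udiag U (fun i => f i - g i).
Proof. by rewrite /udiag -diagcB mulmxBr mulmxBl. Qed.

Lemma udiag1 n (U : 'M[C]_n) : unitary U -> udiag U (fun=> 1) = 1%:M.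
Proof. by move=> u; rewrite /udiag diagc1 mulmx1 unitary_mulV. Qed.

Lemma udiagK n (U : 'M[C]_n) f : unitary U -> U *m udiag U f *m U^t* = diagc f.
Proof.
by move=> u; rewrite /udiag !mulmxA u mul1mx -mulmxA u mulmx1.
Qed.

Lemma udiag_conj n (U W : 'M[C]_n) f i : (W *m udiag U f *m W^t*) i i =
  (\sum_j f j * nsq ((W *m U^t*) i j))%:C.
Proof.
rewrite /udiag !mulmxA -(mulmxA (W *m _ *m _)) mxE rmorph_sum/=.
apply: eq_bigr => j _; rewrite mul_mx_diagc rmorphM/= nsqE.
rewrite -[U *m W^t*]adjmxK adjmxM adjmxK adjmxE; ring.
Qed.

Lemma trace_udiag n (U : 'M[C]_n) f : unitary U -> \tr (udiag U f) = (\sum_i f i)%:C.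
Proof.
move=> u; rewrite /udiag -mulmxA mxtrace_mulC -mulmxA u mulmx1 rmorph_sum/=.
by apply: eq_bigr => i _; rewrite diagcE eqxx mulr1n.
Qed.

Lemma trace_udiag_mul n (U X : 'M[C]_n) f :
  \tr (udiag U f *m X) = \sum_i (f i)%:C * (U *m X *m U^t*) i i.
Proof.
rewrite /udiag -!mulmxA mxtrace_mulC -!mulmxA; apply: eq_bigr => i _.
by rewrite mul_diagc_mx mulmxA.
Qed.

Lemma trace_udiag2 n (A B : 'M[C]_n) f g :
  \tr (udiag A f *m udiag B g) =
  (\sum_i \sum_j f i * g j * nsq ((A *m B^t*) i j))%:C.
Proof.
rewrite trace_udiag_mul rmorph_sum/=; apply: eq_bigr => i _.
rewrite udiag_conj -rmorphM; congr (_%:C); rewrite mulr_sumr.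
by apply: eq_bigr => j _; rewrite mulrA.
Qed.

Lemma unitary_row n (U : 'M[C]_n) i : unitary U -> \sum_j nsq (U i j) = 1.
Proof.
move=> u; apply: (@complexI R); rewrite rmorph1 rmorph_sum/=.
have := congr1 (fun M : 'M[C]_n => M i i) u; rewrite !mxE eqxx mulr1n => <-.
by apply: eq_bigr => j _; rewrite nsqE !mxE.
Qed.

Lemma unitary_col n (U : 'M[C]_n) j : unitary U -> \sum_i nsq (U i j) = 1.
Proof.
move=> /unitary_adj/unitary_row => /(_ j) <-.
by apply: eq_bigr => i _; rewrite adjmxE nsq_conj.
Qed.

(** The change of basis [X] intertwines the two diagonals, so [X i j] is nonzero only where the
    eigenvalues agree; it then intertwines their images under [g] too. Hence [mxfun] does not depend
    on the diagonalization that defines it. *)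
Lemma udiag_fun_uniq n (U W : 'M[C]_n) f f' (g : R -> R) : unitary U -> unitary W ->
  udiag U f = udiag W f' -> udiag U (g \o f) = udiag W (g \o f').
Proof.
move=> u w e; pose X := W *m U^t*.
have eX : diagc f' *m X = X *m diagc f.
  rewrite -(udiagK f' w) -(udiagK f u) -e /X.
  by rewrite !mulmxA -(mulmxA _ (W^t*)) (unitary_mulV w) mulmx1
    -(mulmxA W (U^t*) U) (unitary_mulV u) mulmx1.
have {}eX : diagc (g \o f') *m X = X *m diagc (g \o f).
  apply/matrixP => i j; rewrite mul_diagc_mx mul_mx_diagc /=.
  have := congr1 (fun M : 'M[C]_n => M i j) eX; rewrite mul_diagc_mx mul_mx_diagc.
  have [->|X0] := eqVneq (X i j) 0; first by rewrite !mulr0 !mul0r.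
  by rewrite mulrC => /(mulfI X0)/complexI ->; rewrite mulrC.
have : W^t* *m (diagc (g \o f') *m X) *m U = W^t* *m (X *m diagc (g \o f)) *m U.
  by rewrite eX.
rewrite /X !mulmxA (unitary_mulV w) mul1mx -[_ *m U^t* *m U]mulmxA.
by rewrite (unitary_mulV u) mulmx1.
Qed.

Lemma normal_udiag n (N : 'M[C]_n) : N *m N^t* = N^t* *m N ->
  exists2 U, unitary U & exists d : 'rV[C]_n, N = U^t* *m diag_mx d *m U.
Proof.
move=> h; have /orthomx_spectralP e : N \is normalmx by apply/normalmxP.
have Uu := spectral_unitarymx N.
exists (spectralmx N); first exact/unitarymxP.
by exists (spectral_diag N); rewrite {1}e invmx_unitary.
Qed.

Lemma hermitian_spectral n (A : 'M[C]_n) : Defs.hermitian A ->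
  unitary (spectralmx A) /\
  A = udiag (spectralmx A) (fun i => complex.Re (spectral_diag A ord0 i)).
Proof.
move=> hA; have Uu := spectral_unitarymx A.
have hA' : A \is hermsymmx.
  by apply/is_hermitianmxP; rewrite expr0 scale1r; exact: (esym hA).
have /orthomx_spectralP e := hermitian_normalmx hA'.
have hd : \row_i (complex.Re (spectral_diag A ord0 i))%:C = spectral_diag A.
  apply/rowP => i; rewrite mxE.
  by have /mxOverP/(_ ord0 i)/RRe_real := hermitian_spectral_diag_real hA'.
split; first exact/unitarymxP.
rewrite /udiag /diagc hd; move: e; rewrite invmx_unitary//; exact.
Qed.

Lemma hermitian_udiag n (A : 'M[C]_n) : Defs.hermitian A ->
  exists2 U, unitary U & exists f, A = udiag U f.
Proof.
move=> /hermitian_spectral[u e]; exists (spectralmx A) => //.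
by eexists; exact: e.
Qed.

Lemma mxfun_udiag n (g : R -> R) (U : 'M[C]_n) f : unitary U ->
  mxfun g (udiag U f) = udiag U (g \o f).
Proof.
move=> u; have [u' e] := hermitian_spectral (adj_udiag U f).
rewrite -(udiag_fun_uniq g u' u (esym e)) /mxfun invmx_unitary//.
exact: spectral_unitarymx.
Qed.

Lemma psd_udiag_ge0 n (U : 'M[C]_n) f : unitary U -> psd (udiag U f) -> forall i, 0 <= f i.
Proof.
move=> u [_ H] i; have := H (row i U).
suff -> : (row i U *m udiag U f *m (row i U)^t*) ord0 ord0 = (f i)%:C by rewrite ler0c.
have := congr1 (fun M : 'M[C]_n => M i i) (udiagK f u); rewrite diagcE eqxx mulr1n => <-.
rewrite -row_mul !mxE; apply: eq_bigr => j _; rewrite !mxE.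
by congr (_ * _).
Qed.

Lemma psd_conj m n (K : 'M[C]_(m, n)) (X : 'M[C]_n) : psd X -> psd (K *m X *m K^t*).
Proof.
move=> [hX H]; split; first by rewrite /Defs.hermitian !adjmxM adjmxK hX mulmxA.
by move=> v; have := H (v *m K); rewrite adjmxM !mulmxA.
Qed.

Lemma psd_diagc n (f : 'I_n -> R) : (forall i, 0 <= f i) -> psd (diagc f).
Proof.
move=> f0; split; first exact: adj_diagc.
move=> v; rewrite mxE sumr_ge0// => j _; rewrite mul_mx_diagc adjmxE.
by rewrite mulrAC mulr_ge0 ?ler0c ?f0// -normCK exprn_ge0.
Qed.

Lemma psd_udiag n (U : 'M[C]_n) f : (forall i, 0 <= f i) -> psd (udiag U f).
Proof.
move=> f0; rewrite /udiag -{2}(adjmxK U); apply: psd_conj; exact: psd_diagc.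
Qed.

Lemma psdD n (X Y : 'M[C]_n) : psd X -> psd Y -> psd (X + Y).
Proof.
move=> [hX HX] [hY HY]; split; first by rewrite /Defs.hermitian adjmxD hX hY.
by move=> v; rewrite mulmxDr mulmxDl mxE addr_ge0.
Qed.

Lemma psd_diag_entry n (X : 'M[C]_n) i : psd X -> 0 <= X i i.
Proof.
move=> [_ /(_ (delta_mx ord0 i))].
rewrite -rowE mxE (bigD1 i)//= big1 ?addr0 => [|j ji].
  by rewrite !mxE !eqxx rmorph1 mulr1.
by rewrite !mxE (negbTE ji) andbF rmorph0 mulr0.
Qed.

Lemma trace_psd_mul_ge0 n (X Y : 'M[C]_n) : psd X -> psd Y -> 0 <= \tr (X *m Y).
Proof.
move=> pX pY; have [U u [f e]] := hermitian_udiag pX.1; rewrite e in pX *.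
rewrite trace_udiag_mul sumr_ge0// => i _.
rewrite mulr_ge0 ?ler0c ?(psd_udiag_ge0 u pX)//.
by apply: psd_diag_entry; exact: psd_conj.
Qed.

Lemma density_udiag n (rho : 'M[C]_n) : density rho ->
  exists U f, [/\ unitary U, rho = udiag U f, forall i, 0 <= f i & \sum_i f i = 1].
Proof.
move=> [p t]; have [U u [f e]] := hermitian_udiag p.1; rewrite e in p t *.
exists U, f; split => //; first exact: psd_udiag_ge0 p.
by apply: (@complexI R); rewrite -(trace_udiag _ u) t.
Qed.

End UnitaryDiagonalization.

(** * Nussbaum-Szkola distributions *)

Section TensorPowers.
Variable R : realType.
Local Notation C := (R[i]).
Local Notation "x %:C" := (real_complex R x) : ring_scope.
Local Notation "A ^t*" := (adjmx A) (at level 30) : ring_scope.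
Local Notation "A *t B" := (mxtens.tensmx A B) (at level 40, left associativity) : ring_scope.

(** [P] commutes with [X] but perhaps not with [Y]; cyclicity of the trace still identifies the two
    cross terms. *)
Lemma trace_mul_sqrB (K : comPzRingType) n (P X Y : 'M[K]_n) : X *m P = P *m X ->
  \tr (P *m ((X - Y) *m (X - Y))) =
  \tr (P *m X *m X) - 2 * \tr (P *m X *m Y) + \tr (P *m (Y *m Y)).
Proof.
move=> XP; have e : \tr (P *m Y *m X) = \tr (P *m X *m Y) by rewrite mxtrace_mulC mulmxA XP.
have -> : P *m ((X - Y) *m (X - Y)) = P *m X *m X - P *m X *m Y - (P *m Y *m X - P *m (Y *m Y)).
  by rewrite mulmxBl mulmxBr !mulmxBr !mulmxA.
rewrite !raddfB/= e; ring.
Qed.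

Section NussbaumSzkola.
Variables (n : nat) (A B : 'M[C]_n) (la mu : 'I_n -> R).
Hypotheses (uA : unitary A) (uB : unitary B).

(* The classical Nussbaum-Szkola pair of [udiag A la], [udiag B mu] is
   [la i * overlap i j] and [mu j * overlap i j]. *)
Definition overlap (i j : 'I_n) : R := nsq ((A *m B^t*) i j).

Lemma overlap_ge0 i j : 0 <= overlap i j. Proof. exact: nsq_ge0. Qed.

Lemma overlap_row i : \sum_j overlap i j = 1.
Proof. by apply: unitary_row; apply: unitaryM => //; exact: unitary_adj. Qed.

Lemma overlap_col j : \sum_i overlap i j = 1.
Proof. by apply: unitary_col; apply: unitaryM => //; exact: unitary_adj. Qed.

Definition ns_prob (ij : 'I_n * 'I_n) : R := la ij.1 * overlap ij.1 ij.2.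
Definition ns_llr (ij : 'I_n * 'I_n) : R := ln (la ij.1) - ln (mu ij.2).

Lemma relent_ns : relent (udiag A la) (udiag B mu) = \sum_ij ns_prob ij * ns_llr ij.
Proof.
rewrite /relent /logmx !mxfun_udiag// mulmxBr raddfB/= udiagM// !trace_udiag2.
rewrite trace_udiag// -rmorphB Re_real -(pair_bigA _ (fun i j => ns_prob (i, j) * ns_llr (i, j)))/=.
rewrite -sumrB; apply: eq_bigr => i _; rewrite -[X in X - _]mulr1 -(overlap_row i).
rewrite mulr_sumr -sumrB; apply: eq_bigr => j _.
by rewrite /ns_prob /ns_llr /= /overlap; ring.
Qed.

Lemma relvar_ns : relvar (udiag A la) (udiag B mu) =
  \sum_ij ns_prob ij * ns_llr ij ^+ 2 - relent (udiag A la) (udiag B mu) ^+ 2.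
Proof.
rewrite /relvar; congr (_ - _); rewrite /logmx !mxfun_udiag//.
set rho := udiag A la; set X := udiag A _; set Y := udiag B _.
have XR : X *m rho = rho *m X.
  by rewrite /X /rho !(udiagM _ _ uA); apply: eq_udiag => i; exact: mulrC.
rewrite (trace_mul_sqrB _ XR).
rewrite /X /Y /rho !(udiagM _ _ uA) (udiagM _ _ uB) !trace_udiag2 (trace_udiag _ uA).
rewrite -[2](rmorph_nat (real_complex R)) -rmorphM -rmorphB -rmorphD Re_real.
rewrite -(pair_bigA _ (fun i j => ns_prob (i, j) * ns_llr (i, j) ^+ 2))/=.
rewrite mulr_sumr -sumrB -big_split/=; apply: eq_bigr => i _.
have ws (r : R) : r = \sum_j r * overlap i j by rewrite -mulr_sumr overlap_row mulr1.
rewrite [X in X - _]ws !mulr_sumr -sumrB -big_split/=.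
apply: eq_bigr => j _.
by rewrite /ns_prob /ns_llr /= /overlap; ring.
Qed.

End NussbaumSzkola.

(** Spectrum of a tensor power in the index order of [ntensmx]. The recursion starts at one factor
    because [d ^ 1] and [d] are convertible, hence the exponents [n.+1] below. *)
Fixpoint tens_fun d (f : 'I_d -> R) n : 'I_(d ^ n.+1) -> R :=
  if n is n'.+1 return 'I_(d ^ n.+1) -> R then
    fun k : 'I_(d * d ^ n'.+1) => f (mxtens.mxtens_unindex k).1 *
      @tens_fun d f n' (mxtens.mxtens_unindex k).2
  else f.

Lemma tens_fun_index d (f : 'I_d -> R) n i j :
  @tens_fun d f n.+1 (@mxtens.mxtens_index d (d ^ n.+1) (i, j)) = f i * @tens_fun d f n j.
Proof.
rewrite -[LHS]/(f (@mxtens.mxtens_unindex d (d ^ n.+1) _).1 *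
  @tens_fun d f n (@mxtens.mxtens_unindex d (d ^ n.+1) _).2).
by rewrite mxtens.mxtens_indexK.
Qed.

Lemma adj_tens m n p q (X : 'M[C]_(m, n)) (Y : 'M[C]_(p, q)) : (X *t Y)^t* = X^t* *t Y^t*.
Proof. by apply/matrixP => i j; rewrite !mxE rmorphM. Qed.

Lemma tens_id m n : (1%:M : 'M[C]_m) *t (1%:M : 'M[C]_n) = 1%:M.
Proof.
apply/matrixP => i j; case: (mxtens.mxtens_indexP i) => i1 i2.
case: (mxtens.mxtens_indexP j) => j1 j2; rewrite mxtens.tensmxE !mxE -natrM mulnb.
congr (_%:R); congr nat_of_bool; apply/andP/eqP => [[/eqP-> /eqP->]//|h].
by have := can_inj (@mxtens.mxtens_indexK m n) h => -[-> ->].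
Qed.

Lemma unitary_tens m n (X : 'M[C]_m) (Y : 'M[C]_n) : unitary X -> unitary Y -> unitary (X *t Y).
Proof. by rewrite /unitary => x y; rewrite adj_tens mxtens.tensmx_mul x y tens_id. Qed.

Lemma udiag_tens m n (X : 'M[C]_m) (Y : 'M[C]_n) f g :
  udiag X f *t udiag Y g = udiag (X *t Y)
    (fun k => f (mxtens.mxtens_unindex k).1 * g (mxtens.mxtens_unindex k).2).
Proof.
rewrite /udiag adj_tens.
have -> : diagc (fun k => f (mxtens.mxtens_unindex k).1 * g (mxtens.mxtens_unindex k).2) =
    diagc f *t diagc g.
  apply/matrixP => i j; case: (mxtens.mxtens_indexP i) => i1 i2.
  case: (mxtens.mxtens_indexP j) => j1 j2; rewrite mxtens.tensmxE !diagcE.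
  rewrite !mxtens.mxtens_indexK /= rmorphM/= (can_eq (@mxtens.mxtens_indexK m n)) xpair_eqE.
  by case: eqP => _; case: eqP => _; rewrite /= ?mulr0n ?mul0r ?mulr0.
by rewrite !mxtens.tensmx_mul.
Qed.

Lemma unitary_tpow d (U : 'M[C]_d) n : unitary U -> unitary (tpow U n.+1).
Proof. by move=> u; elim: n => [//|n IH]; exact: unitary_tens. Qed.

Lemma udiag_tpow d (U : 'M[C]_d) f n :
  tpow (udiag U f) n.+1 = udiag (tpow U n.+1) (@tens_fun d f n).
Proof.
elim: n => [//|n IH]; rewrite /tpow.
by rewrite [LHS](_ : _ = udiag U f *t tpow (udiag U f) n.+1)// IH udiag_tens.
Qed.

Lemma tens_fun_ge0 d (f : 'I_d -> R) n : (forall i, 0 <= f i) -> forall k, 0 <= @tens_fun d f n k.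
Proof.
move=> f0; elim: n => [//|n IH] k /=; exact: mulr_ge0.
Qed.

Lemma sum_tens (K : nmodType) m n (F : 'I_(m * n) -> K) :
  \sum_k F k = \sum_i \sum_j F (mxtens.mxtens_index (i, j)).
Proof.
rewrite (pair_bigA _ (fun i j => F (mxtens.mxtens_index (i, j))))/=.
rewrite (reindex (@mxtens.mxtens_index m n))/=; first by apply: eq_bigr => -[].
exists (@mxtens.mxtens_unindex m n) => k _; first exact: mxtens.mxtens_indexK.
exact: mxtens.mxtens_unindexK.
Qed.

Lemma tens_fun_sum1 d (f : 'I_d -> R) n : \sum_i f i = 1 -> \sum_k @tens_fun d f n k = 1.
Proof.
move=> f1; elim: n => [//|n IH].
rewrite [LHS](@sum_tens _ d (d ^ n.+1)).
under eq_bigr => i _.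
  under eq_bigr => j _ do rewrite tens_fun_index.
  rewrite -mulr_sumr IH mulr1; over.
by [].
Qed.

(* A superset of the spectrum of [tpow sigma n.+1] of size polynomial in [n]. *)
Definition type_values d (f : 'I_d -> R) n : seq R :=
  [seq \prod_i f i ^+ (k i : 'I_n.+2) | k : {ffun 'I_d -> 'I_n.+2}].

Lemma size_type_values d (f : 'I_d -> R) n : size (type_values f n) = (n.+2 ^ d)%N.
Proof. by rewrite size_map -cardE card_ffun !card_ord. Qed.

(** A product eigenvalue depends only on how often each index occurs, and these counts [e i] are at
    most [n.+1]. *)
Lemma mem_type_values d (f : 'I_d -> R) n k : @tens_fun d f n k \in type_values f n.
Proof.
suff [e ek ->] : exists2 e : 'I_d -> nat, forall i, (e i <= n.+1)%N &
    @tens_fun d f n k = \prod_i f i ^+ e i.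
  apply/mapP; exists [ffun i => inord (e i)]; first by rewrite mem_enum.
  by apply: eq_bigr => i _; rewrite ffunE inordK// ltnS.
elim: n k => [|n IH] k.
  exists (fun i => (i == k) : nat); first by move=> i; case: (i == k).
  by rewrite (bigD1 k)//= eqxx big1 ?mulr1// => i /negbTE ->.
case: (@mxtens.mxtens_indexP d (d ^ n.+1) k) => i0 j0; have [e en ek] := IH j0.
exists (fun i => e i + (i == i0))%N.
  by move=> i; rewrite -addn1 leq_add//; case: (i == i0).
rewrite tens_fun_index ek; under [RHS]eq_bigr do rewrite exprD.
rewrite big_split/= mulrC; congr (_ * _).
by rewrite (bigD1 i0)//= eqxx big1 ?mulr1// => i /negbTE ->.
Qed.

Section Law.
Variables (d : nat) (A B : 'M[C]_d) (la mu : 'I_d -> R).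
Hypotheses (la0 : forall i, 0 <= la i) (mu0 : forall i, 0 <= mu i).
Hypothesis supp : forall i j, ns_prob A B la (i, j) != 0 -> 0 < mu j.

Lemma overlap_tpowS n i j i' j' :
  overlap (tpow A n.+2) (tpow B n.+2)
    (@mxtens.mxtens_index d (d ^ n.+1) (i, i')) (@mxtens.mxtens_index d (d ^ n.+1) (j, j')) =
  overlap A B i j * overlap (tpow A n.+1) (tpow B n.+1) i' j'.
Proof.
rewrite /overlap -nsqM; congr nsq.
rewrite [tpow A n.+2](_ : _ = A *t tpow A n.+1)// [tpow B n.+2](_ : _ = B *t tpow B n.+1)//.
by rewrite adj_tens mxtens.tensmx_mul mxtens.tensmxE.
Qed.

Lemma ns_tpowS n i j i' j' :
  ns_prob (tpow A n.+2) (tpow B n.+2) (@tens_fun d la n.+1)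
    (@mxtens.mxtens_index d (d ^ n.+1) (i, i'), @mxtens.mxtens_index d (d ^ n.+1) (j, j')) =
  ns_prob A B la (i, j) * ns_prob (tpow A n.+1) (tpow B n.+1) (@tens_fun d la n) (i', j').
Proof.
by rewrite [LHS]/(tens_fun _ _ * overlap _ _ _ _) tens_fun_index overlap_tpowS mulrACA.
Qed.

Lemma ns_tpow_pos n i j : ns_prob (tpow A n.+1) (tpow B n.+1) (@tens_fun d la n) (i, j) != 0 ->
  0 < @tens_fun d la n i /\ 0 < @tens_fun d mu n j.
Proof.
elim: n i j => [|n IH] i j.
  move=> h; split; last exact: supp h.
  by rewrite lt_neqAle la0 andbT eq_sym; apply: contraNneq h; rewrite /ns_prob /= => ->; rewrite mul0r.
case: (@mxtens.mxtens_indexP d (d ^ n.+1) i) => i1 i2.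
case: (@mxtens.mxtens_indexP d (d ^ n.+1) j) => j1 j2.
rewrite ns_tpowS !tens_fun_index mulf_eq0 negb_or => /andP[h1 h2].
have [p1 p2] := IH _ _ h2; split; rewrite mulr_gt0//; last exact: supp h1.
by rewrite lt_neqAle la0 andbT eq_sym; apply: contraNneq h1; rewrite /ns_prob /= => ->; rewrite mul0r.
Qed.

(** The weights multiply and the log-likelihood ratios add. With [ln 0 = 0] additivity can fail off
    the support, but there the weight vanishes. *)
Lemma ns_tpow_law n (h : R -> R) :
  \sum_i \sum_j ns_prob (tpow A n.+1) (tpow B n.+1) (@tens_fun d la n) (i, j) *
     h (ns_llr (@tens_fun d la n) (@tens_fun d mu n) (i, j)) =
  iid_expect (ns_prob A B la) (ns_llr la mu) n.+1 h.
Proof.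
elim: n h => [|n IH] h.
  rewrite /= (pair_bigA _ (fun i j => ns_prob A B la (i, j) * h (ns_llr la mu (i, j))))/=.
  by apply: eq_bigr => -[i j] _; rewrite add0r.
transitivity (\sum_i \sum_j ns_prob A B la (i, j) *
    iid_expect (ns_prob A B la) (ns_llr la mu) n.+1 (fun x => h (x + ns_llr la mu (i, j))));
  last by rewrite pair_bigA; apply: eq_bigr => -[i j].
rewrite [LHS](@sum_tens _ d (d ^ n.+1)); apply: eq_bigr => i _.
pose F i' j := ns_prob (tpow A n.+2) (tpow B n.+2) (@tens_fun d la n.+1)
    (@mxtens.mxtens_index d (d ^ n.+1) (i, i'), j) *
  h (ns_llr (@tens_fun d la n.+1) (@tens_fun d mu n.+1)
    (@mxtens.mxtens_index d (d ^ n.+1) (i, i'), j)).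
transitivity (\sum_i' \sum_j \sum_j' F i' (@mxtens.mxtens_index d (d ^ n.+1) (j, j'))).
  by apply: eq_bigr => i' _; exact: (@sum_tens _ d (d ^ n.+1) (F i')).
rewrite exchange_big; apply: eq_bigr => j _; rewrite -IH mulr_sumr.
apply: eq_bigr => i' _; rewrite mulr_sumr; apply: eq_bigr => j' _.
rewrite /F ns_tpowS -mulrA; have [->|h1] := eqVneq (ns_prob A B la (i, j)) 0.
  by rewrite !mul0r.
have [->|h2] := eqVneq (ns_prob (tpow A n.+1) (tpow B n.+1) (@tens_fun d la n) (i', j')) 0.
  by rewrite !mul0r.
congr (_ * (_ * h _)); have [p1 p2] := ns_tpow_pos h2; have p3 := supp h1.
have p4 : 0 < la i.
  by rewrite lt_neqAle la0 andbT eq_sym; apply: contraNneq h1; rewrite /ns_prob /= => ->; rewrite mul0r.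
rewrite [LHS]/(ln (tens_fun _ _) - ln (tens_fun _ _)) !tens_fun_index !lnM ?posrE//.
rewrite [LHS](_ : _ = ln (la i) + ln (@tens_fun d la n i') - (ln (mu j) + ln (@tens_fun d mu n j')))//.
by rewrite /ns_llr /=; ring.
Qed.

End Law.
End TensorPowers.

(** * Pinching and hypothesis tests *)

Section PinchingAndTests.
Variable R : realType.
Local Notation C := (R[i]).
Local Notation "x %:C" := (real_complex R x) : ring_scope.
Local Notation "A ^t*" := (adjmx A) (at level 30) : ring_scope.

Lemma adj_udiagZi n (D M : 'M[C]_n) : D^t* = D -> M^t* = M ->
  (D + 'i%C *: M)^t* = D - 'i%C *: M.
Proof.
move=> hD hM; rewrite adjmxD adjmxZ hD hM; congr (_ + _).
have -> : Num.conj 'i%C = - 'i%C :> C by apply/eqP; rewrite eq_complex /= oppr0 !eqxx.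
by rewrite scaleNr.
Qed.

Lemma hermitian_parts_inj n (D M D' M' : 'M[C]_n) :
  D^t* = D -> M^t* = M -> D'^t* = D' -> M'^t* = M' ->
  D + 'i%C *: M = D' + 'i%C *: M' -> D = D' /\ M = M'.
Proof.
move=> hD hM hD' hM' e.
have e' : D - 'i%C *: M = D' - 'i%C *: M' by rewrite -!adj_udiagZi// e.
have DD : D = D'.
  have : 2 *: D = 2 *: D'.
    rewrite !scaler_nat !mulr2n.
    have s (X Y : 'M[C]_n) : X + X = (X + Y) + (X - Y) by rewrite addrACA subrr addr0.
    by rewrite (s D ('i%C *: M)) e e' -s.
  by move/(congr1 ( *:%R 2^-1)); rewrite !scalerA mulVf ?pnatr_eq0// !scale1r.
split=> //; move: e; rewrite DD => /addrI /(congr1 ( *:%R 'i%C^-1)).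
by rewrite !scalerA mulVf ?scale1r// -sqrf_eq0 sqr_i oppr_eq0 oner_eq0.
Qed.

(** Commutation makes [D + i M] normal; one diagonalization of it gives both matrices as its
    Hermitian parts, with the real and imaginary parts of its eigenvalues. *)
Lemma commuting_udiag n (D M : 'M[C]_n) : D^t* = D -> M^t* = M -> D *m M = M *m D ->
  exists2 W, unitary W & exists q r, D = udiag W q /\ M = udiag W r.
Proof.
move=> hD hM DM.
have [|W uW [d e]] := @normal_udiag R n (D + 'i%C *: M).
  have DY : D *m ('i%C *: M) = ('i%C *: M) *m D by rewrite -scalemxAr -scalemxAl DM.
  rewrite adj_udiagZi//; move: ('i%C *: M) DY => Y DY.
  by rewrite !mulmxDl !mulmxDr !mulmxN !mulNmx DY addrACA.
exists W => //; exists (fun i => complex.Re (d ord0 i)), (fun i => complex.Im (d ord0 i)).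
apply: hermitian_parts_inj => //; rewrite ?adj_udiag// e /udiag.
have -> : diag_mx d = diagc (fun i => complex.Re (d ord0 i)) + 'i%C *: diagc (fun i => complex.Im (d ord0 i)).
  apply/matrixP => i j; rewrite !mxE mulrnAr -mulrnDl; congr (_ *+ _).
  exact: complexE.
by rewrite mulmxDr mulmxDl -scalemxAr -scalemxAl.
Qed.

Lemma unitary_conjM n (B Y Z : 'M[C]_n) : unitary B ->
  (B *m Y *m B^t*) *m (B *m Z *m B^t*) = B *m (Y *m Z) *m B^t*.
Proof.
by move=> uB; rewrite !mulmxA -(mulmxA _ (B^t*) B) (unitary_mulV uB) mulmx1.
Qed.

(** In the eigenbasis [B], the matrix [M] keeps only the entries of the state inside blocks of equal
    eigenvalue. It commutes with [diagc mu], so both are diagonalized by one [W], and [W *m B] is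
    the basis sought. If the states commute, no entry is lost and [M] is the state itself. *)
Lemma pinching_basis n (rho B : 'M[C]_n) mu : rho^t* = rho -> unitary B ->
  exists2 U, unitary U & exists q,
   [/\ udiag U q = udiag B mu,
       forall l m, l != m -> q l = q m -> (U *m rho *m U^t*) l m = 0 &
       rho *m udiag B mu = udiag B mu *m rho -> exists p, U *m rho *m U^t* = diagc p].
Proof.
move=> hr uB; pose X := B *m rho *m B^t*.
have hX j k : Num.conj (X j k) = X k j.
  by rewrite -adjmxE /X !adjmxM adjmxK hr mulmxA.
pose M := \matrix_(j, k) (X j k *+ (mu j == mu k)) : 'M[C]_n.
have ME j k : M j k = X j k *+ (mu j == mu k) by rewrite mxE.
have hM : M^t* = M.
  by apply/matrixP => j k; rewrite adjmxE !ME rmorphMn/= hX eq_sym.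
have DM : diagc mu *m M = M *m diagc mu.
  apply/matrixP => j k; rewrite mul_diagc_mx mul_mx_diagc !ME.
  by case: eqP => [->|_]; [rewrite mulrC|rewrite !mulr0n mul0r mulr0].
have [W uW [q [r [eD eM]]]] := commuting_udiag (adj_diagc mu) hM DM.
(* [W] mixes only indices of the same eigenvalue, so inside a block it cannot tell the state from
   its pinching. *)
have Wq l j : W l j != 0 -> mu j = q l.
  have := congr1 (fun Z => (W *m Z) l j) eD.
  rewrite /udiag !mulmxA uW mul1mx mul_diagc_mx mul_mx_diagc => h /mulIf inj.
  by move: h; rewrite mulrC => /inj/complexI.
exists (W *m B); first exact: unitaryM.
exists q; split.
- by rewrite /udiag adjmxM !mulmxA -(mulmxA _ W) -(mulmxA (B^t*)) mulmxA -(mulmxA (B^t*)) -/(udiag W q) -eD.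
- move=> l m lm qlm; have -> : W *m B *m rho *m (W *m B)^t* = W *m X *m W^t*.
    by rewrite adjmxM /X !mulmxA.
  have : (W *m M *m W^t*) l m = 0 by rewrite eM udiagK// diagcE (negbTE lm).
  move=> <-; rewrite [LHS]mxE [RHS]mxE; apply: eq_bigr => j _; rewrite adjmxE.
  have [->|Wm] := eqVneq (W m j) 0; first by rewrite rmorph0 !mulr0.
  congr (_ * _); rewrite [LHS]mxE [RHS]mxE; apply: eq_bigr => k _.
  have [->|Wl] := eqVneq (W l k) 0; first by rewrite !mul0r.
  by rewrite ME (Wq _ _ Wl) (Wq _ _ Wm) qlm eqxx.
- move=> comm; exists r.
  have -> : W *m B *m rho *m (W *m B)^t* = W *m X *m W^t* by rewrite adjmxM /X !mulmxA.
  suff -> : X = M by rewrite eM udiagK.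
  have XD : X *m diagc mu = diagc mu *m X.
    by rewrite -(udiagK mu uB) /X !unitary_conjM// comm.
  apply/matrixP => j k; rewrite ME.
  have := congr1 (fun Z : 'M[C]_n => Z j k) XD; rewrite mul_diagc_mx mul_mx_diagc mulrC.
  case: eqP => [//|mjk]; rewrite mulr0n.
  have [//|Xjk] := eqVneq (X j k) 0.
  by move=> /(mulIf Xjk)/complexI h; case: mjk.
Qed.

Lemma row_diagc_quad n (u : 'rV[C]_n) f :
  (u *m diagc f *m u^t*) ord0 ord0 = (\sum_j f j * nsq (u ord0 j))%:C.
Proof.
rewrite mxE rmorph_sum/=; apply: eq_bigr => j _.
by rewrite mul_mx_diagc adjmxE rmorphM/= nsqE mulrCA mulrA.
Qed.

Section PinchedTest.
Variables (n : nat) (A U : 'M[C]_n) (la q : 'I_n -> R).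
Hypotheses (uA : unitary A) (uU : unitary U) (la0 : forall i, 0 <= la i).
Let M := U *m udiag A la *m U^t*.
Let p l := \sum_i la i * overlap U A l i.
Hypothesis Moff : forall l m, l != m -> q l = q m -> M l m = 0.

Lemma pinched_diag l : M l l = (p l)%:C.
Proof. exact: udiag_conj. Qed.

(* A vector supported on the block [q = kappa], where the pinched state is
   small, has small overlap with an eigenvector of [rho] of large eigenvalue. *)
Lemma pinched_overlap (al kappa : R) (S : pred 'I_n) i :
  (forall l, S l -> q l = kappa /\ p l <= al * kappa) ->
  la i * (\sum_(l | S l) overlap U A l i) ^+ 2 <= al * kappa * \sum_(l | S l) overlap U A l i.
Proof.
move=> HS; set x := \sum_(l | S l) _.
pose c := U *m A^t*.
(* Projection of the [i]-th eigenvector of the state onto the block. Its quadratic form is computed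
   twice: in the basis [U], where the block of [M] is diagonal, and in the eigenbasis, where only
   the [i]-th term is kept. *)
pose v : 'rV[C]_n := \row_l (Num.conj (c l i) *+ S l).
have vE l : v ord0 l = Num.conj (c l i) *+ S l by rewrite mxE.
have E1 : (v *m M *m v^t*) ord0 ord0 = (\sum_(l | S l) p l * overlap U A l i)%:C.
  rewrite mxE rmorph_sum/= [RHS]big_mkcond/=; apply: eq_bigr => m _.
  rewrite adjmxE vE rmorphMn/= conjCK mxE.
  case: (boolP (S m)) => Sm; last by rewrite mulr0n mulr0.
  rewrite (bigD1 m)//= big1 ?addr0 => [|l lm].
    by rewrite vE Sm !mulr1n pinched_diag rmorphM/= /overlap -/c nsqE mulrAC mulrC (mulrC (Num.conj _)).
  rewrite vE; case: (boolP (S l)) => Sl; last by rewrite mulr0n mul0r.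
  by rewrite Moff ?mulr0//; rewrite (HS _ Sl).1 (HS _ Sm).1.
have E2 : (v *m M *m v^t*) ord0 ord0 = (\sum_j la j * nsq ((v *m c) ord0 j))%:C.
  rewrite -row_diagc_quad; congr (fun_of_matrix _ _ _).
  by rewrite /M /udiag /c !adjmxM adjmxK !mulmxA.
have E3 : (v *m c) ord0 i = x%:C.
  rewrite mxE rmorph_sum/= [RHS]big_mkcond/=; apply: eq_bigr => l _.
  rewrite vE; case: (S l); last by rewrite mulr0n mul0r.
  by rewrite mulr1n /overlap nsqE mulrC.
have E4 : nsq ((v *m c) ord0 i) = x ^+ 2.
  by rewrite E3 /nsq /= expr0n addr0.
have {}E2 := complexI (etrans (esym E1) E2).
apply: (@le_trans _ _ (\sum_(l | S l) p l * overlap U A l i)).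
  rewrite E2 -E4 (bigD1 i)//= lerDl sumr_ge0// => j _.
  by rewrite mulr_ge0// nsq_ge0.
rewrite /x mulr_sumr; apply: ler_sum => l Sl.
by rewrite ler_wpM2r ?overlap_ge0//; have [] := HS l Sl.
Qed.

(** Eigenvectors with [la i <= be * q l] give the first term. For the others, each eigenvalue [k] of
    sigma is treated separately: by [pinched_overlap] the relevant overlap is at most
    [al * k / la i], hence at most [al / be]. Averaging over [la] costs [al / be] per eigenvalue. *)
Lemma pinched_test_bound (vals : seq R) (al be : R) :
  \sum_i la i = 1 -> (forall l, 0 <= q l) -> (forall l, q l \in vals) ->
  0 < al -> 0 < be ->
  \sum_(l | p l <= al * q l) p l <=
  \sum_l \sum_(i | la i <= be * q l) la i * overlap U A l i + (size vals)%:R * (al / be).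
Proof.
move=> la1 q0 qv al0 be0.
have ov0 l i : 0 <= la i * overlap U A l i by rewrite mulr_ge0 ?overlap_ge0.
pose F l := \sum_(i | ~~ (la i <= be * q l)) la i * overlap U A l i.
have F0 l : 0 <= F l by rewrite sumr_ge0.
have -> : \sum_(l | p l <= al * q l) p l =
   \sum_(l | p l <= al * q l) \sum_(i | la i <= be * q l) la i * overlap U A l i +
   \sum_(l | p l <= al * q l) F l.
  by rewrite -big_split/=; apply: eq_bigr => l _; rewrite /p (bigID (fun i => la i <= be * q l)).
apply: lerD.
  rewrite big_mkcond/=; apply: ler_sum => l _; case: ifP => // _.
  by rewrite sumr_ge0.
apply: (@le_trans _ _ (\sum_(k <- vals) \sum_(l | (p l <= al * q l) && (q l == k)) F l)).
  under [leRHS]eq_bigr do rewrite big_mkcondr/=.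
  rewrite exchange_big/=; apply: ler_sum => l _.
  by rewrite (big_rem _ (qv l))/= eqxx lerDl sumr_ge0// => k _; case: ifP.
have -> : (size vals)%:R * (al / be) = \sum_(k <- vals) (al / be).
  by rewrite big_const_seq count_predT iter_addr addr0 mulr_natl.
rewrite !big_seq; apply: ler_sum => k _.
pose S := [pred l | (p l <= al * q l) && (q l == k)].
have -> : \sum_(l | S l) F l = \sum_(i | ~~ (la i <= be * k)) la i * \sum_(l | S l) overlap U A l i.
  transitivity (\sum_(l | S l) \sum_(i | ~~ (la i <= be * k)) la i * overlap U A l i).
    by apply: eq_bigr => l /andP[_ /eqP <-].
  by rewrite exchange_big/=; apply: eq_bigr => i _; rewrite mulr_sumr.
rewrite -[leRHS]mul1r -la1 mulr_suml [leRHS](bigID (fun i => ~~ (la i <= be * k)))/=.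
rewrite -[leLHS]addr0 lerD//; last first.
  by rewrite sumr_ge0// => i _; rewrite mulr_ge0// divr_ge0// ltW.
apply: ler_sum => i; rewrite -ltNge => ki.
have H : forall l, S l -> q l = k /\ p l <= al * k.
  by move=> l /andP[h /eqP e]; rewrite -e.
have := pinched_overlap i H; set x := \sum_(l | S l) _ => hx.
have x0 : 0 <= x by rewrite sumr_ge0// => l _; exact: overlap_ge0.
rewrite ler_wpM2l//.
have [->|xn0] := eqVneq x 0; first by rewrite divr_ge0// ltW.
have xp : 0 < x by rewrite lt_neqAle eq_sym xn0.
move: hx; rewrite expr2 mulrA ler_pM2r// => hx.
rewrite ler_pdivlMr//.
have [l Sl|S0] := pickP S; last by move: xn0; rewrite /x big_pred0 ?eqxx.
have k0 : 0 <= k by have [<- _] := H l Sl.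
have lap : 0 < la i by apply: le_lt_trans ki; rewrite mulr_ge0// ltW.
rewrite -(ler_pM2l lap); apply: (@le_trans _ _ (al * k * be)).
  by rewrite mulrA ler_wpM2r// ltW.
by rewrite -mulrA mulrC (mulrC k) ler_wpM2r// ltW.
Qed.

End PinchedTest.

Lemma nsqD_weighted (u v : C) (th : R) : 0 < th ->
  nsq (u + v) <= (1 + th) * nsq u + (1 + th^-1) * nsq v.
Proof.
move=> th0; have key (a b : R) : (a + b) ^+ 2 <= (1 + th) * a ^+ 2 + (1 + th^-1) * b ^+ 2.
  rewrite -subr_ge0.
  have -> : (1 + th) * a ^+ 2 + (1 + th^-1) * b ^+ 2 - (a + b) ^+ 2 = (th * a - b) ^+ 2 / th.
    by field; rewrite gt_eqF.
  by rewrite divr_ge0 ?sqr_ge0// ltW.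
case: u v => [a b] [c d]; rewrite /nsq /=.
have := key a c; have := key b d; lra.
Qed.

Lemma ReB (z w : C) : complex.Re (z - w) = complex.Re z - complex.Re w.
Proof. by case: z w => [a b] [c d]. Qed.

Lemma trace_sqr_udiag n (A B S : 'M[C]_n) la : unitary A -> unitary B -> S^t* = S ->
  \tr (udiag A la *m (S *m S)) = (\sum_i \sum_j la i * nsq ((A *m S *m B^t*) i j))%:C.
Proof.
move=> uA uB hS; rewrite trace_udiag_mul rmorph_sum/=; apply: eq_bigr => i _.
have -> : A *m (S *m S) *m A^t* = (A *m S *m B^t*) *m (A *m S *m B^t*)^t*.
  by rewrite !adjmxM adjmxK hS !mulmxA -(mulmxA _ (B^t*) B) (unitary_mulV uB) mulmx1.
rewrite mxE rmorph_sum/= mulr_sumr; apply: eq_bigr => j _.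
by rewrite rmorphM/= nsqE adjmxE.
Qed.

(** $T-T^2 = T(1-T)T+(1-T)T(1-T)$, a sum of two congruences. *)
Lemma psd_sub_sqr n (T : 'M[C]_n) : psd T -> psd (1%:M - T) -> psd (T - T *m T).
Proof.
move=> pT pT1; have hT := pT.1; have hT1 := pT1.1.
have -> : T - T *m T = T *m (1%:M - T) *m T^t* + (1%:M - T) *m T *m (1%:M - T)^t*.
  have -> : T^t* = T by []; have -> : (1%:M - T)^t* = 1%:M - T by [].
  have -> : T *m (1%:M - T) *m T = T *m T - T *m T *m T by rewrite mulmxBr mulmxBl mulmx1.
  have -> : (1%:M - T) *m T *m (1%:M - T) = T - T *m T - (T *m T - T *m T *m T).
    by rewrite mulmxBl mul1mx mulmxBr mulmx1 mulmxBl.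
  by rewrite [RHS]addrC subrK.
by apply: psdD; exact: psd_conj.
Qed.

(** The amplitude between two eigenvectors splits into its parts through [1 - T] and through [T],
    and $T^2\le T$ bounds the squared parts by the two error terms. An unweighted splitting would
    cost a factor 2 in probability; the weight [th] brings it down to [1 + th] and moves the loss
    into the threshold. *)
Lemma ns_test_bound n (A B T : 'M[C]_n) (la mu : 'I_n -> R) (ga th : R) : unitary A -> unitary B ->
  psd T -> psd (1%:M - T) -> (forall i, 0 <= la i) -> (forall j, 0 <= mu j) ->
  0 < ga -> 0 < th ->
  \sum_i \sum_(j | la i <= th * ga * mu j) la i * overlap A B i j <=
  (1 + th) * (complex.Re (\tr (udiag A la *m (1%:M - T))) + ga * complex.Re (\tr (udiag B mu *m T))).
Proof.
move=> uA uB pT pT1 la0 mu0 ga0 th0.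
have H1 : \sum_i \sum_j la i * nsq ((A *m (1%:M - T) *m B^t*) i j) <=
    complex.Re (\tr (udiag A la *m (1%:M - T))).
  have hS : (1%:M - T)^t* = 1%:M - T by have [] := pT1.
  have pT' : psd (1%:M - (1%:M - T)) by rewrite opprB addrC subrK.
  have := trace_psd_mul_ge0 (psd_udiag A la0) (psd_sub_sqr pT1 pT').
  rewrite mulmxBr raddfB/= (trace_sqr_udiag la uA uB hS) lecE => /andP[_].
  by rewrite ReB Re_real subr_ge0.
have H2 : \sum_i \sum_j mu j * nsq ((A *m T *m B^t*) i j) <=
    complex.Re (\tr (udiag B mu *m T)).
  have hS : T^t* = T by have [] := pT.
  have := trace_psd_mul_ge0 (psd_udiag B mu0) (psd_sub_sqr pT pT1).
  rewrite mulmxBr raddfB/= (trace_sqr_udiag mu uB uA hS) lecE => /andP[_].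
  rewrite ReB Re_real subr_ge0 exchange_big/=; congr (_ <= _).
  apply: eq_bigr => i _; apply: eq_bigr => j _; congr (_ * _).
  by rewrite -(nsq_conj (_ i j)) -adjmxE !adjmxM adjmxK hS mulmxA.
apply: (@le_trans _ _ ((1 + th) * (\sum_i \sum_j la i * nsq ((A *m (1%:M - T) *m B^t*) i j) +
   ga * \sum_i \sum_j mu j * nsq ((A *m T *m B^t*) i j)))); last first.
  by rewrite ler_wpM2l ?addr_ge0// ?(ltW th0)// lerD// ler_wpM2l// ltW.
rewrite mulr_sumr -big_split/= mulr_sumr; apply: ler_sum => i _.
rewrite mulr_sumr -big_split/= mulr_sumr big_mkcond/=; apply: ler_sum => j _.
set u : C := (A *m (1%:M - T) *m B^t*) i j; set v : C := (A *m T *m B^t*) i j.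
have uv : overlap A B i j = nsq (u + v).
  rewrite /overlap; congr nsq.
  have -> : A *m B^t* = A *m (1%:M - T) *m B^t* + A *m T *m B^t*.
    by rewrite mulmxBr mulmxBl mulmx1 subrK.
  by rewrite mxE.
have u0 := nsq_ge0 u; have v0 := nsq_ge0 v.
case: ifP => [h|_]; last first.
  by rewrite mulr_ge0 ?addr_ge0 ?(ltW th0)// mulr_ge0// ?(ltW ga0)// mulr_ge0.
rewrite uv; apply: (le_trans (ler_wpM2l (la0 i) (nsqD_weighted u v th0))).
have e : 1 + th^-1 = (1 + th) / th by field; rewrite gt_eqF.
have h2 : la i / th * nsq v <= ga * (mu j * nsq v).
  rewrite mulrA ler_wpM2r// ler_pdivrMr//; move: h; lra.
rewrite e.
have -> : la i * ((1 + th) * nsq u + (1 + th) / th * nsq v) = (1 + th) * (la i * nsq u + la i / th * nsq v).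
  by ring.
by rewrite ler_wpM2l ?addr_ge0// ?(ltW th0)// lerD2l.
Qed.

End PinchingAndTests.

(** * Asymptotics of tests on tensor powers *)

Section AsymptoticTests.
Variable R : realType.
Local Notation C := (R[i]).
Local Notation "x %:C" := (real_complex R x) : ring_scope.
Local Notation "A ^t*" := (adjmx A) (at level 30) : ring_scope.
Local Notation Phi := (@ncdf R 0 1).

Lemma overlapC n (A B : 'M[C]_n) i j : overlap A B i j = overlap B A j i.
Proof. by rewrite /overlap -nsq_conj -adjmxE adjmxM adjmxK. Qed.

Lemma overlap_id n (A : 'M[C]_n) i j : unitary A -> overlap A A i j = (i == j)%:R.
Proof.
move=> uA; rewrite /overlap uA mxE; case: eqP => _; rewrite /nsq /=.
  by rewrite expr1n expr0n addr0.
by rewrite !expr0n addr0.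
Qed.

(** Both sums are the [i]-th diagonal entry, in the basis [A], of [h] applied to the common matrix.
    Sums over a measurement basis thereby become Nussbaum-Szkola sums. *)
Lemma overlap_fun_uniq n (A B U : 'M[C]_n) mu q (h : R -> R) i : unitary B -> unitary U ->
  udiag U q = udiag B mu ->
  \sum_l h (q l) * overlap U A l i = \sum_j h (mu j) * overlap A B i j.
Proof.
move=> uB uU e; apply: (@complexI R).
transitivity ((A *m udiag U (h \o q) *m A^t*) i i).
  rewrite udiag_conj; congr (_%:C); apply: eq_bigr => l _ /=.
  by rewrite overlapC.
by rewrite (udiag_fun_uniq h uU uB e) udiag_conj.
Qed.

Lemma udiag_spectrum n (B U : 'M[C]_n) mu q l : unitary B -> unitary U ->
  udiag U q = udiag B mu -> exists j, q l = mu j.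
Proof.
move=> uB uU e; apply: contrapT => /forallNP H.
have := overlap_fun_uniq U (fun y => (y == q l)%:R) l uB uU e.
rewrite [RHS]big1 => [|j _]; last first.
  by case: eqP => [h|_]; [case: (H j)|rewrite mul0r].
rewrite (bigD1 l)//= eqxx overlap_id// eqxx mul1r big1 ?addr0 => [/eqP|i il].
  by rewrite oner_eq0.
by rewrite overlap_id// (negbTE il) mulr0.
Qed.

Lemma poly_expR_small (d : nat) (eta e : R) : 0 < eta -> 0 < e ->
  exists N, forall n, (N <= n)%N ->
    (n.+2 ^ d)%:R * expR (- (eta * Num.sqrt n.+1%:R)) <= e.
Proof.
move=> eta0 e0; pose k := (2 * d + 2)%N.
have k0 : 0 < k%:R :> R by rewrite ltr0n /k addn2.
pose c : R := (eta / k%:R) ^+ k.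
have c0 : 0 < c by rewrite exprn_gt0// divr_gt0.
exists (Num.truncn (2 ^+ d / (c * e))).+1 => n Nn.
have n0 : 0 < n.+1%:R :> R by [].
set x := eta * _; have x0 : 0 <= x by rewrite mulr_ge0 ?sqrtr_ge0// ltW.
have H1 : c * n.+1%:R ^+ d.+1 <= expR x.
  have -> : expR x = expR (x / k%:R) ^+ k.
    by rewrite -expRM_natl; congr expR; field; rewrite gt_eqF.
  have -> : c * n.+1%:R ^+ d.+1 = (x / k%:R) ^+ k.
    rewrite /c /x -[X in X ^+ d.+1](@sqr_sqrtr R n.+1%:R) ?ler0n// -exprM.
    have -> : (2 * d.+1 = k)%N by rewrite /k mulnS addnC.
    by rewrite -exprMn; congr (_ ^+ _); ring.
  apply: lerXn2r; rewrite ?nnegrE ?expR_ge0 ?divr_ge0 ?ler0n//.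
  by have := expR_ge1Dx (x / k%:R); lra.
have H2 : (n.+2 ^ d)%:R <= 2 ^+ d * n.+1%:R ^+ d :> R.
  rewrite natrX -exprMn; case: (d) => [//|d']; rewrite ler_pXn2r ?nnegrE ?mulr_ge0//.
  by rewrite -natrM ler_nat mul2n -addnn addSn ltnS leq_addl.
rewrite expRN ler_pdivrMr ?expR_gt0//.
apply: (le_trans H2); apply: (@le_trans _ _ (e * (c * n.+1%:R ^+ d.+1))); last first.
  by rewrite ler_wpM2l// ltW.
rewrite exprS !mulrA ler_wpM2r ?exprn_ge0 ?ler0n//.
rewrite -ler_pdivrMl ?mulr_gt0// mulrC (mulrC e c); apply: ltW.
by apply: (lt_le_trans (truncnS_gt _)); rewrite ler_nat (leq_trans Nn).
Qed.

(* [U] diagonalizes [sigma] and, inside each eigenspace of [sigma], the pinching of [rho],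
   whose eigenvalues are [p]. *)
Record meas_basis n (rho sigma U : 'M[C]_n) (p q : 'I_n -> R) : Prop := MeasBasis {
  mb_unitary : unitary U;
  mb_sigma : sigma = udiag U q;
  mb_diag : forall l, (U *m rho *m U^t*) l l = (p l)%:C;
  mb_pinch : forall l m, l != m -> q l = q m -> (U *m rho *m U^t*) l m = 0;
  mb_comm : rho *m sigma = sigma *m rho -> rho = udiag U p;
  mb_p0 : forall l, 0 <= p l;
  mb_q0 : forall l, 0 <= q l;
  mb_p1 : \sum_l p l = 1;
  mb_q1 : \sum_l q l = 1 }.

Lemma le_of_scaled_le (p b th : R) : 0 < th -> p <= 1 ->
  p - 2 * th <= (1 + th) * (1 - b + th) -> b <= 1 - p + 4 * th.
Proof.
move=> th0 p1 h; rewrite leNgt; apply/negP => hb.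
have h1 : (1 + th) * (1 - b + th) <= (1 + th) * (p - 3 * th).
  by rewrite ler_wpM2l ?addr_ge0// ?(ltW th0)//; lra.
have h2 : th * p <= th by rewrite ler_piMr// ltW.
have h3 : 0 < th * th by rewrite mulr_gt0.
lra.
Qed.

Section Decomposed.
Variables (d : nat) (A B : 'M[C]_d) (la mu : 'I_d -> R).
Hypotheses (uA : unitary A) (uB : unitary B).
Hypotheses (la0 : forall i, 0 <= la i) (mu0 : forall j, 0 <= mu j).
Hypotheses (la1 : \sum_i la i = 1) (mu1 : \sum_j mu j = 1).
Hypothesis supp : forall i j, ns_prob A B la (i, j) != 0 -> 0 < mu j.
Let D := relent (udiag A la) (udiag B mu).
Let V := relvar (udiag A la) (udiag B mu).
Hypothesis V0 : 0 < V.
Let thr n (x : R) : R := n.+1%:R * D + x * Num.sqrt (n.+1%:R * V).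

Let ns_cdf n (t : R) : R := \sum_i \sum_(j | @tens_fun R d la n i <= t * @tens_fun R d mu n j)
  @tens_fun R d la n i * overlap (tpow A n.+1) (tpow B n.+1) i j.

Lemma ns_prob_ge0 ij : 0 <= ns_prob A B la ij.
Proof. by rewrite mulr_ge0 ?overlap_ge0. Qed.

Lemma ns_prob_sum1 : \sum_ij ns_prob A B la ij = 1.
Proof.
rewrite -(pair_bigA _ (fun i j => ns_prob A B la (i, j)))/= -la1.
by apply: eq_bigr => i _; rewrite /ns_prob /= -mulr_sumr overlap_row// mulr1.
Qed.

Lemma ns_cdf_expect n a : ns_cdf n (expR a) =
  iid_expect (ns_prob A B la) (ns_llr la mu) n.+1 (fun x => (x <= a)%R%:R).
Proof.
rewrite -(ns_tpow_law la0 supp); apply: eq_bigr => i _.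
rewrite big_mkcond/=; apply: eq_bigr => j _.
have [z|nz] := eqVneq (ns_prob (tpow A n.+1) (tpow B n.+1) (@tens_fun R d la n) (i, j)) 0.
  by rewrite z mul0r; move: z; rewrite /ns_prob /= => ->; case: ifP.
have [p1 p2] := ns_tpow_pos la0 supp nz.
rewrite -[ns_prob _ _ _ _]/(tens_fun la i * overlap _ _ i j).
rewrite [ns_llr _ _ _](_ : _ = ln (tens_fun la i) - ln (tens_fun mu j))//.
have -> : (ln (tens_fun la i) - ln (tens_fun mu j) <= a) = (tens_fun la i <= expR a * tens_fun mu j).
  rewrite [LHS]lerBlDr -[LHS]ler_expR expRD !lnK// ?posrE//.
by case: ifP; rewrite ?mulr1 ?mulr0.
Qed.

Lemma ns_cdf_cvg x e : 0 < e -> exists N, forall n, (N <= n)%N ->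
  `|ns_cdf n (expR (thr n x)) - Phi x| <= e.
Proof.
move=> e0; have [N HN] := clt ns_prob_ge0 ns_prob_sum1 V0
  (esym (relent_ns la mu uA uB)) (esym (relvar_ns la mu uA uB)) x e0.
exists N => n Nn; rewrite ns_cdf_expect; exact/HN/(leq_trans Nn).
Qed.

Lemma ns_cdf_homo n s t : s <= t -> ns_cdf n s <= ns_cdf n t.
Proof.
move=> st; apply: ler_sum => i _; rewrite big_mkcond [leRHS]big_mkcond/=.
apply: ler_sum => j _.
have t0 := @tens_fun_ge0 R d la n la0 i; have m0 := @tens_fun_ge0 R d mu n mu0 j.
case: ifP => [h|_]; last by case: ifP => // _; rewrite mulr_ge0 ?overlap_ge0.
by rewrite ifT// (le_trans h)// ler_wpM2r.
Qed.

Lemma sqrt_unbounded (K eta : R) : 0 < eta -> exists N, forall n, (N <= n)%N ->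
  K <= eta * Num.sqrt (n.+1%:R * V).
Proof.
move=> eta0; exists (Num.truncn ((K / eta) ^+ 2 / V)).+1 => n Nn.
rewrite -ler_pdivrMl// mulrC; apply: (le_trans (ler_norm _)).
rewrite -sqrtr_sqr ler_sqrt ?mulr_ge0 ?ler0n ?(ltW V0)// -ler_pdivrMr//.
apply: ltW; apply: (lt_le_trans (truncnS_gt _)); rewrite ler_nat.
exact: (leq_trans Nn).
Qed.

(** [ns_test_bound] loses a constant factor in the likelihood threshold, which is covered by
    lowering the quantile from [x] to [x - th] once $\sqrt n$ is large; the loss in probability is a
    multiple of [th]. *)
Lemma test_converse x e : 0 < e -> exists N, forall n, (N <= n)%N ->
  forall T : 'M[C]_(d ^ n.+1), psd T -> psd (1%:M - T) ->
  complex.Re (\tr (tpow (udiag B mu) n.+1 *m T)) <= expR (- thr n x) ->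
  complex.Re (\tr (tpow (udiag A la) n.+1 *m T)) <= 1 - Phi x + e.
Proof.
move=> e0; pose th := e / 4; have th0 : 0 < th by rewrite divr_gt0.
have [N1 H1] := ns_cdf_cvg (x - th) th0.
have [N2 H2] := sqrt_unbounded (- (2 * ln th)) th0.
exists (maxn N1 N2) => n; rewrite geq_max => /andP[n1 n2] T pT pT1 hT.
have ga0 : 0 < th * expR (thr n x) by rewrite mulr_gt0 ?expR_gt0.
have := ns_test_bound (unitary_tpow n uA) (unitary_tpow n uB) pT pT1
  (tens_fun_ge0 la0) (tens_fun_ge0 mu0) ga0 th0.
rewrite -!udiag_tpow -/(ns_cdf n (th * (th * expR (thr n x)))) mulmxBr mulmx1 raddfB/=.
set tr1 := \tr (tpow (udiag A la) n.+1).
have -> : tr1 = 1.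
  rewrite /tr1 udiag_tpow trace_udiag ?tens_fun_sum1 ?rmorph1//.
  exact: unitary_tpow.
set a := complex.Re (\tr _) in hT *; rewrite [complex.Re (1 - _)]ReB; set b := complex.Re (\tr _).
have -> : complex.Re (1 : C) = 1 by [].
have ha : th * expR (thr n x) * a <= th.
  rewrite -mulrA ler_piMr// ?(ltW th0)//.
  by apply: (le_trans (ler_wpM2l (expR_ge0 _) hT)); rewrite -expRD subrr expR0.
have hc : expR (thr n (x - th)) <= th * (th * expR (thr n x)).
  have -> : th * (th * expR (thr n x)) = expR (2 * ln th + thr n x).
    by rewrite (expRD (2 * ln th)) mulr_natl mulr2n (expRD (ln th)) !lnK ?posrE// mulrA.
  by rewrite ler_expR /thr mulrBl addrA [leRHS]addrC lerD2l lerNl; exact: H2.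
have := ns_cdf_homo n hc; have := H1 n n1; rewrite ler_norml => /andP[h1 _] h2 h3.
have := Phi_lip x (x - th); rewrite opprB addrCA subrr addr0 (gtr0_norm th0) ler_norml => /andP[_ h4].
have h5 : Phi x - 2 * th <= (1 + th) * (1 - b + th).
  apply: (le_trans _ (le_trans h2 (le_trans h3 _))); first by lra.
  by rewrite ler_wpM2l ?addr_ge0// ?(ltW th0)// lerD2l.
have P1 := ncdf_le1 0 1 x.
have -> : e = 4 * th by rewrite /th; field.
exact: le_of_scaled_le h5.
Qed.

Lemma meas_basis_exists n : exists U p q,
  meas_basis (tpow (udiag A la) n.+1) (tpow (udiag B mu) n.+1) U p q.
Proof.
have uAn := unitary_tpow n uA; have uBn := unitary_tpow n uB.
rewrite !udiag_tpow; set rho := udiag (tpow A n.+1) _.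
have [U uU [q [e off comm]]] := pinching_basis (@tens_fun R d mu n) (adj_udiag _ _ : adjmx rho = rho) uBn.
pose p l := \sum_i tens_fun la i * overlap U (tpow A n.+1) l i.
have pE l : (U *m rho *m U^t*) l l = (p l)%:C by exact: udiag_conj.
exists U, p, q; split => //.
- move=> /comm[p' e']; have pp l : p l = p' l.
    by have := pE l; rewrite e' diagcE eqxx mulr1n => /complexI.
  rewrite (eq_udiag U pp) /udiag -e' !mulmxA (unitary_mulV uU) mul1mx.
  by rewrite -mulmxA (unitary_mulV uU) mulmx1.
- by move=> l; rewrite sumr_ge0// => i _; rewrite mulr_ge0 ?overlap_ge0// tens_fun_ge0.
- by move=> l; have [j ->] := udiag_spectrum l uBn uU e; exact: tens_fun_ge0.
- rewrite /p exchange_big/= -(tens_fun_sum1 n la1); apply: eq_bigr => i _.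
  by rewrite -mulr_sumr overlap_col// mulr1.
- apply: (@complexI R); rewrite -(trace_udiag q uU) e trace_udiag//.
  by rewrite tens_fun_sum1.
Qed.

(** The measured mass cannot be too small, because the likelihood-ratio test in the basis [U] is a
    quantum test and obeys [test_converse]. It cannot be too large, by [pinched_test_bound]. *)
Lemma meas_basis_law x e : 0 < e -> exists N, forall n, (N <= n)%N -> forall U p q,
  meas_basis (tpow (udiag A la) n.+1) (tpow (udiag B mu) n.+1) U p q ->
  `|\sum_(l | p l <= expR (thr n x) * q l) p l - Phi x| <= e.
Proof.
move=> e0; pose eta := e / 3; have eta0 : 0 < eta by rewrite divr_gt0.
have [N1 H1] := test_converse x e0.
have [N2 H2] := ns_cdf_cvg (x + eta) eta0.
have etaV : 0 < eta * Num.sqrt V by rewrite mulr_gt0 ?sqrtr_gt0.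
have [N3 H3] := poly_expR_small d etaV eta0.
exists (maxn N1 (maxn N2 N3)) => n; rewrite !geq_max => /and3P[n1 n2 n3] U p q.
case=> uU sE rE pinch _ p0 q0 p1 q1.
set F := \sum_(l | _) p l; set al := expR (thr n x) in F *.
have al0 : 0 < al by exact: expR_gt0.
rewrite ler_norml; apply/andP; split.
  pose T := udiag U (fun l => (~~ (p l <= al * q l))%:R).
  have pT : psd T by apply: psd_udiag => l; rewrite ler0n.
  have pT1 : psd (1%:M - T).
    rewrite -(udiag1 uU) udiagB; apply: psd_udiag => l.
    by case: (p l <= _); rewrite ?subr0 ?subrr.
  have trT f : complex.Re (\tr (udiag U f *m T)) = \sum_(l | ~~ (p l <= al * q l)) f l.
    rewrite udiagM// trace_udiag// Re_real [RHS]big_mkcond/=.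
    by apply: eq_bigr => l _; case: (p l <= _); rewrite /= ?mulr1 ?mulr0.
  have := H1 n n1 T pT pT1; rewrite sE trT.
  have -> : complex.Re (\tr (tpow (udiag A la) n.+1 *m T)) = 1 - F.
    have pF : \sum_(l | ~~ (p l <= al * q l)) p l = 1 - F.
      by apply/esym/eqP; rewrite subr_eq -p1 [X in X == _](bigID (fun l => p l <= al * q l))/= addrC.
    rewrite mxtrace_mulC trace_udiag_mul -pF.
    rewrite -[RHS]Re_real rmorph_sum [in RHS]big_mkcond/=; congr complex.Re.
    apply: eq_bigr => l _; rewrite rE.
    by case: (p l <= _); rewrite /= ?mul1r ?mul0r.
  have hq : \sum_(l | ~~ (p l <= al * q l)) q l <= expR (- thr n x).
    rewrite expRN -/al -[leRHS]mulr1 -p1 mulr_sumr big_mkcond/=; apply: ler_sum => l _.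
    have h0 : 0 <= al^-1 * p l by rewrite mulr_ge0// invr_ge0 ltW.
    case: ifP => // ; rewrite -ltNge => h; rewrite ler_pdivlMl//; exact: ltW.
  by move=> /(_ hq); lra.
(* Raising the threshold by $\eta\sqrt{nV}$ moves the limit by at most [eta] and makes the ratio
   [al / be] beat the polynomial number of eigenvalues. *)
have be0 : 0 < al * expR (eta * Num.sqrt (n.+1%:R * V)) by rewrite mulr_gt0 ?expR_gt0.
have uAn := unitary_tpow n uA; have uBn := unitary_tpow n uB.
rewrite !udiag_tpow in sE rE pinch.
have := @pinched_test_bound R _ _ _ _ q (tens_fun_ge0 la0) pinch (type_values mu n)
   al _ (tens_fun_sum1 n la1) q0 _ al0 be0.
have qv l : q l \in type_values mu n.
  by have [j ->] := udiag_spectrum l uBn uU (esym sE); exact: mem_type_values.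
move=> /(_ qv).
have pE l : \sum_i tens_fun la i * overlap U (tpow A n.+1) l i = p l.
  by have := rE l; rewrite udiag_conj => /complexI.
under eq_bigl do rewrite pE.
under eq_bigr do rewrite pE.
have alX (X : R) : al / (al * X) = X^-1 by rewrite invfM mulrA divff ?mul1r// gt_eqF.
rewrite -/F size_type_values alX -expRN.
set be := al * _ in be0 *.
have -> : \sum_l \sum_(i | tens_fun la i <= be * q l) tens_fun la i * overlap U (tpow A n.+1) l i =
    ns_cdf n be.
  rewrite /ns_cdf; under eq_bigr do rewrite big_mkcond/=.
  rewrite exchange_big/=; apply: eq_bigr => i _; rewrite [RHS]big_mkcond/=.
  have h := overlap_fun_uniq (tpow A n.+1)
    (fun y => if tens_fun la i <= be * y then tens_fun la i else 0) i uBn uU (esym sE).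
  transitivity (\sum_l (if tens_fun la i <= be * q l then tens_fun la i else 0) *
     overlap U (tpow A n.+1) l i).
    by apply: eq_bigr => l _; case: ifP; rewrite ?mul0r.
  by rewrite h; apply: eq_bigr => j _; case: ifP; rewrite ?mul0r.
have -> : be = expR (thr n (x + eta)).
  by rewrite /be /al -expRD; congr expR; rewrite /thr mulrDl addrA.
have := H2 n n2; rewrite ler_norml => /andP[_ h2].
have := H3 n n3; rewrite -mulrA -sqrtrM ?(ltW V0)// (mulrC V) => h3 h4.
have := Phi_lip (x + eta) x; rewrite addrAC subrr add0r (gtr0_norm eta0) ler_norml => /andP[_ h5].
have e3 : e = eta + eta + eta by rewrite /eta; lra.
rewrite e3; move: h2 h3 h4 h5.
move: F (ns_cdf _ _) (Phi x) (Phi (x + eta)) (_ * expR _) => a1 a2 a3 a4 a5 ? ? ? ?.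
lra.
Qed.

End Decomposed.
End AsymptoticTests.

(** * Channels *)

Section Channels.
Variable R : realType.
Local Notation C := (R[i]).
Local Notation "x %:C" := (real_complex R x) : ring_scope.
Local Notation "A ^t*" := (adjmx A) (at level 30) : ring_scope.
Local Notation "A *t B" := (mxtens.tensmx A B) (at level 40, left associativity) : ring_scope.

Lemma trdist_udiag n (U : 'M[C]_n) f g : unitary U ->
  trdist (udiag U f) (udiag U g) = (\sum_i `|f i - g i|) / 2.
Proof.
move=> uU; rewrite /trdist /trnorm udiagB adj_udiag udiagM// mxfun_udiag// trace_udiag//.
rewrite Re_real; congr (_ / _); apply: eq_bigr => i _ /=.
by rewrite -expr2 sqrtr_sqr.
Qed.

(** In the eigenbasis of the difference the test has diagonal entries in $[0,1]$; adding half of the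
    zero trace turns the eigenvalues into halves of absolute values. *)
Lemma test_le_trdist n (rho sigma T : 'M[C]_n) : Defs.hermitian rho -> Defs.hermitian sigma ->
  \tr rho = \tr sigma -> psd T -> psd (1%:M - T) ->
  complex.Re (\tr (sigma *m T)) - complex.Re (\tr (rho *m T)) <= trdist rho sigma.
Proof.
move=> hr hs trE pT pT1.
have hD : Defs.hermitian (rho - sigma) by rewrite /Defs.hermitian adjmxB hr hs.
have [U uU [f eD]] := hermitian_udiag hD.
have tr0 : \sum_i f i = 0.
  by apply: (@complexI R); rewrite -(trace_udiag f uU) -eD raddfB/= trE subrr.
have -> : trdist rho sigma = (\sum_i `|f i|) / 2.
  rewrite /trdist -[rho - sigma]subr0.
  have -> : (0 : 'M[C]_n) = udiag U (fun=> 0).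
    rewrite /udiag; have -> : diagc (fun _ : 'I_n => 0 : R) = 0.
      by apply/matrixP => i j; rewrite diagcE mxE rmorph0 mul0rn.
    by rewrite mulmx0 mul0mx.
  rewrite eD -[X in X / 2]/(trnorm (udiag U f - udiag U (fun=> 0))).
  rewrite -[LHS]/(trdist _ _) trdist_udiag//; congr (_ / _).
  by apply: eq_bigr => i _; rewrite subr0.
pose t i := complex.Re ((U *m T *m U^t*) i i).
have pc := psd_conj U pT; have pc1 := psd_conj U pT1.
have tE i : (U *m T *m U^t*) i i = (t i)%:C.
  by rewrite /t RRe_real//; apply: ger0_real; exact: psd_diag_entry.
have t0 i : 0 <= t i.
  by rewrite -ler0c -tE; exact: psd_diag_entry.
have t1 i : t i <= 1.
  have := psd_diag_entry i pc1.
  rewrite mulmxBr mulmxBl mulmx1 uU; rewrite [X in 0 <= X]mxE [X in _ + X]mxE tE.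
  by rewrite mxE eqxx -(rmorph1 (real_complex R)) -rmorphB ler0c subr_ge0.
have trT : \tr (udiag U f *m T) = (\sum_i f i * t i)%:C.
  by rewrite trace_udiag_mul rmorph_sum/=; apply: eq_bigr => i _; rewrite tE -rmorphM.
rewrite -ReB -raddfB/= -mulmxBl -opprB eD mulNmx raddfN/= trT -rmorphN Re_real.
rewrite -[X in X <= _]addr0 -[X in _ + X <= _](mul0r 2^-1) -[X in _ + X * _ <= _]tr0.
rewrite -sumrN !mulr_suml -big_split/=; apply: ler_sum => i _.
have := t0 i; have := t1 i; case: (ger0P (f i)) => h h1 h2; nra.
Qed.

Lemma psd_reindex m n (f : 'I_m -> 'I_n) (Y : 'M[C]_n) : psd Y ->
  psd (\matrix_(i, j) Y (f i) (f j)).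
Proof.
move=> pY; pose K : 'M[C]_(m, n) := \matrix_(i, j) (f i == j)%:R.
suff -> : \matrix_(i, j) Y (f i) (f j) = K *m Y *m K^t* by exact: psd_conj.
apply/matrixP => i j; rewrite mxE [RHS]mxE (bigD1 (f j))//= big1 => [|k kj].
  rewrite adjmxE [K _ _]mxE eqxx rmorph1 mulr1 addr0 mxE (bigD1 (f i))//= big1 => [|k ki].
    by rewrite mxE eqxx mul1r addr0.
  by rewrite mxE eq_sym (negbTE ki) mul0r.
by rewrite adjmxE [K _ _]mxE eq_sym (negbTE kj) rmorph0 mulr0.
Qed.

Lemma channel_psd d1 d2 (E : 'M[C]_d1 -> 'M[C]_d2) Y : is_channel E -> psd Y -> psd (E Y).
Proof.
move=> [_ _ cp] pY.
have := cp 1%N _ (psd_reindex (fun k => (@mxtens.mxtens_unindex 1 d1 k).2) pY).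
move=> /(psd_reindex (fun x => @mxtens.mxtens_index 1 d2 (ord0, x))).
set Z := \matrix_(i, j) _; suff -> : Z = E Y by [].
apply/matrixP => x y; rewrite !mxE !mxtens.mxtens_indexK /=.
suff -> : blockmx (\matrix_(i, j) Y (@mxtens.mxtens_unindex 1 d1 i).2 (@mxtens.mxtens_unindex 1 d1 j).2) ord0 ord0 = Y by [].
by apply/matrixP => a b; rewrite mxE [LHS]mxE !mxtens.mxtens_indexK.
Qed.

Lemma row_conj_entry n (U M : 'M[C]_n) i :
  (row i U *m M *m (row i U)^t*) ord0 ord0 = (U *m M *m U^t*) i i.
Proof.
rewrite -row_mul [LHS]mxE [RHS]mxE; apply: eq_bigr => j _.
by rewrite [row _ _ _ _]mxE !adjmxE [row _ _ _ _]mxE.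
Qed.

(** Over the complex numbers a real-valued form is Hermitian: the difference with the adjoint is
    normal, and its eigenvalues are differences of a real number and its conjugate. *)
Lemma psd_of_form n (M : 'M[C]_n) :
  (forall v : 'rV[C]_n, 0 <= (v *m M *m v^t*) ord0 ord0) -> psd M.
Proof.
move=> H; split => //; pose N := M^t* - M.
have hN : N^t* = - N by rewrite /N adjmxB adjmxK opprB.
have [|U uU [d eN]] := @normal_udiag R n N; first by rewrite hN mulmxN mulNmx.
suff d0 : d = 0.
  have : N = 0 by rewrite eN d0 (_ : diag_mx 0 = 0) ?mulmx0 ?mul0mx//;
    apply/matrixP => i j; rewrite !mxE mul0rn.
  by move=> /eqP; rewrite subr_eq0 => /eqP.
apply/rowP => i; rewrite mxE.
have e1 : (row i U *m N *m (row i U)^t*) ord0 ord0 = d ord0 i.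
  have : U *m N *m U^t* = diag_mx d by rewrite eN !mulmxA uU mul1mx -mulmxA uU mulmx1.
  move=> /(congr1 (fun Z : 'M[C]_n => Z i i)); rewrite [X in _ = X -> _]mxE eqxx mulr1n => <-.
  exact: row_conj_entry.
rewrite -e1; have := H (row i U); set v := row i U.
have e2 : (v *m M^t* *m v^t*) ord0 ord0 = Num.conj ((v *m M *m v^t*) ord0 ord0).
  by rewrite -adjmxE !adjmxM adjmxK mulmxA.
move=> h; rewrite /N mulmxBr mulmxBl mxE e2 [X in _ + X]mxE.
by rewrite (CrealP (ger0_real h)) subrr.
Qed.

Lemma channel_sum d1 d2 (E : 'M[C]_d1 -> 'M[C]_d2) (I : Type) (r : seq I) (c : I -> C) X :
  is_channel E -> E (\sum_(i <- r) c i *: X i) = \sum_(i <- r) c i *: E (X i).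
Proof.
move=> [lin _ _]; have E0 : E 0 = 0.
  by have := lin 1 0 0; rewrite !scale1r addr0 => /eqP; rewrite eq_sym -subr_eq0 addrK => /eqP.
by elim: r => [|i r IH]; rewrite ?big_nil// !big_cons lin IH.
Qed.

(** The Heisenberg picture, defined on matrix units. Positivity of [T'] comes from that of the
    channel, positivity of [1%:M - T'] also from trace preservation. *)
Lemma channel_adjoint_test d1 d2 (E : 'M[C]_d1 -> 'M[C]_d2) T : is_channel E ->
  psd T -> psd (1%:M - T) -> exists T', [/\ psd T', psd (1%:M - T') &
    forall X, \tr (X *m T') = \tr (E X *m T)].
Proof.
move=> ch pT pT1; have [_ trE _] := ch.
pose T' : 'M[C]_d1 := \matrix_(j, i) \tr (E (delta_mx i j) *m T).
have HT X : \tr (X *m T') = \tr (E X *m T).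
  have eX : X = \sum_ij X ij.1 ij.2 *: delta_mx ij.1 ij.2.
    by rewrite {1}(matrix_sum_delta X) pair_bigA.
  rewrite [in RHS]eX channel_sum// mulmx_suml raddf_sum/=.
  rewrite -(pair_bigA _ (fun i j => \tr (X i j *: E (delta_mx i j) *m T)))/=.
  apply: eq_bigr => i _; rewrite mxE; apply: eq_bigr => j _.
  by rewrite -scalemxAl mxtraceZ mxE.
have form (v : 'rV[C]_d1) S : (v *m S *m v^t*) ord0 ord0 = \tr ((v^t* *m v) *m S).
  by rewrite -[in RHS]mulmxA [RHS]mxtrace_mulC /mxtrace big_ord1.
have pv (v : 'rV[C]_d1) : psd (v^t* *m v).
  rewrite -{2}(adjmxK v); have -> : v^t* *m v^t*^t* = v^t* *m 1%:M *m v^t*^t* by rewrite mulmx1.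
  apply: psd_conj; rewrite -diagc1; apply: psd_diagc => i; exact: ler01.
exists T'; split => //; apply: psd_of_form => v.
  by rewrite form HT trace_psd_mul_ge0//; exact: channel_psd.
rewrite form mulmxBr raddfB/= mulmx1 HT -trE -raddfB/= -{1}(mulmx1 (E _)) -mulmxBr.
by rewrite trace_psd_mul_ge0//; exact: channel_psd.
Qed.

Lemma psd_tens m n (P : 'M[C]_m) (Q : 'M[C]_n) : psd P -> psd Q -> psd (P *t Q).
Proof.
move=> pP pQ; have [U uU [f eP]] := hermitian_udiag pP.1.
have [W uW [g eQ]] := hermitian_udiag pQ.1; rewrite eP eQ in pP pQ *.
rewrite udiag_tens; apply: psd_udiag => k.
by rewrite mulr_ge0 ?(psd_udiag_ge0 uU pP) ?(psd_udiag_ge0 uW pQ).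
Qed.

Lemma psd_sum n (I : Type) (r : seq I) (X : I -> 'M[C]_n) :
  (forall i, psd (X i)) -> psd (\sum_(i <- r) X i).
Proof.
move=> pX; elim: r => [|i r IH]; last by rewrite big_cons; exact: psdD.
rewrite big_nil; have -> : (0 : 'M[C]_n) = diagc (fun=> 0).
  by apply/matrixP => i j; rewrite diagcE mxE rmorph0 mul0rn.
exact: psd_diagc.
Qed.

Definition measure_prepare d1 d2 (U : 'M[C]_d1) (W : 'M[C]_d2) (t : 'I_d1 -> 'I_d2 -> R)
    (X : 'M[C]_d1) : 'M[C]_d2 :=
  \sum_l (U *m X *m U^t*) l l *: udiag W (t l).

Lemma measure_prepare_channel d1 d2 (U : 'M[C]_d1) (W : 'M[C]_d2) (t : 'I_d1 -> 'I_d2 -> R) :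
  unitary U -> unitary W ->
  (forall l k, 0 <= t l k) -> (forall l, \sum_k t l k = 1) ->
  is_channel (measure_prepare U W t).
Proof.
move=> uU uW t0 t1; split.
- move=> c X Y; rewrite /measure_prepare scaler_sumr -big_split/=.
  apply: eq_bigr => l _; rewrite mulmxDr mulmxDl mxE scalerDl; congr (_ + _).
  by rewrite -scalemxAr -scalemxAl mxE scalerA.
- move=> X; rewrite /measure_prepare raddf_sum/=.
  under eq_bigr do rewrite mxtraceZ trace_udiag// t1 rmorph1 mulr1.
  rewrite -[LHS]/(\tr (U *m X *m U^t*)) mxtrace_mulC mulmxA.
  by rewrite (unitary_mulV uU) mul1mx.
move=> k X pX.
(* The identity on the ancilla tensored with the [l]-th row of [U]: the amplified map becomes a sum
   of congruences tensored with positive matrices. *)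
pose V l : 'M[C]_(k, k * d1) := \matrix_(a, j)
  ((a == (mxtens.mxtens_unindex j).1)%:R * U l (mxtens.mxtens_unindex j).2).
have -> : ampl (measure_prepare U W t) X = \sum_l (V l *m X *m (V l)^t*) *t udiag W (t l).
  apply/matrixP => i j; case: (mxtens.mxtens_indexP i) => a x.
  case: (mxtens.mxtens_indexP j) => b y.
  rewrite mxE !mxtens.mxtens_indexK /measure_prepare !summxE; apply: eq_bigr => l _.
  rewrite mxtens.tensmxE mxE; congr (_ * _).
  have VX c Z : \sum_j V l c j * Z j = \sum_x' U l x' * Z (mxtens.mxtens_index (c, x')).
    rewrite sum_tens (bigD1 c)//= [X in _ + X]big1 ?addr0 => [|c' cc'].
      by apply: eq_bigr => x' _; rewrite mxE mxtens.mxtens_indexK /= eqxx mul1r.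
    by rewrite big1// => x' _; rewrite mxE mxtens.mxtens_indexK /= eq_sym (negbTE cc') !mul0r.
  have e1 z : (V l *m X) a z = \sum_x' U l x' * X (mxtens.mxtens_index (a, x')) z.
    by rewrite mxE VX.
  transitivity (\sum_z Num.conj (V l b z) * (V l *m X) a z); last first.
    by rewrite [RHS]mxE; apply: eq_bigr => z _; rewrite adjmxE mulrC.
  transitivity (Num.conj (\sum_z V l b z * Num.conj ((V l *m X) a z))); last first.
    by rewrite rmorph_sum/=; apply: eq_bigr => z _; rewrite rmorphM/= conjCK.
  rewrite VX rmorph_sum/= [LHS]mxE; apply: eq_bigr => y' _.
  rewrite rmorphM/= conjCK adjmxE mulrC; congr (_ * _).
  by rewrite e1 mxE; apply: eq_bigr => x' _; rewrite mxE.
apply: psd_sum => l; apply: psd_tens; last exact: psd_udiag.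
exact: psd_conj.
Qed.

Lemma measure_prepareE d1 d2 (U : 'M[C]_d1) (W : 'M[C]_d2) (t : 'I_d1 -> 'I_d2 -> R) X (p : 'I_d1 -> R) :
  (forall l, (U *m X *m U^t*) l l = (p l)%:C) ->
  measure_prepare U W t X = udiag W (fun k => \sum_l p l * t l k).
Proof.
move=> pE; rewrite /measure_prepare /udiag.
have -> : diagc (fun k => \sum_l p l * t l k) = \sum_l (p l)%:C *: diagc (t l).
  apply/matrixP => i j; rewrite diagcE summxE rmorph_sum/= -sumrMnl.
  by apply: eq_bigr => l _; rewrite mxE diagcE rmorphM/= mulrnAr.
rewrite mulmx_sumr mulmx_suml; apply: eq_bigr => l _.
by rewrite pE -scalemxAr -scalemxAl.
Qed.

End Channels.

(** * One-shot conversion by likelihood-ratio bins *)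

Section BinnedCoupling.
Variable R : realType.
Variables (X Y I : finType) (p q : X -> R) (p' q' : Y -> R).
Variables (bx : X -> option I) (bY : Y -> option I) (th : R).
Hypotheses (p0 : forall x, 0 <= p x) (q0 : forall x, 0 <= q x).
Hypotheses (p'0 : forall y, 0 <= p' y) (q'0 : forall y, 0 <= q' y).
Hypotheses (p1 : \sum_x p x = 1) (q1 : \sum_x q x = 1).
Hypotheses (p'1 : \sum_y p' y = 1) (q'1 : \sum_y q' y = 1).
Hypothesis th0 : 0 < th.
Let P o := \sum_(x | bx x == o) p x.
Let Q o := \sum_(x | bx x == o) q x.
Let P' o := \sum_(y | bY y == o) p' y.
Hypothesis PI : forall o, o != None -> th <= P o.
Hypothesis P'I : forall o, o != None -> th <= P' o.
Hypothesis QI : forall y, bY y != None -> Q (bY y) * p' y <= th / 2 * q' y.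

(* Each bin of [X] is sent to the matching bin of [Y]; the unbinned part of [X]
   prepares the remainder of [q'] and so makes the image of [q] exact. *)
Lemma binned_coupling : exists t : X -> Y -> R,
  [/\ forall x y, 0 <= t x y, forall x, \sum_y t x y = 1,
      forall y, \sum_x q x * t x y = q' y &
      (\sum_y `|\sum_x p x * t x y - p' y|) / 2 <= 1 - #|I|%:R * th].
Proof.
(* Conditional law of [p'] within its bin; [r] is the part of [q'] not yet produced by the binned
   inputs. *)
pose s y := (bY y != None)%:R * (p' y / P' (bY y)).
pose r y := q' y - Q (bY y) * s y.
have P'0 o : o != None -> 0 < P' o by move=> /P'I; exact: lt_le_trans.
have s0 y : 0 <= s y.
  by rewrite mulr_ge0// divr_ge0// sumr_ge0.
have Qo0 o : 0 <= Q o by exact: sumr_ge0.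
have Qs y : Q (bY y) * s y <= q' y / 2.
  rewrite /s; case: (eqVneq (bY y) None) => [_|oy].
    by rewrite mul0r mulr0 divr_ge0.
  rewrite mul1r mulrA ler_pdivrMr ?P'0// (le_trans (QI oy))//.
  rewrite (mulrC (th / 2)) -mulrA ler_wpM2l// mulrC ler_wpM2l//.
  exact: P'I.
have r0 y : 0 <= r y by rewrite subr_ge0 (le_trans (Qs y))// ler_pdivrMr// ler_peMr// ler1n.
have sum_s o : o != None -> \sum_(y | bY y == o) s y = 1.
  move=> oN; rewrite -(@divff _ (P' o)) ?gt_eqF ?P'0// mulr_suml.
  by apply: eq_bigr => y /eqP e; rewrite /s e oN mul1r.
have sumQs : \sum_y Q (bY y) * s y = \sum_(o | o != None) Q o.
  rewrite (bigID (fun y => bY y != None))/= [X in _ + X]big1 ?addr0 => [|y]; last first.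
    by rewrite negbK /s => ->; rewrite mul0r mulr0.
  rewrite (partition_big bY (fun o => o != None))//=; apply: eq_bigr => o oN.
  rewrite -[RHS]mulr1 -(sum_s _ oN) mulr_sumr; apply: eq_big => [y|y /andP[_ /eqP ->]//].
  by case: (eqVneq (bY y) o) => [->|_]; rewrite ?oN ?andbF.
have QN : \sum_y r y = Q None.
  rewrite /r sumrB q'1 sumQs -q1.
  rewrite (partition_big bx xpredT)//= (bigD1 None)//=.
  by rewrite -[\sum_(o | o != None) Q o]/(\sum_(o | o != None) \sum_(x | bx x == o) q x) addrK.
(* The factor 1/2 in [QI] leaves at least half of [q'] to the unbinned inputs, so normalizing by
   [Q None] is legitimate. *)
have QN0 : 0 < Q None.
  apply: (@lt_le_trans _ _ 2^-1); first by rewrite invr_gt0.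
  have wq (c : R) : c = \sum_y q' y * c by rewrite -mulr_suml q'1 mul1r.
  by rewrite -QN [leLHS]wq; apply: ler_sum => y _; have := Qs y; rewrite /r; lra.
pose t x y := (bx x == None)%:R * (r y / Q None) + (bx x == bY y)%:R * s y.
have t0 x y : 0 <= t x y.
  by rewrite addr_ge0// mulr_ge0// divr_ge0// ltW.
have avg (f : X -> R) y : \sum_x f x * t x y =
    (\sum_(x | bx x == None) f x) * (r y / Q None) + (\sum_(x | bx x == bY y) f x) * s y.
  rewrite !mulr_suml [X in _ = X + _]big_mkcond [X in _ = _ + X]big_mkcond -big_split/=.
  apply: eq_bigr => x _; rewrite /t mulrDr; congr (_ + _).
    by case: eqP; rewrite ?mul1r ?mul0r ?mulr0.
  by case: eqP; rewrite ?mul1r ?mul0r ?mulr0.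
have t1 x : \sum_y t x y = 1.
  rewrite big_split/= -mulr_sumr -mulr_suml QN divff ?gt_eqF// mulr1.
  case: (eqVneq (bx x) None) => [->|oN].
    rewrite big1 ?addr0// => y _; rewrite /s eq_sym.
    by case: (eqVneq (bY y) None); rewrite ?mul0r ?mulr0.
  rewrite add0r -[RHS](sum_s _ oN) [RHS]big_mkcond; apply: eq_bigr => y _.
  by rewrite [bY y == _]eq_sym; case: (bx x == bY y); rewrite ?mul1r ?mul0r.
exists t; split => //.
- move=> y; rewrite avg -/(Q None) -/(Q (bY y)) mulrCA divff ?gt_eqF// mulr1.
  by rewrite subrK.
pose p'' y := \sum_x p x * t x y.
have p''0 y : 0 <= p'' y by rewrite sumr_ge0// => x _; exact: mulr_ge0.
have p''1 : \sum_y p'' y = 1.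
  rewrite exchange_big/= -[RHS]p1; apply: eq_bigr => x _.
  by rewrite -mulr_sumr t1 mulr1.
(* In every bin the image of [p] and the target share at least mass [th] of the same shape; summing
   over the bins bounds the overlap from below. *)
have low y : th * s y <= Num.min (p'' y) (p' y).
  rewrite /s; case: (eqVneq (bY y) None) => [_|oN].
    by rewrite mul0r mulr0 le_min p''0 p'0.
  rewrite mul1r le_min; apply/andP; split.
    rewrite /p'' avg -/(P (bY y)) /s oN mul1r.
    apply: (@le_trans _ _ (P (bY y) * (p' y / P' (bY y)))).
      by rewrite ler_wpM2r ?PI// divr_ge0// ltW// P'0.
    by rewrite lerDr mulr_ge0 ?sumr_ge0// divr_ge0// ltW.
  by rewrite mulrA ler_pdivrMr ?P'0// mulrC ler_wpM2l// P'I.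
have sum_all : \sum_y s y = #|I|%:R.
  rewrite (bigID (fun y => bY y != None))/= [X in _ + X]big1 ?addr0 => [|y]; last first.
    by rewrite negbK /s => ->; rewrite mul0r.
  rewrite (partition_big bY (fun o => o != None))//=.
  rewrite (eq_bigr (fun=> 1)) => [|o oN].
    rewrite sumr_const; congr (_%:R).
    by have := cardC1 (None : option I); rewrite card_option.
  rewrite -(sum_s _ oN); apply: eq_bigl => y.
  by case: (eqVneq (bY y) o) => [->|_]; rewrite ?oN ?andbF.
have -> : \sum_y `|p'' y - p' y| = \sum_y (p'' y + p' y - 2 * Num.min (p'' y) (p' y)).
  apply: eq_bigr => y _; case: (leP (p'' y) (p' y)) => h.
    by rewrite ler0_norm ?subr_le0//; ring.
  by rewrite gtr0_norm ?subr_gt0//; ring.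
rewrite sumrB big_split/= p''1 p'1 -mulr_sumr.
have : th * #|I|%:R <= \sum_y Num.min (p'' y) (p' y).
  by rewrite -sum_all mulr_sumr; exact: ler_sum.
lra.
Qed.

End BinnedCoupling.

Section LikelihoodBins.
Variable R : realType.
Variables (Z : finType) (p q : Z -> R) (J : nat) (a : nat -> R).

Definition llr_mass (x : R) : R := \sum_(z | p z <= expR x * q z) p z.

(** Products instead of quotients keep [q z = 0] meaningful: such points fall in no bin. *)
Definition llr_bin (z : Z) : option 'I_J :=
  [pick i : 'I_J | (expR (a i) * q z < p z) && (p z <= expR (a i.+1) * q z)].

Hypotheses (p0 : forall z, 0 <= p z) (q0 : forall z, 0 <= q z) (p1 : \sum_z p z = 1).
Hypothesis a_ndecr : forall i j : nat, (i <= j)%N -> a i <= a j.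

Lemma llr_binE z (i : 'I_J) : (llr_bin z == Some i) =
  (expR (a i) * q z < p z) && (p z <= expR (a i.+1) * q z).
Proof.
rewrite /llr_bin; case: pickP => [j /andP[hj1 hj2]|/(_ i) -> //].
apply/eqP/andP => [[<-]//|[hi1 hi2]]; congr Some; apply: val_inj => /=.
have sep (k l : 'I_J) : (k < l)%N -> p z <= expR (a k.+1) * q z ->
    expR (a l) * q z < p z -> False.
  move=> kl h1; rewrite ltNge => /negP; apply.
  by rewrite (le_trans h1)// ler_wpM2r// ler_expR a_ndecr.
by case: (ltngtP j i) => // h; [case: (sep _ _ h hj2 hi1)|case: (sep _ _ h hi2 hj1)].
Qed.

Lemma llr_bin_mass (i : 'I_J) :
  \sum_(z | llr_bin z == Some i) p z = llr_mass (a i.+1) - llr_mass (a i).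
Proof.
rewrite /llr_mass [X in _ = X - _](bigID (fun z => p z <= expR (a i) * q z))/=.
rewrite [X in _ = X + _ - _](_ : _ = \sum_(z | p z <= expR (a i) * q z) p z); last first.
  apply: eq_bigl => z; rewrite andbC; case: (boolP (p z <= expR (a i) * q z)) => //= h.
  by rewrite (le_trans h)// ler_wpM2r// ler_expR a_ndecr.
rewrite [X in _ = X - _]addrC addrK; apply: eq_bigl => z.
by rewrite llr_binE andbC -ltNge.
Qed.

Lemma llr_bin_mass_le (i : 'I_J) : \sum_(z | llr_bin z == Some i) q z <= expR (- a i).
Proof.
rewrite expRN -[leRHS]mulr1 -[X in _ * X]p1 mulr_sumr [leLHS]big_mkcond/=.
apply: ler_sum => z _; case: ifP => [|_].
  rewrite llr_binE => /andP[/ltW h _].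
  by rewrite ler_pdivlMl ?expR_gt0.
by rewrite mulr_ge0 ?invr_ge0 ?expR_ge0.
Qed.

End LikelihoodBins.

Section OneShot.
Variable R : realType.
Local Notation C := R[i].
Local Notation "x %:C" := (real_complex R x) : ring_scope.
Local Notation "A ^t*" := (adjmx A) (at level 30) : ring_scope.

(** An input bin has [q]-mass at most [expR (- a i)], and in the matching output bin [p'] is at most
    [expR (c i.+1) * q']; the last hypothesis makes the product small enough for
    [binned_coupling]. *)
Lemma llr_coupling (X Y : finType) (p q : X -> R) (p' q' : Y -> R) (J : nat)
    (a c : nat -> R) (th : R) :
  (forall x, 0 <= p x) -> (forall x, 0 <= q x) ->
  (forall y, 0 <= p' y) -> (forall y, 0 <= q' y) ->
  \sum_x p x = 1 -> \sum_x q x = 1 -> \sum_y p' y = 1 -> \sum_y q' y = 1 ->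
  (forall i j : nat, (i <= j)%N -> a i <= a j) ->
  (forall i j : nat, (i <= j)%N -> c i <= c j) -> 0 < th ->
  (forall i, (i < J)%N -> th <= llr_mass p q (a i.+1) - llr_mass p q (a i)) ->
  (forall i, (i < J)%N -> th <= llr_mass p' q' (c i.+1) - llr_mass p' q' (c i)) ->
  (forall i, (i < J)%N -> expR (c i.+1 - a i) <= th / 2) ->
  exists t : X -> Y -> R,
  [/\ forall x y, 0 <= t x y, forall x, \sum_y t x y = 1,
      forall y, \sum_x q x * t x y = q' y &
      (\sum_y `|\sum_x p x * t x y - p' y|) / 2 <= 1 - J%:R * th].
Proof.
move=> p0 q0 p'0 q'0 p1 q1 p'1 q'1 am cm th0 Fa Fc ac.
have := @binned_coupling R X Y 'I_J p q p' q' (llr_bin p q J a) (llr_bin p' q' J c) th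
  p0 q0 p'0 q'0 p1 q1 p'1 q'1 th0.
rewrite card_ord; apply => [[i|]// _|[i|]// _|y].
- by rewrite llr_bin_mass//; exact: Fa.
- by rewrite llr_bin_mass//; exact: Fc.
case E : (llr_bin p' q' J c y) => [i|]// _.
move/eqP: E; rewrite llr_binE// => /andP[_ h].
apply: (@le_trans _ _ (expR (- a i) * (expR (c i.+1) * q' y))).
  by apply: ler_pM => //; [exact: sumr_ge0|exact: llr_bin_mass_le].
by rewrite mulrA -expRD addrC ler_wpM2r// ac.
Qed.

Lemma dominates_llr (d1 d2 : nat) (rho sigma U : 'M[C]_d1) (W : 'M[C]_d2)
    (p q : 'I_d1 -> R) (p' q' : 'I_d2 -> R) (J : nat) (a c : nat -> R) (th : R) :
  unitary U -> unitary W ->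
  (forall l, (U *m rho *m U^t*) l l = (p l)%:C) -> sigma = udiag U q ->
  (forall x, 0 <= p x) -> (forall x, 0 <= q x) ->
  (forall y, 0 <= p' y) -> (forall y, 0 <= q' y) ->
  \sum_x p x = 1 -> \sum_x q x = 1 -> \sum_y p' y = 1 -> \sum_y q' y = 1 ->
  (forall i j : nat, (i <= j)%N -> a i <= a j) ->
  (forall i j : nat, (i <= j)%N -> c i <= c j) -> 0 < th ->
  (forall i, (i < J)%N -> th <= llr_mass p q (a i.+1) - llr_mass p q (a i)) ->
  (forall i, (i < J)%N -> th <= llr_mass p' q' (c i.+1) - llr_mass p' q' (c i)) ->
  (forall i, (i < J)%N -> expR (c i.+1 - a i) <= th / 2) ->
  dominates rho sigma (udiag W p') (udiag W q') (1 - J%:R * th) 0.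
Proof.
move=> uU uW Up -> p0 q0 p'0 q'0 p1 q1 p'1 q'1 am cm th0 Fa Fc ac.
have [t [t0 t1 tq tp]] :=
  llr_coupling p0 q0 p'0 q'0 p1 q1 p'1 q'1 am cm th0 Fa Fc ac.
exists (measure_prepare U W t); split.
- exact: measure_prepare_channel.
- by rewrite (measure_prepareE _ _ Up) trdist_udiag.
rewrite (@measure_prepareE _ _ _ U W t (udiag U q) q) => [|l].
  rewrite trdist_udiag// big1 ?mul0r// => y _.
  by rewrite tq subrr normr0.
by rewrite udiagK// diagcE eqxx mulr1n.
Qed.

End OneShot.

(** * Second-order conversion rates *)

Section DensityPairs.
Variable R : realType.
Local Notation C := (R[i]).
Local Notation "x %:C" := (real_complex R x) : ring_scope.
Local Notation "A ^t*" := (adjmx A) (at level 30) : ring_scope.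
Local Notation "A *t B" := (mxtens.tensmx A B) (at level 40, left associativity) : ring_scope.

Lemma tpow_mul d (A B : 'M[C]_d) n : tpow A n.+1 *m tpow B n.+1 = tpow (A *m B) n.+1.
Proof.
elim: n => [//|n IH].
by rewrite /tpow !mxtens.ntensmxSS -/(tpow A n.+1) -/(tpow B n.+1) -/(tpow (A *m B) n.+1) -IH mxtens.tensmx_mul.
Qed.

(** An eigenvector of sigma with eigenvalue 0 is killed by rho, so rho has expectation 0 in it; this
    expectation is a sum of nonnegative Nussbaum-Szkola weights. *)
Lemma ns_supp n (A B : 'M[C]_n) (la mu : 'I_n -> R) : unitary A -> unitary B ->
  (forall i, 0 <= la i) -> (forall j, 0 <= mu j) ->
  supp_le (udiag A la) (udiag B mu) ->
  forall i j, ns_prob A B la (i, j) != 0 -> 0 < mu j.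
Proof.
move=> uA uB la0 mu0 supp i j; rewrite lt_neqAle mu0 andbT eq_sym; apply: contra_neq => mj.
have Bs : B *m udiag B mu = diagc mu *m B by rewrite /udiag !mulmxA uB mul1mx.
have /supp vr : row j B *m udiag B mu = 0.
  rewrite -row_mul Bs; apply/rowP => k.
  by rewrite !mxE big1// => l _; rewrite diagcE -mj rmorph0 mul0rn mul0r.
have : (B *m udiag A la *m B^t*) j j = 0.
  by rewrite -row_conj_entry vr mul0mx mxE.
rewrite udiag_conj => /(congr1 (@complex.Re R)) /=.
move/eqP; rewrite psumr_eq0 => [/allP/(_ i)|k _]; last by rewrite mulr_ge0 ?nsq_ge0.
by rewrite mem_index_enum => /(_ isT)/eqP; rewrite /ns_prob /= overlapC => ->.
Qed.

(** With $P, Q$ the Nussbaum-Szkola pair, $P\ln(P/Q)\ge P-Q$ termwise and the right sides sum to 0.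
    A zero sum forces equality everywhere, hence a vanishing log-likelihood ratio on the support of
    $P$ and zero variance. *)
Lemma ns_relent_gt0 n (A B : 'M[C]_n) (la mu : 'I_n -> R) : unitary A -> unitary B ->
  (forall i, 0 <= la i) -> (forall j, 0 <= mu j) ->
  \sum_i la i = 1 -> \sum_j mu j = 1 ->
  (forall i j, ns_prob A B la (i, j) != 0 -> 0 < mu j) ->
  0 < relvar (udiag A la) (udiag B mu) -> 0 < relent (udiag A la) (udiag B mu).
Proof.
move=> uA uB la0 mu0 la1 mu1 supp; rewrite relvar_ns//.
pose g (ij : 'I_n * 'I_n) : R := overlap A B ij.1 ij.2 * (la ij.1 - mu ij.2).
have g_sum : \sum_ij g ij = 0.
  rewrite -(pair_bigA _ (fun i j => g (i, j)))/=.
  under eq_bigr do (under eq_bigr do rewrite /g mulrBr; rewrite sumrB).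
  rewrite sumrB [X in _ - X]exchange_big/=.
  under eq_bigr do rewrite -mulr_suml overlap_row// mul1r.
  under [X in _ - X]eq_bigr do rewrite -mulr_suml overlap_col// mul1r.
  by rewrite la1 mu1 subrr.
have key ij : g ij <= ns_prob A B la ij * ns_llr la mu ij /\
    (g ij = ns_prob A B la ij * ns_llr la mu ij -> ns_prob A B la ij * ns_llr la mu ij ^+ 2 = 0).
  case: ij => i j; have w0 := overlap_ge0 A B i j.
  have [P0|P0] := eqVneq (ns_prob A B la (i, j)) 0.
    rewrite P0 !mul0r; split => //; move/eqP: P0; rewrite /ns_prob /g /= mulf_eq0.
    by case/orP => /eqP ->; rewrite ?mul0r// sub0r mulrN oppr_le0 mulr_ge0.
  have muj := supp _ _ P0; move: P0; rewrite /ns_prob /g /ns_llr /= mulf_eq0 negb_or => /andP[li wi].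
  have {}li : 0 < la i by rewrite lt_neqAle eq_sym li la0.
  have {}w0 : 0 < overlap A B i j by rewrite lt_neqAle eq_sym wi w0.
  set L := ln (la i) - ln (mu j).
  have eL : expR (- L) = mu j / la i by rewrite /L opprB expRD expRN !lnK// posrE.
  split.
    rewrite mulrAC mulrC ler_wpM2r ?(ltW w0)//.
    have := expR_ge1Dx (- L); rewrite eL ler_pdivlMr//; lra.
  rewrite mulrAC mulrC => /(mulIf (lt0r_neq0 w0)) h.
  have [->|L0] := eqVneq L 0; first by rewrite expr0n mulr0.
  have := @expR_gt1Dx R (- L); rewrite oppr_eq0 => /(_ L0).
  rewrite eL ltr_pdivlMr//; lra.
have D0 : 0 <= relent (udiag A la) (udiag B mu).
  by rewrite relent_ns// -[leLHS]g_sum; apply: ler_sum => ij _; case: (key ij).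
rewrite [X in _ -> is_true X]lt_neqAle D0 andbT eq_sym; apply: contraTneq => Dz.
rewrite Dz expr0n subr0 big1 ?ltxx// => ij _; apply: (key ij).2.
have : \sum_ij (ns_prob A B la ij * ns_llr la mu ij - g ij) = 0.
  by rewrite sumrB g_sum subr0 -relent_ns.
move=> /eqP; rewrite psumr_eq0 => [/allP/(_ ij)|k _]; last by rewrite subr_ge0; case: (key k).
by rewrite mem_index_enum => /(_ isT); rewrite subr_eq0 => /eqP.
Qed.

(** The interface between the analysis of one pair and the conversion of two: positive drift, a
    measurement basis, the limit law of the measured ratio, and optimality among all tests. *)
Definition second_order d (rho sigma : 'M[C]_d) (D V : R) : Prop :=
  let thr (n : nat) x := n%:R * D + x * Num.sqrt (n%:R * V) in
  [/\ 0 < D,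
    forall n, exists (U : 'M[C]_(d ^ n.+1)) (p q : 'I_(d ^ n.+1) -> R),
      meas_basis (tpow rho n.+1) (tpow sigma n.+1) U p q,
    forall x e : R, 0 < e -> exists N, forall n, (N <= n)%N ->
      forall (U : 'M[C]_(d ^ n.+1)) (p q : 'I_(d ^ n.+1) -> R),
      meas_basis (tpow rho n.+1) (tpow sigma n.+1) U p q ->
      `|llr_mass p q (thr n.+1 x) - ncdf 0 1 x| <= e &
    forall x e : R, 0 < e -> exists N, forall n, (N <= n)%N ->
      forall T : 'M[C]_(d ^ n.+1), psd T -> psd (1%:M - T) ->
      complex.Re (\tr (tpow sigma n.+1 *m T)) <= expR (- thr n.+1 x) ->
      complex.Re (\tr (tpow rho n.+1 *m T)) <= 1 - ncdf 0 1 x + e].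

Lemma density_second_order d (rho sigma : 'M[C]_d) :
  density rho -> density sigma -> supp_le rho sigma -> 0 < relvar rho sigma ->
  second_order rho sigma (relent rho sigma) (relvar rho sigma).
Proof.
move=> /density_udiag[A [la [uA -> la0 la1]]] /density_udiag[B [mu [uB -> mu0 mu1]]].
move=> /(ns_supp uA uB la0 mu0) supp V0; split.
- exact: ns_relent_gt0.
- exact: meas_basis_exists.
- exact: meas_basis_law.
- exact: test_converse.
Qed.

End DensityPairs.

(** * Comparison of thresholds growing like n and its square root *)

Section Growth.
Variable R : realType.

Lemma eventually_forall_lt (P : nat -> nat -> Prop) J :
  (forall i, exists N, forall n, (N <= n)%N -> P i n) ->
  exists N, forall n, (N <= n)%N -> forall i, (i < J)%N -> P i n.
Proof.
move=> H; elim: J => [|J [N IH]]; first by exists 0%N.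
have [M HM] := H J; exists (maxn N M) => n; rewrite geq_max => /andP[nN nM] i.
by rewrite ltnS leq_eqVlt => /orP[/eqP ->|/IH]; [exact: HM|exact].
Qed.

Lemma sqrt_natr_large (V c : R) : 0 < V ->
  exists N, forall n, (N <= n)%N -> c <= Num.sqrt (n.+1%:R * V).
Proof.
move=> V0; exists (Num.truncn (c ^+ 2 / V)) => n nN.
apply: (le_trans (ler_norm c)); rewrite -sqrtr_sqr; apply: ler_wsqrtr.
rewrite -ler_pdivrMr// ltW// (lt_le_trans (truncnS_gt _))//.
by rewrite ler_nat ltnS.
Qed.

Lemma drift_large (D V x c : R) : 0 < D -> 0 < V ->
  exists N, forall n, (N <= n)%N -> c <= n.+1%:R * D + x * Num.sqrt (n.+1%:R * V).
Proof.
move=> D0 V0.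
have [N HN] := sqrt_natr_large (1 + (`|c| + `|x|) * V / D) V0.
exists N => n /HN; have := @sqr_sqrtr R (n.+1%:R * V); rewrite mulr_ge0 ?ler0n ?(ltW V0)//.
move: (Num.sqrt _) => S /(_ isT) SS hS.
have -> : n.+1%:R * D = S * (S * (D / V)).
  by rewrite mulrA -expr2 SS; field; rewrite gt_eqF.
have c0 := normr_ge0 c; have x0 := normr_ge0 x.
have S1 : 1 <= S.
  by apply: le_trans hS; rewrite lerDl divr_ge0 ?mulr_ge0 ?addr_ge0// ltW.
have hS' : `|c| + `|x| <= S * (D / V).
  rewrite mulrA ler_pdivlMr// -ler_pdivrMr//; apply: le_trans hS; lra.
have := ler_norm c; have := ler_norm (- x); rewrite normrN => hx hc.
rewrite (mulrC x) -mulrDr (le_trans hc)//.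
have h : `|c| <= S * (D / V) + x by lra.
by rewrite (le_trans h)// ler_peMl// (le_trans c0 h).
Qed.

(** [m * D2] lies within $O(\sqrt n)$ of $nD_1$, so $\sqrt{mV_2}$ is within a constant of
    $y\sqrt{nV_1}$, and the strict inequality at that scale absorbs all constants. [m] is real so
    that the converse can use a non-integer copy number. *)
Lemma growth_compare (D1 V1 D2 V2 mu w z c : R) :
  0 < D1 -> 0 < V1 -> 0 < D2 -> 0 < V2 ->
  w < z * Num.sqrt (V2 * D1 / (V1 * D2)) ->
  exists N, forall n, (N <= n)%N -> forall m : R, 0 <= m ->
    n.+1%:R * D1 + mu * Num.sqrt (n.+1%:R * V1) - D2 <= m * D2 ->
    m * D2 <= n.+1%:R * D1 + mu * Num.sqrt (n.+1%:R * V1) ->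
    w * Num.sqrt (n.+1%:R * V1) + c <= z * Num.sqrt (m * V2).
Proof.
move=> D10 V10 D20 V20; set y := Num.sqrt (V2 * D1 / _) => wz.
have y0 : 0 < y by rewrite sqrtr_gt0 divr_gt0// mulr_gt0.
pose K := V2 * (`|mu| / D2 + 1) / y.
have [N HN] := sqrt_natr_large (1 + (`|z| * K + `|c|) / (z * y - w)) V10.
exists N => n /HN; have := @sqr_sqrtr R (n.+1%:R * V1); rewrite mulr_ge0 ?ler0n ?(ltW V10)//.
move: (Num.sqrt _) => S /(_ isT) SS hS m m0 lo hi.
have yy : y ^+ 2 = V2 * D1 / (V1 * D2).
  by rewrite sqr_sqrtr// divr_ge0 ?mulr_ge0// ltW.
have K0 : 0 <= K.
  by rewrite divr_ge0 ?(ltW y0)// mulr_ge0 ?(ltW V20)// addr_ge0// divr_ge0// ltW.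
have e0 : 0 < z * y - w by rewrite subr_gt0.
have zK : 0 <= `|z| * K by exact: mulr_ge0.
have S1 : 1 <= S.
  by apply: le_trans hS; rewrite lerDl divr_ge0 ?(addr_ge0 zK)// ltW.
have S0 : 0 < S by exact: lt_le_trans S1.
have hS' : `|z| * K + `|c| <= (z * y - w) * S.
  by rewrite [leRHS]mulrC -ler_pdivrMr//; apply: le_trans hS; rewrite lerDr ler01.
set X := Num.sqrt (m * V2).
have XX : X ^+ 2 = m * V2 by rewrite sqr_sqrtr// mulr_ge0// ltW.
have X0 : 0 <= X by exact: sqrtr_ge0.
have md : `|m * D2 - n.+1%:R * D1| <= (`|mu| + D2) * S.
  have h1 : `|mu * S| = `|mu| * S by rewrite normrM (gtr0_norm S0).
  have := ler_norm (mu * S); have := ler_norm (- (mu * S)); rewrite normrN h1 => ha hb.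
  have hc : D2 <= D2 * S by rewrite ler_peMr// ltW.
  by rewrite ler_norml; apply/andP; split; rewrite mulrDl; lra.
(* The difference of squares is linear in [m * D2 - n.+1%:R * D1]; dividing by [X + y * S], at least
   [y * S], cancels the factor [S] of [md]. *)
have XY : `|X - y * S| <= K.
  rewrite /K ler_pdivlMr//.
  have -> : V2 * (`|mu| / D2 + 1) = V2 / D2 * (`|mu| + D2) by field; rewrite gt_eqF.
  rewrite -(ler_pM2r S0) -[leRHS]mulrA.
  apply: (@le_trans _ _ (V2 / D2 * `|m * D2 - n.+1%:R * D1|)); last first.
    by rewrite ler_pM2l// divr_gt0.
  have -> : V2 / D2 * `|m * D2 - n.+1%:R * D1| = `|X - y * S| * (X + y * S).
    rewrite -[V2 / D2]ger0_norm ?divr_ge0 ?ltW// -[X + y * S in RHS]ger0_norm; last first.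
      by rewrite addr_ge0// mulr_ge0// ltW.
    rewrite -!normrM; congr `|_|.
    rewrite -subr_sqr exprMn XX yy SS; field; rewrite !gt_eqF//.
  by rewrite -mulrA ler_wpM2l// lerDr.
have h : `|z * X - z * (y * S)| <= `|z| * K by rewrite -mulrBr normrM ler_wpM2l.
have := ler_norm c; have := ler_norm (- (z * X - z * (y * S))); rewrite normrN => ha hb.
have : (z * y - w) * S = z * (y * S) - w * S by ring.
lra.
Qed.

(** For negative [z] the square-root term decreases, but slower than the drift grows once [x] is
    large. The converse uses this to reach copy numbers with no upper limit. *)
Lemma threshold_ndecr (D V z x y : R) : 0 < D -> 0 <= V -> 0 <= x -> x <= y ->
  z ^+ 2 * V / D <= x * D ->
  x * D + z * Num.sqrt (x * V) <= y * D + z * Num.sqrt (y * V).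
Proof.
move=> D0 V0 x0 xy h; have y0 : 0 <= y by exact: le_trans xy.
have hz : `|z| * Num.sqrt V <= Num.sqrt x * D.
  rewrite -[`|z|]sqrtr_sqr -sqrtrM ?sqr_ge0//.
  rewrite -[D in leRHS]ger0_norm ?(ltW D0)// -sqrtr_sqr -sqrtrM//; apply: ler_wsqrtr.
  by rewrite expr2 mulrA -ler_pdivrMr.
have := sqr_sqrtr x0; have := sqr_sqrtr y0; rewrite !sqrtrM//.
move: (ler_wsqrtr xy) (sqrtr_ge0 x) (sqrtr_ge0 y) (sqrtr_ge0 V) hz.
move: (Num.sqrt x) (Num.sqrt y) (Num.sqrt V) => a b v ab a0 b0 v0 hz <- <-.
have hzz : - z * v <= a * D.
  by apply: le_trans hz; rewrite ler_wpM2r// -normrN ler_norm.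
have bD : 0 <= b * D by rewrite mulr_ge0// ltW.
have azv : 0 <= a * D + z * v by rewrite -lerBlDr sub0r -mulNr.
have : 0 <= (b - a) * (b * D + (a * D + z * v)).
  by rewrite mulr_ge0 ?subr_ge0// addr_ge0.
by rewrite -[in X in _ -> X]subr_ge0; congr (is_true (0 <= _)); ring.
Qed.

End Growth.

Section TestTransport.
Variable R : realType.
Local Notation C := (R[i]).

Lemma density_tpow d (X : 'M[C]_d) n : density X -> density (tpow X n.+1).
Proof.
move=> /density_udiag[A [la [uA -> la0 la1]]]; rewrite udiag_tpow; split.
  by apply: psd_udiag; exact: tens_fun_ge0.
by rewrite trace_udiag ?tens_fun_sum1 ?rmorph1//; exact: unitary_tpow.
Qed.

Lemma channel_test_close d1 d2 (E : 'M[C]_d1 -> 'M[C]_d2) (X T' : 'M[C]_d1) (Y T : 'M[C]_d2) :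
  is_channel E -> density X -> density Y -> psd T -> psd (1%:M - T) ->
  (forall X, \tr (X *m T') = \tr (E X *m T)) ->
  `|complex.Re (\tr (X *m T')) - complex.Re (\tr (Y *m T))| <= trdist (E X) Y.
Proof.
move=> chE [pX tX] [pY tY] pT pT1 trT'; rewrite trT'.
have [_ trE _] := chE; have pEX := channel_psd chE pX.
have trEX : \tr (E X) = \tr Y by rewrite trE tX tY.
have h1 := test_le_trdist pEX.1 pY.1 trEX pT pT1.
have pTT : psd (1%:M - (1%:M - T)) by rewrite opprB addrC subrK.
have := test_le_trdist pEX.1 pY.1 trEX pT1 pTT.
rewrite !mulmxBr !mulmx1 !raddfB/= trEX => h2.
rewrite ler_norml; apply/andP; split.
  by move: h1; move: (trdist _ _) (complex.Re _) (complex.Re _) => *; lra.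
move: h2; move: (trdist _ _) (complex.Re (\tr Y)) (complex.Re (\tr (E X *m T))).
move: (complex.Re (\tr (Y *m T))) => *; lra.
Qed.

End TestTransport.

Section SecondOrder.
Variable R : realType.
Local Notation C := (R[i]).
Local Notation Phi := (@ncdf R 0 1).
Variables (d1 d2 : nat) (rho1 sigma1 : 'M[C]_d1) (rho2 sigma2 : 'M[C]_d2).
Variables (eps D1 V1 D2 V2 : R).
Hypotheses (r1 : density rho1) (s1 : density sigma1).
Hypotheses (r2 : density rho2) (s2 : density sigma2).
Hypotheses (so1 : second_order rho1 sigma1 D1 V1) (so2 : second_order rho2 sigma2 D2 V2).
Hypotheses (V10 : 0 < V1) (V20 : 0 < V2) (eps01 : 0 < eps < 1).
Let nu := V2 * D1 / (V1 * D2).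
Let drift (n : nat) (mu : R) : R := n%:R * D1 + mu * Num.sqrt (n%:R * V1).

(** If [k] were too large, the output test at a quantile [z] just above [x] would have threshold at
    least [drift n.+1 t]. As the second error is 0, its pullback has [sigma1] weight at most
    [expR (- drift n.+1 t)], so [rho1] weight at most about [1 - Phi t]; but up to [eps] that weight
    is at least about [1 - Phi x]. *)
Lemma conversion_upper mu : Sesq_inv nu eps < mu ->
  exists N, forall n, (N <= n)%N -> forall k,
  dominates (tpow rho1 n.+1) (tpow sigma1 n.+1) (tpow rho2 k) (tpow sigma2 k) eps 0 ->
  k%:R * D2 <= drift n.+1 mu.
Proof.
have [D10 _ _ conv1] := so1; have [D20 basis2 law2 _] := so2.
have nu0 : 0 < nu by rewrite divr_gt0 ?mulr_gt0.
move=> /(Sesq_inv_gt nu0 eps01)[t]; set x := (t - mu) / Num.sqrt nu => ht.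
(* Three [e] are spent, on the input test bound, the output law and the shift from [x] to [z]; the
   fourth keeps the contradiction strict. *)
have [e e0 he] : exists2 e, 0 < e & Phi t - Phi x = eps + 4 * e.
  by exists ((Phi t - Phi x - eps) / 4); [rewrite divr_gt0// subr_gt0|field].
pose z := x + e.
have Phiz : Phi z <= Phi x + e.
  have := Phi_lip z x; rewrite /z addrAC subrr add0r (gtr0_norm e0) ler_norml => /andP[_].
  by rewrite lerBlDl.
have [N1 H1] := conv1 t e e0.
have [N2 H2] := law2 z e e0.
have wz : t - mu < z * Num.sqrt nu.
  by rewrite /z mulrDl /x divfK ?gt_eqF ?sqrtr_gt0// ltrDl mulr_gt0// sqrtr_gt0.
have [N3 H3] := @growth_compare R D1 V1 D2 V2 mu (t - mu) z 0 D10 V10 D20 V20 wz.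
pose c := Num.max (N2.+1%:R * D2) (z ^+ 2 * V2 / D2).
have [N4 H4] := @drift_large R D1 V1 mu c D10 V10.
exists (maxn N1 (maxn N3 N4)) => n; rewrite !geq_max => /and3P[n1 n3 n4] k.
have := H4 n n4; rewrite -/(drift n.+1 mu) ge_max => /andP[c1 c2].
case: k => [|m] dom; first by rewrite mul0r (le_trans _ c1)// mulr_ge0 ?ler0n// ltW.
rewrite leNgt; apply/negP => hm.
have m2 : (N2 <= m)%N.
  have := le_lt_trans c1 hm; rewrite ltr_pM2r// ltr_nat => /ltnW.
  by rewrite ltnS.
(* The thresholds are compared at this critical real copy number first and carried to the larger
   integer [m.+1] by monotonicity. *)
pose y := drift n.+1 mu / D2.
have yD : y * D2 = drift n.+1 mu by rewrite divfK// gt_eqF.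
have y0 : 0 <= y.
  by rewrite divr_ge0 ?(ltW D20)// (le_trans _ c1)// mulr_ge0 ?ler0n// ltW.
have hy : drift n.+1 t <= y * D2 + z * Num.sqrt (y * V2).
  have := H3 n n3 y y0; rewrite yD /drift => /(_ _ (lexx _)) h.
  have {}h := h ltac:(rewrite lerBlDr lerDl ltW//).
  by rewrite -addrA lerD2l -lerBlDl -mulrBl -[leLHS]addr0.
have hmy : drift n.+1 t <= m.+1%:R * D2 + z * Num.sqrt (m.+1%:R * V2).
  apply: (le_trans hy); apply: threshold_ndecr => //; rewrite ?(ltW V20) ?yD//.
  by rewrite ler_pdivrMr// ltW.
have [E [chE hrho hsig]] := dom.
have [U [p [q mb]]] := basis2 m; have uU := mb_unitary mb.
set b := m.+1%:R * D2 + _ in hmy.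
pose T := udiag U (fun l => (~~ (p l <= expR b * q l))%:R).
have pT : psd T by apply: psd_udiag => l; rewrite ler0n.
have pT1 : psd (1%:M - T).
  rewrite -(udiag1 uU) udiagB; apply: psd_udiag => l.
  by case: (p l <= _); rewrite ?subr0 ?subrr.
have [T' [pT' pT1' trT']] := channel_adjoint_test chE pT pT1.
have rhoT : complex.Re (\tr (tpow rho2 m.+1 *m T)) = 1 - llr_mass p q b.
  have pF : \sum_(l | ~~ (p l <= expR b * q l)) p l = 1 - llr_mass p q b.
    apply/esym/eqP; rewrite subr_eq -(mb_p1 mb).
    by rewrite [X in X == _](bigID (fun l => p l <= expR b * q l))/= addrC.
  rewrite mxtrace_mulC trace_udiag_mul -pF.
  rewrite -[RHS]Re_real rmorph_sum [in RHS]big_mkcond/=; congr complex.Re.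
  apply: eq_bigr => l _; rewrite (mb_diag mb).
  by case: (p l <= _); rewrite /= ?mul1r ?mul0r.
have sigT : complex.Re (\tr (tpow sigma2 m.+1 *m T)) <= expR (- b).
  rewrite (mb_sigma mb) udiagM// trace_udiag// Re_real.
  rewrite expRN -[leRHS]mulr1 -[X in _ <= _ * X](mb_p1 mb) mulr_sumr; apply: ler_sum => l _.
  have be0 := expR_gt0 b.
  case: (leP (p l)) => h /=; last by rewrite mulr1 ler_pdivlMl// ltW.
  by rewrite mulr0 mulr_ge0 ?(mb_p0 mb)// invr_ge0 ltW.
have test (X : 'M[C]_d1) (Y : 'M[C]_d2) (dl : R) : density X -> density Y ->
    trdist (E (tpow X n.+1)) (tpow Y m.+1) <= dl ->
    `|complex.Re (\tr (tpow X n.+1 *m T')) - complex.Re (\tr (tpow Y m.+1 *m T))| <= dl.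
  move=> dX dY; apply: le_trans.
  exact: (channel_test_close chE (density_tpow _ dX) (density_tpow _ dY) pT pT1 trT').
have {}hrho := test _ _ _ r1 r2 hrho.
have {}hsig := test _ _ _ s1 s2 hsig.
move: hrho hsig; rewrite normr_le0 subr_eq0 rhoT => hrho /eqP hsig.
have sb : expR (- b) <= expR (- drift n.+1 t) by rewrite ler_expR lerN2.
have := H1 n n1 T' pT' pT1'; rewrite hsig => /(_ (le_trans sigT sb)) h3.
have := H2 m m2 U p q mb; rewrite -/b.
move: hrho; rewrite !ler_norml => /andP[h1 _] /andP[_ h2].
move: h1 h2 h3 he Phiz e0; clear.
move: (complex.Re _) (llr_mass _ _ _) (Phi t) (Phi z) (Phi x) => *; lra.
Qed.

(* With bins of probability [1 / K], the inequality [Phi (mu + sqrt nu * z) <= s + Phi z]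
   says that matching the output bin [i] with the input bin [i + r + 1], [s K < r], leaves a
   positive gap of order [sqrt n] between the log-likelihood ratios; the price is the mass
   of the roughly [s K] unmatched bins. *)
Lemma conversion_lower mu : rho2 *m sigma2 = sigma2 *m rho2 -> mu < Sesq_inv nu eps ->
  exists N, forall n, (N <= n)%N -> exists2 k,
    drift n.+1 mu - D2 <= k%:R * D2 &
    dominates (tpow rho1 n.+1) (tpow sigma1 n.+1) (tpow rho2 k) (tpow sigma2 k) eps 0.
Proof.
have [D10 basis1 law1 _] := so1; have [D20 basis2 law2 _] := so2.
have nu0 : 0 < nu by rewrite divr_gt0 ?mulr_gt0.
move=> comm /(Sesq_inv_lt nu0 eps01)[s /andP[s0 se] hs].
(* The final error is at most [s + 5 / K]: one [1 / K] from rounding [s * K] up to [r], three from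
   the bins dropped in [J], one from using [th] instead of [1 / K]. *)
pose K := (Num.truncn (5 / (eps - s))).+2.
have K0 : 0 < K%:R :> R by rewrite ltr0n.
pose ka : R := K%:R^-1.
have ka0 : 0 < ka by rewrite invr_gt0.
have Kka : K%:R * ka = 1 by rewrite divff ?gt_eqF.
have ka1 : ka < 1 by rewrite invf_lt1// ltr1n.
have ka5 : 5 * ka <= eps - s.
  rewrite ler_pdivrMr// mulrC -ler_pdivrMr ?subr_gt0//.
  by apply/ltW/(lt_le_trans (truncnS_gt _)); rewrite ler_nat.
pose r := (Num.truncn (s * K%:R)).+1.
have r_gt : s < r%:R * ka by rewrite -ltr_pdivrMr// /ka invrK truncnS_gt.
have r_le : r%:R * ka <= s + ka.
  by rewrite -natr1 mulrDl mul1r lerD2r ler_pdivrMr// truncn_le mulr_ge0// ltW.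
(* Quantiles of level [i.+1 / K]; the cap at [K.-1] defines them for all [i] and keeps the sequence
   monotone. *)
have zP (i : nat) : exists x, Phi x = (minn i.+1 K.-1)%:R * ka.
  apply: (ncdf_quantile 0 ltr01); rewrite mulr_gt0 ?ltr0n//=; last by rewrite leq_min.
  by rewrite ltr_pdivrMr// mul1r ltr_nat gtn_min ltnSn orbT.
have [z hzm] := choice zP.
have hz i : (i.+1 < K)%N -> Phi (z i) = i.+1%:R * ka.
  by move=> iK; rewrite hzm (minn_idPl _)// -ltnS.
have zm : forall i j : nat, (i <= j)%N -> z i <= z j.
  move=> i j ij; rewrite leNgt; apply/negP => /(ncdf_lt 0 ltr01).
  rewrite !hzm ltr_pM2r// ltr_nat ltnNge => /negP; apply.
  by rewrite leq_min geq_minr (leq_trans (geq_minl _ _)).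
pose J := (K - (r + 3))%N.
have JK i : (i < J)%N -> (i + r + 3 < K)%N.
  by rewrite /J ltn_subRL => h; rewrite -addnA addnC.
(* A bin of limiting mass [ka] loses at most [e] at each end, hence keeps [th]. *)
pose e := ka ^+ 2 / 2; have e0 : 0 < e by rewrite divr_gt0 ?exprn_gt0.
pose th := ka - ka ^+ 2.
have th0 : 0 < th by rewrite subr_gt0 expr2 gtr_pMl.
have Jth : 1 - J%:R * th <= eps.
  have h1 : (K%:R : R) <= J%:R + (r%:R + 3).
    by rewrite -!natrD ler_nat addnC -leq_subLR.
  have h2 : (J%:R : R) <= K%:R by rewrite ler_nat leq_subr.
  move: (ler_wpM2r (ltW ka0) h1) (ler_wpM2r (ltW ka0) h2) r_le ka5.
  rewrite (mulrDl J%:R) (mulrDl r%:R) Kka /th.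
  have -> : J%:R * (ka - ka ^+ 2) = J%:R * ka - J%:R * ka * ka by ring.
  move: (J%:R * ka) (r%:R * ka) => u v h3 h4.
  have : u * ka <= ka by rewrite ler_piMl// ltW.
  by move: (u * ka) h3 h4 => *; lra.
(* Otherwise the bound [hs] at [mu + sqrt nu * z i.+1] would give a shift of [r] bins at most [s],
   against the choice of [r]. *)
have gap i : (i < J)%N -> mu + Num.sqrt nu * z i.+1 < z (i.+1 + r)%N.
  move=> iJ; rewrite ltNge; apply/negP => h.
  have := hs (mu + Num.sqrt nu * z i.+1).
  have -> : (mu + Num.sqrt nu * z i.+1 - mu) / Num.sqrt nu = z i.+1.
    by rewrite addrAC subrr add0r mulrC mulKf// gt_eqF// sqrtr_gt0.
  have := ncdf_le 0 1 h.
  have iK := JK i iJ.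
  rewrite !hz ?(leq_ltn_trans _ iK)//; last 2 first.
  - by rewrite addn3 !ltnS (leq_trans (leq_addr r i)).
  - by rewrite addn3 addSn.
  rewrite -addSn natrD mulrDl; move: r_gt.
  move: (ncdf _ _ _) (_ * ka) (_ * ka); move=> *; lra.
have [N1 H1] := @eventually_forall_lt _ J.+1 (fun i => law1 (z (i.+1 + r)%N) e e0).
have [N2 H2] := @eventually_forall_lt _ J.+1 (fun i => law2 (z i) e e0).
have [N3 H3] : exists N, forall n, (N <= n)%N -> forall i, (i < J)%N -> forall m : R, 0 <= m ->
    drift n.+1 mu - D2 <= m * D2 -> m * D2 <= drift n.+1 mu ->
    z i.+1 * Num.sqrt (m * V2) + mu * Num.sqrt (n.+1%:R * V1) -
      z (i.+1 + r)%N * Num.sqrt (n.+1%:R * V1) <= ln (th / 2).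
  have [i|N HN] := @eventually_forall_lt (fun i n => (i < J)%N -> forall m : R, 0 <= m ->
    drift n.+1 mu - D2 <= m * D2 -> m * D2 <= drift n.+1 mu ->
    z i.+1 * Num.sqrt (m * V2) + mu * Num.sqrt (n.+1%:R * V1) -
      z (i.+1 + r)%N * Num.sqrt (n.+1%:R * V1) <= ln (th / 2)) J; last first.
    by exists N => n nN i iJ; exact: HN.
  case: (ltnP i J) => [iJ|_]; last by exists 0%N.
  have wz : - (z (i.+1 + r)%N - mu) < - z i.+1 * Num.sqrt nu.
    by rewrite mulNr ltrN2 ltrBrDl mulrC gap.
  have [N HN] := @growth_compare R D1 V1 D2 V2 mu _ _ (- ln (th / 2)) D10 V10 D20 V20 wz.
  exists N => n nN _ m m0 lo hi.
  have := HN n nN m m0 lo hi.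
  move: (Num.sqrt _) (Num.sqrt _) (ln _) (z i.+1) (z (i.+1 + r)%N); move=> *; lra.
have [N4 H4] := @drift_large R D1 V1 mu (N2.+1%:R * D2) D10 V10.
exists (maxn N1 (maxn N3 N4)) => n; rewrite !geq_max => /and3P[n1 n3 n4].
have := H4 n n4; rewrite -/(drift n.+1 mu) -ler_pdivlMr//; set y := _ / D2 => hy.
have y0 : 0 <= y by apply: le_trans hy; rewrite ler0n.
have yD : y * D2 = drift n.+1 mu by rewrite divfK// gt_eqF.
(* The number of output copies is the integer part of [y], so rounding costs at most one copy, that
   is [D2] in drift. *)
have [ty1 ty2] : (Num.truncn y)%:R <= y /\ y < (Num.truncn y).+1%:R.
  by have /andP[] := truncn_itv y0.
have : (N2.+1 <= Num.truncn y)%N by rewrite truncn_ge_nat.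
case E : (Num.truncn y) ty1 ty2 => [//|m] ty1 ty2; rewrite ltnS => m2.
have lo : drift n.+1 mu - D2 <= m.+1%:R * D2.
  have -> : m.+1%:R * D2 = m.+2%:R * D2 - D2 by rewrite -[m.+2%:R]natr1 mulrDl mul1r addrK.
  by rewrite lerB// -yD ler_pM2r// ltW.
exists m.+1; first exact: lo.
have [U [p [q mb1]]] := basis1 n; have [W [p' [q' mb2]]] := basis2 m.
have comm_m : tpow rho2 m.+1 *m tpow sigma2 m.+1 = tpow sigma2 m.+1 *m tpow rho2 m.+1.
  by rewrite !tpow_mul comm.
rewrite (mb_comm mb2 comm_m) (mb_sigma mb2).
pose a i := drift n.+1 (z (i.+1 + r)%N).
pose c i := m.+1%:R * D2 + z i * Num.sqrt (m.+1%:R * V2).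
have [E' [chE he1 he2]] : dominates (tpow rho1 n.+1) (tpow sigma1 n.+1) (udiag W p') (udiag W q') (1 - J%:R * th) 0.
  apply: (@dominates_llr R _ _ _ _ U W p q p' q' J a c th (mb_unitary mb1) (mb_unitary mb2)
    (mb_diag mb1) (mb_sigma mb1) (mb_p0 mb1) (mb_q0 mb1) (mb_p0 mb2) (mb_q0 mb2)
    (mb_p1 mb1) (mb_q1 mb1) (mb_p1 mb2) (mb_q1 mb2)) => //.
  - by move=> i j ij; rewrite lerD2l ler_wpM2r ?sqrtr_ge0// zm// leq_add2r ltnS.
  - by move=> i j ij; rewrite lerD2l ler_wpM2r ?sqrtr_ge0// zm.
  - move=> i iJ; have iK := JK i iJ.
    have := H1 n n1 i (ltnW iJ) U p q mb1; have := H1 n n1 i.+1 iJ U p q mb1.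
    rewrite -/(drift n.+1 _) -/(drift n.+1 _) -/(a i) -/(a i.+1).
    rewrite !hz ?(leq_ltn_trans _ iK)//; last 2 first.
    - by rewrite addn3 addSn.
    - by rewrite addn3 addSn.
    rewrite -[(i.+2 + r).+1%:R]natr1 -[(i.+2 + r)%N]/((i.+1 + r).+1) mulrDl mul1r.
    rewrite !ler_norml /th.
    have -> : ka ^+ 2 = 2 * e by rewrite /e; field.
    move: (llr_mass _ _ _) (llr_mass _ _ _) (_%:R * ka).
    by move=> u v w /andP[h1 _] /andP[_ h2]; lra.
  - move=> i iJ; have iK := JK i iJ.
    have := H2 m m2 i (ltnW iJ) W p' q' mb2; have := H2 m m2 i.+1 iJ W p' q' mb2.
    rewrite -/(c i) -/(c i.+1).
    rewrite !hz ?(leq_ltn_trans _ iK)//; last 2 first.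
    - by rewrite addn3 !ltnS; do 2!apply: leqW; exact: leq_addr.
    - by rewrite addn3 !ltnS; apply: leqW; exact: leq_addr.
    rewrite -[i.+2%:R]natr1 mulrDl mul1r !ler_norml /th.
    have -> : ka ^+ 2 = 2 * e by rewrite /e; field.
    move: (llr_mass _ _ _) (llr_mass _ _ _) (_%:R * ka).
    by move=> u v w /andP[h1 _] /andP[_ h2]; lra.
  move=> i iJ; rewrite -[leRHS]lnK ?posrE ?divr_gt0// ler_expR.
  have hmD : m.+1%:R * D2 <= drift n.+1 mu by rewrite -yD ler_pM2r.
  have := H3 n n3 i iJ m.+1%:R (ler0n _ _) lo hmD.
  move: hmD; rewrite /a /c /drift.
  move: (Num.sqrt _) (Num.sqrt _) (ln _) (z i.+1) (z (i.+1 + r)%N); move=> *; lra.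
exists E'; split => //; exact: le_trans he1 Jth.
Qed.

Let F (n : nat) : R := (D1 + Num.sqrt (V1 / n%:R) * Sesq_inv nu eps) / D2.

Lemma drift_rate n mu : drift n.+1 mu / (n.+1%:R * D2) - F n.+1 =
  (mu - Sesq_inv nu eps) * Num.sqrt V1 / D2 / Num.sqrt n.+1%:R.
Proof.
have [D10 _ _ _] := so1; have [D20 _ _ _] := so2.
rewrite /F /drift sqrtrM ?ler0n// sqrtrM ?(ltW V10)// sqrtrV ?ler0n//.
have n0 : 0 < Num.sqrt n.+1%:R :> R by rewrite sqrtr_gt0.
rewrite -[X in X * D1 + _](@sqr_sqrtr R n.+1%:R) ?ler0n//.
rewrite -[X in _ / (X * D2)](@sqr_sqrtr R n.+1%:R) ?ler0n//.
by field; rewrite !gt_eqF.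
Qed.

Lemma Rstar_upper dl : 0 < dl -> exists N, forall n, (N <= n)%N ->
  (Rstar rho1 sigma1 rho2 sigma2 n.+1 eps - F n.+1) * Num.sqrt n.+1%:R <= dl.
Proof.
have [D10 _ _ _] := so1; have [D20 _ _ _] := so2 => dl0.
have sV : 0 < Num.sqrt V1 by rewrite sqrtr_gt0.
pose mu := Sesq_inv nu eps + dl * D2 / Num.sqrt V1.
have [|N1 H1] := @conversion_upper mu.
  by rewrite /mu ltrDl divr_gt0// mulr_gt0.
have [N2 H2] := @drift_large R D1 V1 mu 0 D10 V10.
exists (maxn N1 N2) => n; rewrite geq_max => /andP[n1 n2].
have nD0 : 0 < n.+1%:R * D2 by rewrite mulr_gt0.
have n0 : 0 < Num.sqrt n.+1%:R :> R by rewrite sqrtr_gt0.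
have d0 : 0 <= drift n.+1 mu := H2 n n2.
rewrite -ler_pdivlMr// lerBlDr.
have -> : dl / Num.sqrt n.+1%:R + F n.+1 = drift n.+1 mu / (n.+1%:R * D2).
  rewrite -[RHS](subrK (F n.+1)) drift_rate; congr (_ + _).
  by rewrite /mu; field; rewrite !gt_eqF.
rewrite /Rstar; set A := [set _ | _ in _].
have ubA : ubound A (drift n.+1 mu / (n.+1%:R * D2)).
  move=> _ [k /= dom <-]; rewrite ler_pdivlMr// mulrA divfK ?pnatr_eq0//.
  exact: H1 dom.
(* [sup] of the empty set is 0, below the nonnegative bound. *)
have [A0|A0] := pselect (A !=set0); first exact: ge_sup.
have -> : A = set0 by apply/eqP; rewrite -[_ == _]negbK; apply/negP => /set0P.
by rewrite sup0 divr_ge0// ltW.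
Qed.

Lemma Rstar_lower dl : rho2 *m sigma2 = sigma2 *m rho2 -> 0 < dl ->
  exists N, forall n, (N <= n)%N ->
  - dl <= (Rstar rho1 sigma1 rho2 sigma2 n.+1 eps - F n.+1) * Num.sqrt n.+1%:R.
Proof.
have [D10 _ _ _] := so1; have [D20 _ _ _] := so2 => comm dl0.
have sV : 0 < Num.sqrt V1 by rewrite sqrtr_gt0.
(* Half of [dl] goes into [mu], the other half covers the rounding loss [1 / n.+1] in the rate. *)
pose mu := Sesq_inv nu eps - dl / 2 * D2 / Num.sqrt V1.
have [|N1 H1] := @conversion_lower mu comm.
  by rewrite /mu gtrDl oppr_lt0 divr_gt0// mulr_gt0// divr_gt0.
(* Bounds the set of achievable rates, so that [sup] really lies above each of them. *)
have [|N2 H2] := @conversion_upper (Sesq_inv nu eps + 1); first by rewrite ltrDl.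
have [N3 H3] := @sqrt_natr_large R 1 (2 / dl) ltr01.
exists (maxn N1 (maxn N2 N3)) => n; rewrite !geq_max => /and3P[n1 n2 n3].
have nD0 : 0 < n.+1%:R * D2 by rewrite mulr_gt0.
have n0 : 0 < Num.sqrt n.+1%:R :> R by rewrite sqrtr_gt0.
have := H3 n n3; rewrite mulr1 ler_pdivrMr// => h3.
have [k hk dom] := H1 n n1.
rewrite -ler_pdivrMr// lerBrDr.
have kR : k%:R / n.+1%:R <= Rstar rho1 sigma1 rho2 sigma2 n.+1 eps.
  apply: ub_le_sup; last by exists k.
  exists (drift n.+1 (Sesq_inv nu eps + 1) / (n.+1%:R * D2)) => _ [j /= domj <-].
  rewrite ler_pdivlMr// mulrA divfK ?pnatr_eq0//; exact: H2 domj.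
apply: le_trans kR.
have -> : F n.+1 = drift n.+1 mu / (n.+1%:R * D2) -
    (mu - Sesq_inv nu eps) * Num.sqrt V1 / D2 / Num.sqrt n.+1%:R.
  by rewrite -drift_rate subKr.
have h : drift n.+1 mu / (n.+1%:R * D2) <= k%:R / n.+1%:R + n.+1%:R^-1.
  rewrite ler_pdivrMr// mulrDl mulrA divfK ?pnatr_eq0// mulrA mulVf ?pnatr_eq0// mul1r.
  by rewrite -lerBlDr.
have -> : (mu - Sesq_inv nu eps) * Num.sqrt V1 / D2 / Num.sqrt n.+1%:R =
    - (dl / 2 / Num.sqrt n.+1%:R).
  by rewrite /mu; field; rewrite !gt_eqF.
have hn : n.+1%:R^-1 <= dl / 2 / Num.sqrt n.+1%:R.
  rewrite ler_pdivlMr// -[X in X^-1](@sqr_sqrtr R n.+1%:R) ?ler0n// expr2 invfM -mulrA mulVf ?gt_eqF// mulr1.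
  by rewrite -div1r ler_pdivrMr// mulrAC ler_pdivlMr// mul1r mulrC.
rewrite mulNr; move: h hn; have -> : dl / Num.sqrt n.+1%:R = 2 * (dl / 2 / Num.sqrt n.+1%:R).
  by field; rewrite gt_eqF.
have arith (u v w q : R) : u <= v + w -> w <= q -> - (2 * q) + (u - - q) <= v by lra.
exact: arith.
Qed.

End SecondOrder.

Theorem theorem2 (R : realType) (d1 d2 : nat)
  (rho1 sigma1 : 'M[R[i]]_d1) (rho2 sigma2 : 'M[R[i]]_d2) (eps : R) :
  density rho1 -> density sigma1 -> density rho2 -> density sigma2 ->
  supp_le rho1 sigma1 -> supp_le rho2 sigma2 ->
  0 < relvar rho1 sigma1 -> 0 < relvar rho2 sigma2 ->
  0 < eps < 1 ->
  let D1 := relent rho1 sigma1 in let V1 := relvar rho1 sigma1 in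
  let D2 := relent rho2 sigma2 in let V2 := relvar rho2 sigma2 in
  let xi := (V1 / D1) / (V2 / D2) in
  let F := fun n : nat => (D1 + Num.sqrt (V1 / n%:R) * Sesq_inv xi^-1 eps) / D2 in
  let Rn := fun n : nat => Rstar rho1 sigma1 rho2 sigma2 n eps in
  (rho2 *m sigma2 = sigma2 *m rho2 ->
     (fun n : nat => (Rn n - F n) * Num.sqrt n%:R) @ \oo --> 0)
  /\
  (exists g : nat -> R, (fun n : nat => g n * Num.sqrt n%:R) @ \oo --> 0 /\
     forall n : nat, (0 < n)%N -> Rn n <= F n + g n).
Proof.
move=> r1 s1 r2 s2 supp1 supp2 V10 V20 eps01 D1 V1 D2 V2 xi F Rn.
have so1 := density_second_order r1 s1 supp1 V10.
have so2 := density_second_order r2 s2 supp2 V20.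
have [D10 _ _ _] := so1; have [D20 _ _ _] := so2.
have xiE : xi^-1 = V2 * D1 / (V1 * D2).
  have inv_ratio (a b c d : R) : (a / b / (c / d))^-1 = c * b / (a * d).
    by rewrite !invfM !invrK; ring.
  exact: inv_ratio.
have up dl : 0 < dl -> exists N, forall n, (N <= n)%N -> (Rn n - F n) * Num.sqrt n%:R <= dl.
  move=> dl0; have [N HN] := Rstar_upper r1 s1 r2 s2 so1 so2 V10 V20 eps01 dl0.
  exists N.+1 => -[//|n] nN; rewrite /F xiE; exact: HN.
split=> [comm|].
  apply/cvgrPdist_le => e e0; have [N1 H1] := up e e0.
  have [N2 H2] := Rstar_lower r1 s1 r2 s2 so1 so2 V10 V20 eps01 comm e0.
  exists (maxn N1 N2.+1) => // -[|n] /=; first by rewrite geq_max ltn0 andbF.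
  rewrite geq_max ltnS => /andP[n1 n2]; rewrite sub0r normrN ler_norml H1// andbT.
  by rewrite /F xiE; exact: H2.
(* The positive part of the excess satisfies the inequality at every [n] and is controlled by the
   upper estimate alone. *)
exists (fun n => Num.max 0 (Rn n - F n)); split; last first.
  by move=> n _; rewrite -lerBlDl le_max lexx orbT.
apply/cvgrPdist_le => e e0; have [N HN] := up e e0.
exists N => // n /= nN; rewrite sub0r normrN ger0_norm; last first.
  by rewrite mulr_ge0 ?sqrtr_ge0// le_max lexx.
by rewrite maxr_pMl ?sqrtr_ge0// mul0r ge_max (ltW e0) HN.
Qed.
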